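(* Let $(C,g)$ be a Lorentzian cylinder admitting a parabolic atlas $\mathcal A=\{(U_i,\phi_i);\ i\in\mathbb Z/2k\mathbb Z\}$ with translation parameter $\tau$. The surface $(C,g)$ is spacelike Zoll if and only if $\tau=0$ and there exist $k$ smooth functions $\kappa_0,\dots,\kappa_{k-1}:\mathbb R\to\mathbb R$ (indexed by $\mathbb Z/k\mathbb Z$) such that 1. for all $t\in\mathbb R$ and all $j\in\mathbb Z/k\mathbb Z$, $\kappa_j(t)\ge -1$; 2. all the functions $\kappa_j$ have the same infinite Taylor expansion at $0$ and satisfy $\kappa_j(0)=\kappa_j'(0)=0$; 3. the function $\sum_j\kappa_j$ is odd; 4. for all $i\in\mathbb Z/2k\mathbb Z$ (represented by $i\in\{0,\dots,2k-1\}$), the function $f_i$ such that $(\phi_i^{-1})^*g=y^2dx^2+2dx\,dy+f_i(y)dy^2$ satisfies $$f_i(y)=\begin{cases}\dfrac{1-(1+\kappa_{\lfloor i/2\rfloor}(y))^2}{y^2}&\text{if }y>0,\\[2mm]\dfrac{1-(1+\kappa_{\lceil i/2\rceil}(y))^2}{y^2}&\text{if }y<0,\end{cases}$$ where $\lfloor\cdot\rfloor$ and $\lceil\cdot\rceil$ are the lower and upper integral parts and the indices of $\kappa$ are taken modulo $k$.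
   Context: Conventions: a Lorentzian surface has signature $(+,-)$; $v$ is spacelike if $g(v,v)>0$. A cylinder is a surface diffeomorphic to $S^1\times\mathbb R$. A spacelike Zoll surface is a Lorentzian surface all of whose (maximal) spacelike geodesics are simply closed and have the same length. Parabolic atlas: let $(C,g)$ be a Lorentzian cylinder with an atlas $\mathcal A=\{(U_i,\phi_i);\ i\in\mathbb Z/2k\mathbb Z\}$, $k\ge1$, and transition functions $\Phi_{ij}=\phi_j\circ\phi_i^{-1}$. Put $H^+=\{(x,y)\in\mathbb R^2: y>0\}$, $H^-=\{(x,y)\in\mathbb R^2:y<0\}$. $\mathcal A$ is a parabolic atlas (with parameters $k$ and $\tau\in\mathbb R$) if: (i) $\phi_i(U_i)=\mathbb R^2$ for all $i$; (ii) the transition functions are $\Phi_{2i,2i+1}:H^+\to H^+$, $(x,y)\mapsto(-x+\frac2y,y)$ for all $i$; $\Phi_{2i-1,2i}:H^-\to H^-$, $(x,y)\mapsto(-x+\frac2y,y)$ for $i\ne0$; and $\Phi_{2k-1,0}:H^-\to H^-$, $(x,y)\mapsto(-x+\frac2y+\tau,y)$ (the charts are glued only along these half-planes; when $k=1$, $U_0$ and $U_1$ are glued along both half-planes); (iii) for all $i$, $(\phi_i^{-1})^*g=y^2dx^2+2dx\,dy+f_i(y)dy^2$ with $f_i$ a smooth function on $\mathbb R$ satisfying $1-y^2f_i(y)>0$ for all $y\in\mathbb R$. *)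

(* Defs.v *)
From HB Require Import structures.
From mathcomp Require Import all_boot all_order all_algebra.
From mathcomp Require Import all_classical all_reals all_analysis.

Set Implicit Arguments.
Unset Strict Implicit.
Unset Printing Implicit Defensive.

Import Order.TTheory GRing.Theory Num.Theory.
Import numFieldNormedType.Exports.

Local Open Scope ring_scope.
Local Open Scope classical_set_scope.

Section Smooth.
Context {R : realType} {V W : normedModType R}.

(* Meant for A open and V finite-dimensional, where this is the usual C^n:
   all iterated directional derivatives up to order n exist and are
   continuous on A. *)
Fixpoint Cn_on (n : nat) (A : set V) (f : V -> W) : Prop :=
  (forall x, A x -> {for x, continuous f}) /\
  if n is m.+1 then
    forall v, (forall x, A x -> derivable f x v) /\ Cn_on m A ('D_v f)
  else True.

Definition smooth_on (A : set V) (f : V -> W) : Prop := forall n, Cn_on n A f.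

End Smooth.

Section Charts.
Context {R : realType} {T : topologicalType}.

(* chart_map and chart_inv are total functions; they are only meaningful on
   chart_dom and chart_img respectively. *)
Record chart := Chart {
  chart_dom : set T;
  chart_map : T -> R * R;
  chart_inv : R * R -> T }.

Definition chart_img (c : chart) : set (R * R) := chart_map c @` chart_dom c.

Definition is_chart (c : chart) : Prop :=
  [/\ open (chart_dom c),
      open (chart_img c),
      forall p, chart_dom c p -> chart_inv c (chart_map c p) = p,
      forall p, chart_dom c p -> {for p, continuous (chart_map c)} &
      forall q, chart_img c q -> {for q, continuous (chart_inv c)}].

Definition overlap (c c' : chart) : set (R * R) :=
  chart_map c @` (chart_dom c `&` chart_dom c').

Definition transition (c c' : chart) : R * R -> R * R :=
  chart_map c' \o chart_inv c.

Definition compatible (c c' : chart) : Prop :=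
  smooth_on (overlap c c') (transition c c') /\
  smooth_on (overlap c' c) (transition c' c).

End Charts.
Arguments chart : clear implicits.

(* The smooth structure is given by its maximal atlas. *)
Record surface (R : realType) := Surface {
  point :> topologicalType;
  atlas : set (chart R point);
  surface_hausdorff : hausdorff_space point;
  surface_second_countable : @second_countable point;
  atlas_is_chart : forall c, atlas c -> is_chart c;
  atlas_cover : forall p : point, exists c, atlas c /\ chart_dom c p;
  atlas_compatible : forall c c', atlas c -> atlas c' -> compatible c c';
  atlas_maximal : forall c, is_chart c ->
    (forall c', atlas c' -> compatible c c') -> atlas c }.

Section Surfaces.
Context {R : realType} (S : surface R).

Definition chart_at (p : S) : chart R S := sval (cid (atlas_cover p)).

Definition smooth_from (W : normedModType R) (F : S -> W) : Prop :=
  forall c, atlas c -> smooth_on (chart_img c) (F \o chart_inv c).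

Definition smooth_into (V : normedModType R) (A : set V) (G : V -> S) : Prop :=
  (forall x, A x -> {for x, continuous G}) /\
  forall c, atlas c ->
    smooth_on (A `&` G @^-1` chart_dom c) (chart_map c \o G).

Definition std_cylinder : set (R * R * R) :=
  [set p | p.1.1 ^+ 2 + p.1.2 ^+ 2 = 1].

(* S is diffeomorphic to std_cylinder = S^1 x R, seen as a submanifold of R^3:
   a map is smooth on a submanifold when it is the restriction of a smooth map
   defined on an open neighbourhood. *)
Definition cylinder : Prop :=
  exists (F : S -> R * R * R) (G : R * R * R -> S) (A : set (R * R * R)),
    [/\ open A /\ std_cylinder `<=` A,
        smooth_from F /\ smooth_into A G,
        forall p, std_cylinder (F p),
        forall p, G (F p) = p &
        forall z, std_cylinder z -> F (G z) = z].

(* pullback c q is the bilinear form on R^2 given at q by the pull-back of the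
   metric under the inverse of the chart c; pullback_transition says that these
   local expressions define a tensor field on S. *)
Record lorentzian_metric := LorentzianMetric {
  pullback : chart R S -> R * R -> R * R -> R * R -> R;
  pullback_linear : forall c q, atlas c -> chart_img c q ->
    forall (a : R) u u' v, pullback c q (a *: u + u') v =
      a * pullback c q u v + pullback c q u' v;
  pullback_sym : forall c q, atlas c -> chart_img c q ->
    forall u v, pullback c q u v = pullback c q v u;
  pullback_signature : forall c q, atlas c -> chart_img c q ->
    exists u v, [/\ pullback c q u u = 1, pullback c q v v = -1 &
                    pullback c q u v = 0];
  pullback_smooth : forall c, atlas c ->
    forall u v, smooth_on (chart_img c) (fun q => pullback c q u v);
  pullback_transition : forall c c' q, atlas c -> atlas c' ->
    overlap c c' q -> forall u v,
    pullback c q u v = pullback c' (transition c c' q)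
                         ('D_u (transition c c') q) ('D_v (transition c c') q) }.

End Surfaces.

Section Geodesics.
Context {R : realType} {S : surface R} (g : lorentzian_metric S).

(* Christoffel symbols of the first kind: christoffel c q u v w is
   g(nabla_u v, w) at q for constant vector fields u, v, w of the chart c,
   by the Koszul formula. *)
Definition christoffel (c : chart R S) (q u v w : R * R) : R :=
  2^-1 * ('D_u (fun z => pullback g c z v w) q
        + 'D_v (fun z => pullback g c z u w) q
        - 'D_w (fun z => pullback g c z u v) q).

(* The last clause says g(nabla_{gamma'} gamma', w) = 0 for all w, i.e.
   nabla_{gamma'} gamma' = 0 since g is nondegenerate. *)
Definition geodesic (J : set R) (gamma : R -> S) : Prop :=
  [/\ open J, is_interval J, J !=set0, smooth_into J gamma &
      forall c t, atlas c -> J t -> chart_dom c (gamma t) ->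
        let x := chart_map c \o gamma in
        forall w, pullback g c (x t) (x^`(2) t) w
                  + christoffel c (x t) (x^`() t) (x^`() t) w = 0].

Definition maximal_geodesic (J : set R) (gamma : R -> S) : Prop :=
  geodesic J gamma /\
  forall J' gamma', geodesic J' gamma' -> J `<=` J' ->
    (forall t, J t -> gamma' t = gamma t) -> J' = J.

(* g(gamma'(t), gamma'(t)); by pullback_transition it does not depend on the
   chart around gamma(t). *)
Definition sq_velocity (gamma : R -> S) (t : R) : R :=
  let c := chart_at (gamma t) in
  let x := chart_map c \o gamma in
  pullback g c (x t) (x^`() t) (x^`() t).

Definition spacelike (J : set R) (gamma : R -> S) : Prop :=
  forall t, J t -> 0 < sq_velocity gamma t.

Definition simply_closed (T : R) (gamma : R -> S) : Prop :=
  [/\ 0 < T, forall t, gamma (t + T) = gamma t &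
      forall s t, 0 <= s < T -> 0 <= t < T -> gamma s = gamma t -> s = t].

Definition curve_length (T : R) (gamma : R -> S) : R :=
  \int[lebesgue_measure]_(t in `[0, T]) Num.sqrt (sq_velocity gamma t).

Definition spacelike_zoll : Prop :=
  exists L : R, forall J gamma, maximal_geodesic J gamma -> spacelike J gamma ->
    J = setT /\ exists T, simply_closed T gamma /\ curve_length T gamma = L.

End Geodesics.

Section ParabolicAtlas.
Context {R : realType} {S : surface R} (g : lorentzian_metric S).

(* Indices in Z/2kZ are represented by 'I_(2 * k), with cyclic successor ordS.
   U_i and U_j are glued along y > 0 (resp. y < 0) when {i, j} = {l, l + 1} with
   l even (resp. odd); for k = 1 both hold for {i, j} = {0, 1}. *)
Definition glued_up n (i j : 'I_n) : bool :=
  (~~ odd i && (j == ordS i)) || (~~ odd j && (i == ordS j)).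

Definition glued_down n (i j : 'I_n) : bool :=
  (odd i && (j == ordS i)) || (odd j && (i == ordS j)).

Definition parabolic_atlas (k : nat) (tau : R)
    (phi : 'I_(2 * k) -> chart R S) (f : 'I_(2 * k) -> R -> R) : Prop :=
  [/\ (forall i, atlas (phi i)) /\ (forall p, exists i, chart_dom (phi i) p),
      forall i, chart_img (phi i) = setT,
      forall i j, i != j -> overlap (phi i) (phi j) =
        [set q | (glued_up i j /\ 0 < q.2) \/ (glued_down i j /\ q.2 < 0)],
      (forall (i : 'I_(2 * k)) (q : R * R), ~~ odd i -> 0 < q.2 ->
         transition (phi i) (phi (ordS i)) q = (- q.1 + 2 / q.2, q.2)) /\
      (forall (i : 'I_(2 * k)) (q : R * R), odd i -> q.2 < 0 ->
         transition (phi i) (phi (ordS i)) q =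
         (- q.1 + 2 / q.2 + (if i.+1 == (2 * k)%N then tau else 0), q.2)) &
      forall i, [/\ smooth_on setT (f i),
        forall y, 0 < 1 - y ^+ 2 * f i y &
        (* y^2 dx^2 + 2 dx dy + f_i(y) dy^2 *)
        forall q u v, pullback g (phi i) q u v =
          q.2 ^+ 2 * (u.1 * v.1) + (u.1 * v.2 + u.2 * v.1)
          + f i q.2 * (u.2 * v.2)]].

End ParabolicAtlas.

(* Main.v *)
(* Write [h_i = sqrt (1 - y^2 f_i)].  The coordinate [y] is global and in each
   chart [d/dx] is a Killing field, so spacelike geodesics can be integrated: up
   to a reparametrization each of them is [y = a sin theta],
   [x = +-(tan ((theta - i pi) / 2) / a - a M(theta) + x0)] for
   [|theta - i pi| < pi] in the [i]-th chart (indices lifted to the integers),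
   where [M'(theta)] is the value of [(1 - h_i) / y^2] at [a sin theta], and
   [theta] moves with speed [e / h_i].  One turn of [theta] through [2 k pi]
   translates [x] by [tau - a M(2 k pi)], so that all spacelike geodesics close
   if and only if this vanishes for every [a > 0].

   Put [kappa_j = h_{2j} - 1].  Then [M(2 k pi)] is the integral over [[0, pi]]
   of [F (a sin theta)], with [y^2 F(y) = - sum_j (kappa_j(y) + kappa_j(-y))] for
   [y > 0].  Letting [a] tend to [0] gives [tau = 0], and injectivity of the Abel
   transform gives [F = 0], i.e. oddness of the sum.  Conversely, if [tau = 0]
   and [F = 0] then every spacelike geodesic is simply closed of length [2 k pi].
   The common Taylor expansion of the [kappa_j] says that charts glued along a
   half-plane share the jet of [f_i] at [y = 0]. *)

(* The angle comes from the identity [C^2 = (h y')^2 + E y^2] between the Clairaut constant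
   [C = g(gamma', d/dx)], the energy [E] and [h^2 = 1 - y^2 f], which is minus the determinant of
   the metric. For [E > 0] it forces [C <> 0] and places [(h y' / C, +- y / a)], with
   [a = |C| / sqrt E], on the unit circle; the angle of this point obeys a first-order equation,
   solved by one primitive and one inverse function. So inside a chart a spacelike geodesic is
   computed from its first integrals, without an existence or uniqueness theorem for the
   second-order equation, and it is continued from chart to chart by an open-closed argument. As [x]
   has poles at [theta - i pi = +- pi], a chart sees one strip of angles only; the term [2 / y] of
   the gluing maps is, up to sign, [(tan u + cot u) / a] with [u = (theta - i pi) / 2]. The quotient
   [(1 - h) / y^2] is written [f / (1 + h)], which is smooth across [y = 0]. The Abel transform is
   injective because iterating it with weight [y] sends [y^n] to [2 pi] times its primitive, by the
   Wallis relation [(n + 1) W_n W_(n+1) = 2 pi]. *)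
Require Import Defs.
From mathcomp Require Import all_boot all_order all_algebra.
From mathcomp Require Import all_classical all_reals all_analysis.
From mathcomp Require Import ring lra zify.

Set Implicit Arguments.
Unset Strict Implicit.
Unset Printing Implicit Defensive.

Import Order.TTheory GRing.Theory Num.Theory.
Import numFieldNormedType.Exports.

Local Open Scope ring_scope.
Local Open Scope classical_set_scope.

(** * Smooth maps *)

Section DerivePair.
Context {R : realType} {V W1 W2 : normedModType R}.

Lemma is_derive_pair (a : V -> W1) (b : V -> W2) (x v : V) da db :
  is_derive x v a da -> is_derive x v b db ->
  is_derive x v (fun z => (a z, b z)) (da, db).
Proof.
move=> [da1 da2] [db1 db2].
have H : (fun h : R => h^-1 *: (((fun z => (a z, b z)) \o shift x) (h *: v)
    - (a x, b x))) @ 0^' --> (da, db).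
  by rewrite -da2 -db2; apply: (cvg_pair da1 db1).
by split; [exact: cvgP H|apply: cvg_lim H].
Qed.

Lemma is_derive_fst (f : V -> W1 * W2) (x v : V) df :
  is_derive x v f df -> is_derive x v (fun z => (f z).1) df.1.
Proof.
move=> [d1 d2].
have H : (fun h : R => h^-1 *: (((fun z => (f z).1) \o shift x) (h *: v)
    - (f x).1)) @ 0^' --> df.1.
  rewrite -d2; apply: (cvg_comp _ fst d1); exact: cvg_fst.
by split; [exact: cvgP H|apply: cvg_lim H].
Qed.

Lemma is_derive_snd (f : V -> W1 * W2) (x v : V) df :
  is_derive x v f df -> is_derive x v (fun z => (f z).2) df.2.
Proof.
move=> [d1 d2].
have H : (fun h : R => h^-1 *: (((fun z => (f z).2) \o shift x) (h *: v)
    - (f x).2)) @ 0^' --> df.2.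
  rewrite -d2; apply: (cvg_comp _ snd d1); exact: cvg_snd.
by split; [exact: cvgP H|apply: cvg_lim H].
Qed.

End DerivePair.

Section CnOn.
Context {R : realType} {V W : normedModType R}.
Implicit Types (A : set V) (f g : V -> W).

Lemma Cn_on_continuous n A f x : Cn_on n A f -> A x -> {for x, continuous f}.
Proof. by case: n => [|n] [h _]; exact: h. Qed.

Lemma Cn_onS n A f : Cn_on n.+1 A f -> Cn_on n A f.
Proof.
elim: n f => [|n IH] f /= [cf Hf]; first by split.
split => // v; have [df Cf] := Hf v; split => //.
exact: IH Cf.
Qed.

Lemma Cn_on_subset n A B f : B `<=` A -> Cn_on n A f -> Cn_on n B f.
Proof.
move=> BA; elim: n f => [|n IH] f /= [cf Hf]; split => //.
- by move=> x /BA; exact: cf.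
- by move=> x /BA; exact: cf.
- move=> v; have [df Cf] := Hf v; split; last exact: IH.
  by move=> x /BA; exact: df.
Qed.

Lemma Cn_on_ext n A f g : open A -> (forall x, A x -> f x = g x) ->
  Cn_on n A f -> Cn_on n A g.
Proof.
move=> oA; elim: n f g => [|n IH] f g fg /= [cf Hf].
  split => // x Ax.
  have nfg : \near x, f x = g x by apply: filterS fg _; exact: open_nbhs_nbhs.
  suff : g @ x --> g x by [].
  rewrite -(fg _ Ax).
  by apply: cvg_trans (cf _ Ax); apply: near_eq_cvg.
have nfg x : A x -> \near x, f x = g x.
  by move=> Ax; apply: filterS fg _; exact: open_nbhs_nbhs.
split.
  move=> x Ax; suff : g @ x --> g x by [].
  rewrite -(fg _ Ax).
  by apply: cvg_trans (cf _ Ax); apply: near_eq_cvg; exact: nfg.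
move=> v; have [df Cf] := Hf v; split.
  move=> x Ax; apply: near_eq_derivable (nfg x Ax) (df x Ax).
apply: IH Cf => x Ax; apply: near_eq_derive; exact: nfg.
Qed.

Lemma Cn_on_cst n A (c : W) : Cn_on n A (cst c).
Proof.
elim: n c => [|n IH] c; split=> //.
- by move=> x _; exact: cst_continuous.
- by move=> x _; exact: cst_continuous.
- move=> v; split; first by move=> x _; exact: derivable_cst.
  rewrite (_ : 'D_v (cst c) = cst 0) //; apply/funext => x.
  by rewrite derive_cst.
Qed.

Lemma Cn_onD n A f g : open A -> Cn_on n A f -> Cn_on n A g ->
  Cn_on n A (fun x => f x + g x).
Proof.
move=> oA; elim: n f g => [|n IH] f g [cf Hf] [cg Hg]; split => //.
- by move=> x Ax; apply: cvgD; [exact: cf|exact: cg].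
- by move=> x Ax; apply: cvgD; [exact: cf|exact: cg].
move=> v; have [df Cf] := Hf v; have [dg Cg] := Hg v; split.
  by move=> x Ax; apply: derivableD; [exact: df|exact: dg].
apply: (@Cn_on_ext n A (fun x => 'D_v f x + 'D_v g x)) => //; last exact: IH.
by move=> x Ax; rewrite [RHS]deriveD //; [exact: df|exact: dg].
Qed.

Lemma Cn_onZ n A f (k : R) : open A -> Cn_on n A f ->
  Cn_on n A (fun x => k *: f x).
Proof.
move=> oA; elim: n f => [|n IH] f [cf Hf]; split => //.
- by move=> x Ax; apply: cvgZr; exact: cf.
- by move=> x Ax; apply: cvgZr; exact: cf.
move=> v; have [df Cf] := Hf v; split.
  by move=> x Ax; apply: derivableZ; exact: df.
apply: (@Cn_on_ext n A (fun x => k *: 'D_v f x)) => //; last exact: IH.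
by move=> x Ax; rewrite [RHS]deriveZ //; exact: df.
Qed.

End CnOn.

Section CnOnPair.
Context {R : realType} {V W1 W2 : normedModType R}.

Lemma Cn_on_fst n (A : set V) (f : V -> W1 * W2) :
  open A -> Cn_on n A f -> Cn_on n A (fun x => (f x).1).
Proof.
move=> oA; elim: n f => [|n IH] f [cf Hf].
  by split => // x Ax; apply: (cvg_comp _ fst (cf x Ax)); exact: cvg_fst.
split; first by move=> x Ax; apply: (cvg_comp _ fst (cf x Ax)); exact: cvg_fst.
move=> v; have [df Cf] := Hf v.
have D x : A x -> is_derive x v (fun z => (f z).1) ('D_v f x).1.
  by move=> Ax; apply: is_derive_fst; apply: derivableP; exact: df.
split; first by move=> x Ax; case: (D x Ax).
apply: (@Cn_on_ext _ _ _ n A (fun x => ('D_v f x).1)) => //; last exact: IH.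
by move=> x Ax; case: (D x Ax).
Qed.

Lemma Cn_on_snd n (A : set V) (f : V -> W1 * W2) :
  open A -> Cn_on n A f -> Cn_on n A (fun x => (f x).2).
Proof.
move=> oA; elim: n f => [|n IH] f [cf Hf].
  by split => // x Ax; apply: (cvg_comp _ snd (cf x Ax)); exact: cvg_snd.
split; first by move=> x Ax; apply: (cvg_comp _ snd (cf x Ax)); exact: cvg_snd.
move=> v; have [df Cf] := Hf v.
have D x : A x -> is_derive x v (fun z => (f z).2) ('D_v f x).2.
  by move=> Ax; apply: is_derive_snd; apply: derivableP; exact: df.
split; first by move=> x Ax; case: (D x Ax).
apply: (@Cn_on_ext _ _ _ n A (fun x => ('D_v f x).2)) => //; last exact: IH.
by move=> x Ax; case: (D x Ax).
Qed.

Lemma Cn_on_pair n (A : set V) (a : V -> W1) (b : V -> W2) :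
  open A -> Cn_on n A a -> Cn_on n A b -> Cn_on n A (fun x => (a x, b x)).
Proof.
move=> oA; elim: n a b => [|n IH] a b [ca Ha] [cb Hb].
  by split => // x Ax; apply: cvg_pair; [exact: ca|exact: cb].
split; first by move=> x Ax; apply: cvg_pair; [exact: ca|exact: cb].
move=> v; have [da Ca] := Ha v; have [db Cb] := Hb v.
have D x : A x ->
    is_derive x v (fun z => (a z, b z)) ('D_v a x, 'D_v b x).
  by move=> Ax; apply: is_derive_pair; apply: derivableP; [exact: da|exact: db].
split; first by move=> x Ax; case: (D x Ax).
apply: (@Cn_on_ext _ _ _ n A (fun x => ('D_v a x, 'D_v b x))) => //.
  by move=> x Ax; case: (D x Ax).
exact: IH.
Qed.

End CnOnPair.

Section CnOnScalar.
Context {R : realType} {V : normedModType R}.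
Implicit Types (A : set V) (f g : V -> R).

Lemma Cn_onM n A f g : open A -> Cn_on n A f -> Cn_on n A g ->
  Cn_on n A (fun x => f x * g x).
Proof.
move=> oA; elim: n f g => [|n IH] f g Cf Cg.
  case: Cf Cg => [cf _] [cg _]; split=> //.
  by move=> x Ax; apply: cvgM; [exact: cf|exact: cg].
case: (Cf) (Cg) => [cf Hf] [cg Hg]; split.
  by move=> x Ax; apply: cvgM; [exact: cf|exact: cg].
move=> v; have [df Df] := Hf v; have [dg Dg] := Hg v; split.
  by move=> x Ax; apply: derivableM; [exact: df|exact: dg].
apply: (@Cn_on_ext _ _ _ n A (fun x => f x * 'D_v g x + g x * 'D_v f x)) => //.
  by move=> x Ax; rewrite [RHS]deriveM //; [exact: df|exact: dg].
by apply: Cn_onD => //; apply: IH => //; exact: Cn_onS.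
Qed.

Lemma Cn_onV n A f : open A -> (forall x, A x -> f x != 0) -> Cn_on n A f ->
  Cn_on n A (fun x => (f x)^-1).
Proof.
move=> oA f0; elim: n => [|n IH] Cf.
  case: Cf => [cf _]; split=> //.
  by move=> x Ax; apply: cvgV; [exact: f0|exact: cf].
case: (Cf) => [cf Hf]; split.
  by move=> x Ax; apply: cvgV; [exact: f0|exact: cf].
move=> v; have [df Df] := Hf v; split.
  by move=> x Ax; apply: derivableV; [exact: f0|exact: df].
apply: (@Cn_on_ext _ _ _ n A (fun x => -1 *: ((f x)^-1 * (f x)^-1 * 'D_v f x))) => //.
  move=> x Ax; rewrite [RHS]deriveV //; [|exact: f0|exact: df].
  by rewrite scaleN1r /= scaleNr -exprVn.
have C1 : Cn_on n A (fun x => (f x)^-1) by apply: IH; exact: Cn_onS.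
by apply: Cn_onZ => //; apply: Cn_onM => //; exact: Cn_onM.
Qed.

End CnOnScalar.

Section CnOnLine.
Context {R : realType} {W : normedModType R}.
Implicit Types (A : set R).

Lemma derive_line (f : R -> W) (x v : R) (df : W) :
  is_derive x 1 f df -> is_derive x v f (v *: df).
Proof.
move=> [d1 <-]; have d := (derivable1_diffP _ _).1 d1; split.
  exact: diff_derivable.
by rewrite !deriveE // -{1}(mulr1 v) -[v * 1]/(v *: (1 : R)) linearZ.
Qed.

(** [Cn_on] asks for derivatives along every [v]; on the line the one along [v] is [v] times the one
    along [1], so a single derivative decides. *)
Lemma Cn_on_line n A (f f' : R -> W) : open A ->
  (forall x, A x -> is_derive x 1 f (f' x)) -> Cn_on n A f' -> Cn_on n.+1 A f.
Proof.
move=> oA Df Cf'; split.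
  move=> x /Df [d _]; apply: differentiable_continuous.
  exact/derivable1_diffP.
move=> v; split; first by move=> x /Df /(derive_line v) [].
apply: (@Cn_on_ext _ _ _ n A (fun x => v *: f' x)) => //; last exact: Cn_onZ.
by move=> x /Df /(derive_line v) [].
Qed.

Lemma Cn_on_derivable n A (f : R -> W) x :
  Cn_on n.+1 A f -> A x -> is_derive x 1 f (f^`() x).
Proof.
by move=> [_ /(_ 1) [+ _]] => /[apply] d; rewrite derive1E; apply: derivableP.
Qed.

Lemma Cn_on_derive1 n A (f : R -> W) : Cn_on n.+1 A f -> Cn_on n A f^`().
Proof.
move=> [_ /(_ 1) [_]]; rewrite (_ : f^`() = 'D_1 f) //.
by apply/funext => x; rewrite derive1E.
Qed.

Lemma smooth_on_derive1 A (f : R -> W) : smooth_on A f -> smooth_on A f^`().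
Proof. by move=> sf n; apply: Cn_on_derive1; exact: sf. Qed.

Lemma smooth_on_line A (f f' : R -> W) : open A ->
  (forall x, A x -> is_derive x 1 f (f' x)) -> smooth_on A f' -> smooth_on A f.
Proof.
move=> oA Df sf' n; apply: Cn_onS; exact: (Cn_on_line oA Df (sf' n)).
Qed.

End CnOnLine.

Section CnOnReal.
Context {R : realType}.
Implicit Types (A B : set R) (f g u : R -> R).

Lemma Cn_on_id n (A : set R) : Cn_on n A id.
Proof.
elim: n => [|n _]; first by split=> // x _; exact: cvg_id.
split; first by move=> x _; exact: cvg_id.
move=> v; split; first by move=> x _; exact: derivable_id.
rewrite (_ : 'D_v id = cst v); first exact: Cn_on_cst.
by apply/funext => x; rewrite derive_id.
Qed.

Lemma Cn_on_comp n A B f u : open A -> open B ->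
  (forall x, A x -> B (u x)) ->
  Cn_on n B f -> Cn_on n A u -> Cn_on n A (f \o u).
Proof.
move=> oA oB AB; elim: n f => [|n IH] f Cf Cu.
  split=> // x Ax; apply: continuous_comp.
    exact: Cn_on_continuous Cu Ax.
  by apply: Cn_on_continuous Cf _; exact: AB.
have D x : A x -> is_derive x 1 (f \o u) (derive1 f (u x) * derive1 u x).
  move=> Ax; apply: is_derive1_comp.
    by apply: Cn_on_derivable Cf _; exact: AB.
  exact: Cn_on_derivable Cu Ax.
apply: (Cn_on_line oA D).
apply: Cn_onM => //; last exact: Cn_on_derive1.
by apply: IH; [exact: Cn_on_derive1|exact: Cn_onS].
Qed.

Lemma smooth_on_comp A B f u : open A -> open B ->
  (forall x, A x -> B (u x)) ->
  smooth_on B f -> smooth_on A u -> smooth_on A (f \o u).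
Proof. by move=> oA oB AB sf su n; exact: (Cn_on_comp oA oB AB). Qed.

Lemma smooth_onM A f g : open A -> smooth_on A f -> smooth_on A g ->
  smooth_on A (fun x => f x * g x).
Proof. by move=> oA sf sg n; exact: Cn_onM. Qed.

Lemma smooth_onD A f g : open A -> smooth_on A f -> smooth_on A g ->
  smooth_on A (fun x => f x + g x).
Proof. by move=> oA sf sg n; exact: Cn_onD. Qed.

Lemma smooth_onZ A f (k : R) : open A -> smooth_on A f ->
  smooth_on A (fun x => k * f x).
Proof. by move=> oA sf n; exact: Cn_onZ. Qed.

Lemma smooth_onV A f : open A -> (forall x, A x -> f x != 0) ->
  smooth_on A f -> smooth_on A (fun x => (f x)^-1).
Proof. by move=> oA f0 sf n; exact: Cn_onV. Qed.

Lemma smooth_on_subset A B f : B `<=` A -> smooth_on A f -> smooth_on B f.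
Proof. by move=> BA sf n; apply: Cn_on_subset BA _; exact: sf. Qed.

Lemma smooth_on_ext A f g : open A -> (forall x, A x -> f x = g x) ->
  smooth_on A f -> smooth_on A g.
Proof. by move=> oA fg sf n; apply: Cn_on_ext fg _ => //; exact: sf. Qed.

Lemma smooth_on_id A : smooth_on A (@id R).
Proof. by move=> n; exact: Cn_on_id. Qed.

Lemma smooth_on_cst A (c : R) : smooth_on A (cst c : R -> R).
Proof. by move=> n; exact: Cn_on_cst. Qed.

Lemma smooth_on_is_derive A f x : smooth_on A f -> A x ->
  is_derive x 1 f (f^`() x).
Proof. by move=> sf; exact: Cn_on_derivable (sf 1%N). Qed.

Lemma smooth_on_continuous A f x : smooth_on A f -> A x ->
  {for x, continuous f}.
Proof. by move=> sf; exact: Cn_on_continuous (sf 0%N). Qed.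

Lemma smooth_sin_cos :
  smooth_on setT (@sin R) /\ smooth_on setT (@cos R).
Proof.
suff H n : Cn_on n setT (@sin R) /\ Cn_on n setT (@cos R).
  by split=> n; have [Hs Hc] := H n; [exact: Hs|exact: Hc].
elim: n => [|n [IHs IHc]].
  split; split=> // x _; [exact: continuous_sin|exact: continuous_cos].
split.
  apply: (@Cn_on_line R R n setT sin cos); [exact: openT|exact: IHc].
apply: (@Cn_on_line R R n setT cos (fun x => -1 *: sin x)).
- exact: openT.
- by move=> x _; rewrite scaleN1r; exact: is_derive_cos.
- by apply: Cn_onZ; [exact: openT|exact: IHs].
Qed.

(** Bootstrap: if [u] is of class C^n then so is [u' = F o u], hence [u] is of class C^(n+1). *)
Lemma smooth_on_ode A B u F : open A -> open B ->
  (forall x, A x -> B (u x)) -> smooth_on B F ->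
  (forall x, A x -> is_derive x 1 u (F (u x))) -> smooth_on A u.
Proof.
move=> oA oB AB sF du; elim=> [|n IH].
  split=> // x /du [d _]; apply: differentiable_continuous.
  exact/derivable1_diffP.
apply: (Cn_on_line oA du); exact: (Cn_on_comp oA oB AB).
Qed.

Lemma smooth_on_sqrt A u : open A -> (forall x, A x -> 0 < u x) ->
  smooth_on A u -> smooth_on A (fun x => Num.sqrt (u x)).
Proof.
move=> oA u0 su.
have D x : A x -> is_derive x 1 (fun x => Num.sqrt (u x))
    ((2 * Num.sqrt (u x))^-1 * derive1 u x).
  move=> Ax; apply: (@is_derive1_comp _ Num.sqrt); last first.
    exact: smooth_on_is_derive Ax.
  by apply: is_derive1_sqrt; exact: u0.
elim=> [|n IH].
  split=> // x /D [d _]; apply: differentiable_continuous.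
  exact/derivable1_diffP.
apply: (Cn_on_line oA D); apply: Cn_onM => //; last first.
  by apply: Cn_on_derive1; exact: su.
apply: Cn_onV => //; last exact: Cn_onZ.
by move=> x Ax; rewrite mulf_neq0 ?pnatr_eq0// gt_eqF// sqrtr_gt0; exact: u0.
Qed.

End CnOnReal.

(** * Mean values, primitives and inverse functions on the line *)

Section RealCalculus.
Context {R : realType}.
Implicit Types (f g F : R -> R) (J : set R).

Lemma is_derive1_continuous f (x df : R) :
  is_derive x 1 f df -> {for x, continuous f}.
Proof.
by move=> [d _]; apply: differentiable_continuous; apply/derivable1_diffP.
Qed.

Lemma mean_value f df (a b : R) : a < b ->
  (forall x, a <= x <= b -> is_derive x 1 f (df x)) ->
  exists2 c, a < c < b & f b - f a = df c * (b - a).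
Proof.
move=> ab Df.
have cf : {within `[a, b], continuous f}.
  apply: continuous_in_subspaceT => x; rewrite inE /= in_itv /= => xab.
  exact: is_derive1_continuous (Df x xab).
have Df' x : x \in `]a, b[%R -> is_derive x 1 f (df x).
  by rewrite in_itv /= => /andP[ax xb]; apply: Df; rewrite !ltW.
by have [c cab E] := MVT ab Df' cf; exists c => //; move: cab; rewrite in_itv.
Qed.

Lemma derive0_constant_in J f : is_interval J ->
  (forall x, J x -> is_derive x 1 f 0) ->
  forall x y, J x -> J y -> f x = f y.
Proof.
move=> iJ Df; suff H x y : J x -> J y -> x < y -> f x = f y.
  move=> x y Jx Jy; case: (ltgtP x y) => [xy|yx|-> //]; first exact: H.
  by apply/esym; exact: H.
move=> Jx Jy xy.
have [z|c _ /eqP] := @mean_value f (cst 0) x y xy.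
  by move=> zxy; apply: Df; exact: iJ zxy.
by rewrite /= mul0r subr_eq0 => /eqP.
Qed.

Lemma derive_increasing f df (a b : R) : a < b ->
  (forall x, a <= x <= b -> is_derive x 1 f (df x)) ->
  (forall x, a <= x <= b -> 0 < df x) -> f a < f b.
Proof.
move=> ab Df df0; have [c /andP[ac cb] E] := mean_value ab Df.
by rewrite -subr_gt0 E mulr_gt0 ?subr_gt0// df0// !ltW.
Qed.

Lemma antiderivative_itv g (n : R) : continuous g -> 0 < n ->
  exists F, F 0 = 0 /\ forall x, - n < x < n -> is_derive x 1 F (g x).
Proof.
move=> cg n0.
pose F y : R := \int[lebesgue_measure]_(t in [set` `[- n, y]%R]) g t.
have intg : lebesgue_measure.-integrable [set` `[- n, n]%R] (EFin \o g).
  apply: continuous_compact_integrable; first exact: segment_compact.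
  exact: continuous_subspaceT.
have DF x : - n < x < n -> is_derive x 1 F (g x).
  move=> /andP[nx xn].
  have := @continuous_FTC1 R g (BLeft (- n)) x n xn intg.
  move=> /(_ _ (cg x)); rewrite lte_fin => /(_ nx) [d e].
  by split; [exact: d|rewrite -derive1E; exact: e].
exists (fun x => F x - F 0); rewrite subrr; split => // x xn.
rewrite -[g x]subr0; apply: is_deriveB; exact: DF.
Qed.

(** The integral yields a primitive on each bounded interval []-n, n[]; normalized at [0], two of
    them agree on the smaller interval, so they patch together. *)
Lemma antiderivative g : continuous g ->
  exists F, F 0 = 0 /\ forall x : R, is_derive x 1 F (g x).
Proof.
move=> cg.
have H (n : R) : exists F, 0 < n ->
    F 0 = 0 /\ forall x, - n < x < n -> is_derive x 1 F (g x).
  have [n0|n0] := ltP 0 n; last by exists (cst 0).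
  by have [F HF] := antiderivative_itv cg n0; exists F.
have [F HF] := choice H.
(* The value at [x] is read off the primitive on []-N x, N x[], an interval that varies with [x]. *)
pose N (x : R) := `|x| + 1.
have N0 x : 0 < N x by rewrite ltr_wpDl.
have FE x y : N y <= N x -> F (N x) y = F (N y) y.
  move=> yx; have [F0 DF] := HF _ (N0 x); have [G0 DG] := HF _ (N0 y).
  apply/eqP; rewrite -subr_eq0; apply/eqP.
  have := @derive0_constant_in [set z | - N y < z < N y]
     (fun z => F (N x) z - F (N y) z) _ _ y 0; rewrite F0 G0 subr0; apply.
  - move=> u v /= /andP[nu _] /andP[_ nv] z /andP[uz zv].
    by rewrite (lt_le_trans nu)//= (le_lt_trans zv).
  - move=> z /= zn; rewrite -(subrr (g z)); apply: is_deriveB; last exact: DG.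
    by apply: DF; move: zn yx; rewrite /N; lra.
  - by rewrite /N /=; have := ler_norm y; have := ler_norm (- y);
      rewrite normrN; lra.
  - by rewrite /= N0 oppr_lt0 N0.
exists (fun x => F (N x) x); split; first by have [] := HF _ (N0 0).
(* The interval of radius [|x| + 2] serves all points at distance less than [1] from [x], so one
   fixed primitive represents the patched function near [x]. *)
move=> x; have [_ /(_ x) D] := HF (N (`|x| + 1)) (N0 _).
apply: near_eq_is_derive (D _); last first.
  rewrite /N (@ger0_norm _ (`|x| + 1)) ?addr_ge0//.
  by have := ler_norm x; have := ler_norm (- x); rewrite normrN; lra.
near=> z; apply: FE; rewrite /N lerD2r (@ger0_norm _ (`|x| + 1)) ?addr_ge0//.
have : `|x - z| < 1 by near: z; apply: cvgr_dist_lt => //; exact: cvg_id.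
by have := ler_distD x z 0; rewrite !subr0 distrC; lra.
Unshelve. all: by end_near. Qed.

(** The uniform lower bound [m] on the derivative makes [F] not only increasing but onto, so that
    the inverse is defined on the whole line. *)
Lemma derive_inverse F (H : R -> R) : (forall x : R, is_derive x 1 F (H x)) ->
  (exists2 m, 0 < m & forall x, m <= H x) ->
  exists G, [/\ cancel F G, cancel G F &
    forall y : R, is_derive y 1 G (H (G y))^-1].
Proof.
move=> DF [m m0 mH].
have H0 x : 0 < H x by exact: lt_le_trans m0 (mH x).
have incF x y : x < y -> F x < F y.
  by move=> xy; apply: (derive_increasing xy (df := H)).
have cF : continuous F by move=> x; exact: is_derive1_continuous (DF x).
have surj y : exists x, F x = y.
  (* Chosen so that [m * b] exceeds [|y - F 0|]: by the mean value theorem [F] has passed [y] on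
     both sides at [b] and [- b]. *)
  pose b := (`|y - F 0| + 1) / m.
  have b0 : 0 < b by rewrite divr_gt0// ltr_wpDl.
  have Fb : F b >= y.
    have [c _ E] := @mean_value F H 0 b b0 (fun x _ => DF x).
    have : m * b <= H c * (b - 0) by rewrite subr0 ler_pM2r.
    rewrite -E /b mulrC divfK ?gt_eqF//.
    by have := ler_norm (y - F 0); lra.
  have Fnb : F (- b) <= y.
    have nb : - b < 0 by rewrite oppr_lt0.
    have [c _ E] := @mean_value F H (- b) 0 nb (fun x _ => DF x).
    have : m * b <= H c * (0 - - b) by rewrite sub0r opprK ler_pM2r.
    rewrite -E /b mulrC divfK ?gt_eqF//.
    by have := ler_norm (- (y - F 0)); rewrite normrN; lra.
  have nbb : - b <= b by rewrite ge0_cp// ltW.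
  have [||c _ E] := @IVT R F (- b) b y nbb.
  - exact: continuous_subspaceT.
  - by rewrite ge_min le_max Fnb Fb orbT.
  by exists c.
have [G GE] := choice surj.
have FK : cancel F G.
  move=> x; case: (ltgtP (G (F x)) x) => [/incF|/incF|//];
    by rewrite GE ltxx.
exists G; split => // y.
rewrite -{1}(GE y); apply: (@is_derive_inverse R F G); last by rewrite gt_eqF.
- by near=> z; exact: FK.
- by near=> z; exact: cF.
Unshelve. all: by end_near. Qed.

End RealCalculus.

Section Lines.
Context {R : realType} {V W : normedModType R}.

Lemma is_derive_along (F : V -> W) (p v : V) (s : R) :
  derivable F (p + s *: v) v ->
  is_derive s 1 (fun r : R => F (p + r *: v)) ('D_v F (p + s *: v)).
Proof.
have E : (fun h : R => h^-1 *: (((fun r : R => F (p + r *: v)) \o shift s)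
    (h *: (1 : R)) - F (p + s *: v))) =
  (fun h => h^-1 *: ((F \o shift (p + s *: v)) (h *: v) - F (p + s *: v))).
  apply/funext => h /=; congr (_ *: (F _ - _)).
  by rewrite [h *: 1]mulr1 scalerDl addrCA.
by move=> d; split; [rewrite /derivable E|rewrite /derive E].
Qed.

Lemma continuous_near_dist (G : V -> W) (q : V) (e : R) :
  {for q, continuous G} -> 0 < e -> nbhs q [set u | `|G q - G u| < e].
Proof. by move=> /cvgrPdist_lt cG e0; exact: cG. Qed.

End Lines.

(** * Symmetry of second directional derivatives *)

Section Schwarz.
Context {R : realType} {V : normedModType R}.
Variables (A : set V) (F : V -> R).
Hypotheses (oA : open A) (CF : Cn_on 2 A F).

(** Mean value theorem twice: for [r |-> F (q + s w + r v) - F (q + r v)], then for ['D_v F] in the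
    direction [w]. The left-hand side is symmetric in [v] and [w]. *)
Let second_difference q v w (s : R) : 0 < s ->
  (forall r1 r2 : R, 0 <= r1 <= s -> 0 <= r2 <= s -> A (q + r1 *: v + r2 *: w)) ->
  exists r1 r2 : R, [/\ 0 <= r1 <= s, 0 <= r2 <= s &
   F (q + s *: v + s *: w) - F (q + s *: v) - F (q + s *: w) + F q =
   s * s * 'D_w ('D_v F) (q + r1 *: v + r2 *: w)].
Proof.
move=> s0 HA; case: CF => _ HF.
have [dF CF1] := HF v; have [dF2 _] := CF1.2 w.
have s00 : (0 : R) <= 0 <= s by apply/andP; split => //; exact: ltW.
have [|r1 r1s E1] := @mean_value R
    (fun r => F (q + s *: w + r *: v) - F (q + r *: v))
    (fun r => 'D_v F (q + s *: w + r *: v) - 'D_v F (q + r *: v)) 0 s s0.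
- move=> r rs; apply: is_deriveB; apply: is_derive_along; apply: dF.
  + by rewrite addrAC; apply: HA => //; apply/andP; split => //; exact: ltW.
  + by have := HA r 0 rs s00; rewrite scale0r addr0.
have r1s' : 0 <= r1 <= s by move/andP: r1s => [? ?]; rewrite !ltW.
have [|r2 r2s E2] := @mean_value R (fun r => 'D_v F (q + r1 *: v + r *: w))
  (fun r => 'D_w ('D_v F) (q + r1 *: v + r *: w)) 0 s s0.
  by move=> r rs; apply: is_derive_along; apply: dF2; exact: HA.
exists r1, r2; split => //; first by move/andP: r2s => [? ?]; rewrite !ltW.
move: E1 E2; rewrite !scale0r !addr0 subr0.
rewrite !(addrAC q (s *: w)) => E1 E2.
rewrite E2 in E1.
set D := 'D_w _ _ in E1 *; rewrite (_ : s * s * D = D * s * s); last by ring.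
by rewrite -E1; ring.
Qed.

Lemma derive_swap q v w : A q -> 'D_w ('D_v F) q = 'D_v ('D_w F) q.
Proof.
move=> Aq; apply/eqP; rewrite -subr_eq0 -normr_le0.
apply/ler_addgt0Pr => /= e e0; rewrite add0r.
have e2 : 0 < e / 2 by rewrite divr_gt0.
have [_ HF] := CF.
have cvw : {for q, continuous ('D_w ('D_v F))}.
  by have [_ [_ H]] := HF v; have [_ [h _]] := H w; exact: h.
have cwv : {for q, continuous ('D_v ('D_w F))}.
  by have [_ [_ H]] := HF w; have [_ [h _]] := H v; exact: h.
pose D1 : V -> R := 'D_w ('D_v F); pose D2 : V -> R := 'D_v ('D_w F).
have n1 : nbhs q A by exact: open_nbhs_nbhs.
have n2 := continuous_near_dist cvw e2.
have n3 := continuous_near_dist cwv e2.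
have : nbhs q (A `&` ([set u | `|D1 q - D1 u| < e / 2] `&`
    [set u | `|D2 q - D2 u| < e / 2])).
  by apply: filterI; [exact: n1|apply: filterI; [exact: n2|exact: n3]].
move=> /nbhs_ballP [d /= d0 Hd].
(* With [s * N = d / 2] the parallelogram spanned by [s v] and [s w] at [q] stays in the ball of
   radius [d]. *)
pose N := `|v| + `|w| + 1; have N0 : 0 < N by rewrite ltr_wpDl// addr_ge0.
pose s := d / 2 / N; have s0 : 0 < s by rewrite !divr_gt0.
have Hball r1 r2 : 0 <= r1 <= s -> 0 <= r2 <= s ->
    ball q d (q + r1 *: v + r2 *: w).
  move=> /andP[r10 r1s] /andP[r20 r2s]; rewrite -ball_normE /ball_ /=.
  rewrite -addrA opprD addrA subrr sub0r normrN.
  apply: le_lt_trans (ler_normD _ _) _; rewrite !normrZ !ger0_norm//.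
  apply: (@le_lt_trans _ _ (s * N)); last first.
    by rewrite /s divfK ?gt_eqF// ltr_pdivrMr// ltr_pMr// ltr1n.
  rewrite /N !mulrDr mulr1 -[leLHS]addr0; apply: lerD; last exact: ltW.
  by apply: lerD; apply: ler_wpM2r.
have HA r1 r2 : 0 <= r1 <= s -> 0 <= r2 <= s -> A (q + r1 *: v + r2 *: w).
  by move=> h1 h2; have [] := Hd _ (Hball _ _ h1 h2).
have [r1 [r2 [h1 h2 E]]] := second_difference s0 HA.
have HA' r1' r2' : 0 <= r1' <= s -> 0 <= r2' <= s ->
  A (q + r1' *: w + r2' *: v) by move=> ? ?; rewrite addrAC; exact: HA.
have [k1 [k2 [h1' h2' E']]] := second_difference s0 HA'.
have [_ [B1 _]] := Hd _ (Hball _ _ h1 h2).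
have [_ [_ B2]] := Hd _ (Hball _ _ h2' h1').
(* Both orders of differentiation compute the same second difference, so the two mixed derivatives
   agree at two points that are both close to [q]. *)
have ED : D1 (q + r1 *: v + r2 *: w) = D2 (q + k2 *: v + k1 *: w).
  apply: (@mulfI _ (s * s)); first by rewrite mulf_neq0// gt_eqF.
  rewrite (addrAC q (k2 *: v)) -[LHS]E -[RHS]E' (addrAC q (s *: w)).
  by congr (_ + _); rewrite [LHS]addrAC.
have {B1} B1 : `|D1 q - D1 (q + r1 *: v + r2 *: w)| < e / 2 := B1.
have {B2} B2 : `|D2 q - D2 (q + k2 *: v + k1 *: w)| < e / 2 := B2.
rewrite ED in B1; set X := D2 (_ + _) in B1 B2.
suff : `|D1 q - D2 q| <= e by [].
move: (D1 q) (D2 q) X B1 B2 => a b x B1 B2.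
apply: (le_trans (ler_distD x a b)); rewrite (distrC x).
by rewrite [e]splitr; apply: lerD; exact: ltW.
Qed.

End Schwarz.

(** * Chain rule for functions of two variables *)

Section ChainRule.
Context {R : realType}.
Implicit Types (A : set (R * R)) (F : R * R -> R).

Notation d1 := (derive^~ ((1, 0) : R * R)).
Notation d2 := (derive^~ ((0, 1) : R * R)).

Lemma pair_line1 (x y : R) : (x, y) = (0, y) + x *: (1, 0) :> R * R.
Proof.
rewrite [RHS]surjective_pairing; congr pair => /=.
  by rewrite add0r [x *: 1]mulr1.
by rewrite scaler0 addr0.
Qed.

Lemma pair_line2 (x y : R) : (x, y) = (x, 0) + y *: (0, 1) :> R * R.
Proof.
rewrite [RHS]surjective_pairing; congr pair => /=.
  by rewrite scaler0 addr0.
by rewrite add0r [y *: 1]mulr1.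
Qed.

Lemma is_derive_partial1 F (x y : R) : derivable F (x, y) (1, 0) ->
  is_derive x 1 (fun r : R => F (r, y)) ('D_(1, 0) F (x, y)).
Proof.
have E r : F (r, y) = F ((0, y) + r *: (1, 0)).
  by congr F; exact: pair_line1.
have Ex : (x, y) = (0, y) + x *: (1, 0) :> R * R.
  by exact: pair_line1.
under [X in is_derive _ _ X]eq_fun do rewrite E.
by rewrite Ex; exact: is_derive_along.
Qed.

Lemma is_derive_partial2 F (x y : R) : derivable F (x, y) (0, 1) ->
  is_derive y 1 (fun r : R => F (x, r)) ('D_(0, 1) F (x, y)).
Proof.
have E r : F (x, r) = F ((x, 0) + r *: (0, 1)).
  by congr F; exact: pair_line2.
have Ex : (x, y) = (x, 0) + y *: (0, 1) :> R * R.
  by exact: pair_line2.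
under [X in is_derive _ _ X]eq_fun do rewrite E.
by rewrite Ex; exact: is_derive_along.
Qed.

(* Caratheodory slope in the first variable, uniform in the second one. *)
Lemma partial1_slope A F q : open A -> Cn_on 1 A F -> A q ->
  exists P : R * R -> R, [/\ {for q, continuous P}, P q = 'D_(1, 0) F q &
    \forall u \near q, F u - F (q.1, u.2) = P u * (u.1 - q.1)].
Proof.
move=> oA [_ HF] Aq; have [dF [cD _]] := HF (1, 0).
pose P (u : R * R) := if u.1 == q.1 then 'D_(1, 0) F u
  else (F u - F (q.1, u.2)) / (u.1 - q.1).
exists P; split; last 2 first.
- by rewrite /P eqxx.
- near=> u; rewrite /P; case: eqP => [e|/eqP ne].
    by rewrite -e -surjective_pairing !subrr mulr0.
  by rewrite divfK// subr_eq0.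
apply/cvgrPdist_lt => e e0.
have : \forall u \near q, A u /\ `|'D_(1, 0) F q - 'D_(1, 0) F u| < e.
  near=> u; split; near: u; first exact: open_nbhs_nbhs.
  by move/cvgrPdist_lt : (cD _ Aq); exact.
move/nbhs_ballP => [d /= d0 Hd].
suff : nbhs q [set u | `|P q - P u| < e] by [].
apply/nbhs_ballP; exists d => //= -[x y] Bu.
rewrite {1}/P eqxx /P /=; case: eqP => [_|/eqP ne]; first by have [] := Hd _ Bu.
have [Bx By] : `|q.1 - x| < d /\ `|q.2 - y| < d by case: Bu.
have B z : (q.1 <= z <= x) || (x <= z <= q.1) -> ball q d (z, y).
  move=> zz; split => //=; rewrite /ball /=.
  move: Bx; rewrite !ltr_norml => /andP[b1 b2].
  by move/orP: zz => -[] /andP[z1 z2]; apply/andP; split; lra.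
have Dz z : (q.1 <= z <= x) || (x <= z <= q.1) ->
    is_derive z 1 (fun r : R => F (r, y)) ('D_(1, 0) F (z, y)).
  by move=> /B /Hd [Az _]; apply: is_derive_partial1; exact: dF.
case: (ltgtP x q.1) ne => // [xq|qx] _.
  have [z xz|c /andP[c1 c2] E] := mean_value xq (f := fun r => F (r, y))
    (df := fun z => 'D_(1, 0) F (z, y)).
    by apply: Dz; rewrite xz orbT.
  rewrite -[F _ - F _]opprB E -[x - q.1]opprB invrN mulrNN mulfK ?subr_eq0 ?gt_eqF//.
  have Bc : ball q d (c, y) by apply: B; rewrite (ltW c1) (ltW c2) orbT.
  by have [] := Hd _ Bc.
have [z xz|c /andP[c1 c2] E] := mean_value qx (f := fun r => F (r, y))
    (df := fun z => 'D_(1, 0) F (z, y)).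
  by apply: Dz; rewrite xz.
rewrite E mulfK ?subr_eq0 ?gt_eqF//.
have Bc : ball q d (c, y) by apply: B; rewrite (ltW c1) (ltW c2).
by have [] := Hd _ Bc.
Unshelve. all: by end_near. Qed.

(** The increment is split into a step in the first variable, whose slope [P] is continuous in both
    variables, and a step in the second variable with the first one frozen at [z1 t]; the slopes are
    then multiplied. *)
Lemma is_derive_chain A F (z1 z2 : R -> R) (t a b : R) :
  open A -> Cn_on 1 A F -> A (z1 t, z2 t) ->
  is_derive t 1 z1 a -> is_derive t 1 z2 b ->
  is_derive t 1 (fun s => F (z1 s, z2 s))
    (a * 'D_(1, 0) F (z1 t, z2 t) + b * 'D_(0, 1) F (z1 t, z2 t)).
Proof.
move=> oA CF Aq D1 D2.
have [P [cP Pq nP]] := partial1_slope oA CF Aq.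
have dF2 : is_derive (z2 t) 1 (fun r : R => F (z1 t, r))
    ('D_(0, 1) F (z1 t, z2 t)).
  have [_ /(_ (0, 1)) [dF _]] := CF.
  by apply: is_derive_partial2; exact: dF.
have [Q [QE cQ Qq]] := (is_derive1_caratheodory _ _ _).1 dF2.
have [g1 [g1E cg1 g1t]] := (is_derive1_caratheodory _ _ _).1 D1.
have [g2 [g2E cg2 g2t]] := (is_derive1_caratheodory _ _ _).1 D2.
have cz1 := is_derive1_continuous D1; have cz2 := is_derive1_continuous D2.
have cz : {for t, continuous (fun s => (z1 s, z2 s))} by exact: (cvg_pair cz1 cz2).
pose z s := (z1 s, z2 s).
(* The slope identity for [P] holds only near the point, while the Caratheodory criterion wants it
   everywhere: [G] is defined by the identity and coincides with the composite near [t]. *)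
have [G [GE cG Gt]] : exists G, [/\ forall s, G s - G t =
    (P (z s) * g1 s + Q (z2 s) * g2 s) * (s - t),
    (\near t, G t = F (z t)) & True].
  exists (fun s => F (z t) + (P (z s) * g1 s + Q (z2 s) * g2 s) * (s - t)).
  split => //; first by move=> s; rewrite subrr mulr0 addr0; ring.
  have nz : \forall s \near t, F (z s) - F (z1 t, z2 s) =
      P (z s) * (z1 s - z1 t) by exact: cz _ nP.
  near=> s.
  have Es : F (z s) - F (z1 t, z2 s) = P (z s) * (z1 s - z1 t) by near: s.
  by rewrite mulrDl -!mulrA -g1E -g2E -Es -QE /=; ring.
apply: near_eq_is_derive cG _.
apply/is_derive1_caratheodory; exists (fun s => P (z s) * g1 s + Q (z2 s) * g2 s).
split => //; last by rewrite -Qq -Pq g1t g2t mulrC (mulrC b).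
apply: cvgD; apply: cvgM => //.
  by apply: (@continuous_comp _ _ _ z P).
by apply: (@continuous_comp _ _ _ z2 Q).
Unshelve. all: by end_near. Qed.

(** Linearity in the direction is not part of [Cn_on]; it follows from the chain rule along the line
    [q + r v]. *)
Lemma derive_linear A F q (v : R * R) : open A -> Cn_on 1 A F -> A q ->
  'D_v F q = v.1 * 'D_(1, 0) F q + v.2 * 'D_(0, 1) F q.
Proof.
move=> oA CF Aq.
have D1 (x y : R) : is_derive (0 : R) 1 (fun r => x + r * y) y.
  have -> : (fun r => x + r * y) = cst x + (y \*: id).
    by apply/funext => r /=; rewrite mulrC.
  by apply: is_derive_eq; rewrite add0r /GRing.scale /= mulr1.
have := @is_derive_chain A F _ _ 0 _ _ oA CF _ (D1 q.1 v.1) (D1 q.2 v.2).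
rewrite !mul0r !addr0 -surjective_pairing => /(_ Aq) [_ <-].
have [_ /(_ v) [dF _]] := CF.
have Dl : derivable F (q + (0 : R) *: v) v.
  by rewrite scale0r addr0; exact: dF.
have [_ E] := is_derive_along Dl.
by rewrite scale0r addr0 in E; rewrite -E.
Qed.

Lemma Cn_on_curve n A (B : set R) F (z1 z2 : R -> R) :
  open A -> open B -> (forall s, B s -> A (z1 s, z2 s)) ->
  Cn_on n A F -> Cn_on n B z1 -> Cn_on n B z2 ->
  Cn_on n B (fun s => F (z1 s, z2 s)).
Proof.
move=> oA oB BA; elim: n F => [|n IH] F CF C1 C2.
  split => // s Bs.
  apply: (@continuous_comp _ _ _ (fun s => (z1 s, z2 s)) F).
    exact: (cvg_pair (Cn_on_continuous C1 Bs) (Cn_on_continuous C2 Bs)).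
  by apply: Cn_on_continuous CF _; exact: BA.
have D s : B s -> is_derive s 1 (fun s => F (z1 s, z2 s))
    (derive1 z1 s * 'D_(1, 0) F (z1 s, z2 s) +
     derive1 z2 s * 'D_(0, 1) F (z1 s, z2 s)).
  move=> Bs; apply: (@is_derive_chain A) => //; last 3 first.
  - exact: BA.
  - exact: Cn_on_derivable C1 Bs.
  - exact: Cn_on_derivable C2 Bs.
  by elim: n {IH C1 C2} CF => // n IHn /Cn_onS; exact: IHn.
apply: (Cn_on_line oB D).
have [_ HF] := CF.
apply: (Cn_onD oB); apply: (Cn_onM oB).
- exact: Cn_on_derive1.
- by apply: (IH ('D_(1, 0) F)); [exact: (HF (1, 0)).2|exact: Cn_onS|exact: Cn_onS].
- exact: Cn_on_derive1.
- by apply: (IH ('D_(0, 1) F)); [exact: (HF (0, 1)).2|exact: Cn_onS|exact: Cn_onS].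
Qed.

End ChainRule.

Section CnLocal.
Context {R : realType} {V W : normedModType R}.

Lemma Cn_on_local n (A : set V) (f : V -> W) :
  (forall x, A x -> exists B, [/\ open B, B x & Cn_on n B f]) -> Cn_on n A f.
Proof.
elim: n f => [|n IH] f Hf.
  split => // x /Hf [B [_ Bx CB]]; exact: Cn_on_continuous CB Bx.
split.
  by move=> x /Hf [B [_ Bx CB]]; exact: Cn_on_continuous CB Bx.
move=> v; split.
  by move=> x /Hf [B [_ Bx [_ /(_ v) [dB _]]]]; exact: dB.
apply: IH => x /Hf [B [oB Bx [_ /(_ v) [_ CB]]]]; by exists B.
Qed.

Lemma is_derive_comp_real (Y : V -> R) (f : R -> R) (q u : V) (a b : R) :
  is_derive q u Y a -> is_derive (Y q) 1 f b ->
  is_derive q u (f \o Y) (b * a).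
Proof.
move=> [d1 d2] Df.
have D1 : is_derive (0 : R) 1 (fun h : R => Y (q + h *: u)) a.
  have := @is_derive_along R V R Y q u 0; rewrite scale0r addr0 d2; exact.
have D2 : is_derive (0 : R) 1 (f \o (fun h : R => Y (q + h *: u))) (b * a).
  by apply: is_derive1_comp; rewrite scale0r addr0.
have E : (fun h : R => h^-1 *: (((f \o (fun h : R => Y (q + h *: u))) \o shift 0)
    (h *: (1 : R)) - (f \o (fun h : R => Y (q + h *: u))) 0)) =
  (fun h => h^-1 *: (((f \o Y) \o shift q) (h *: u) - (f \o Y) q)).
  apply/funext => h /=; rewrite addr0 [h *: 1]mulr1 scale0r addr0.
  by rewrite (addrC q).
case: D2 => D2 D2'; split.
  by move: D2; rewrite /derivable E.
by move: D2'; rewrite /derive E.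
Qed.

End CnLocal.

Section SecondChain.
Context {R : realType}.

Lemma is_derive_curve (A : set (R * R)) (F : R * R -> R) (z : R -> R * R) (t : R) :
  open A -> Cn_on 1 A F -> A (z t) -> derivable z t 1 ->
  is_derive t 1 (fun s => F (z s)) ('D_(derive1 z t) F (z t)).
Proof.
move=> oA CF Az dz.
have Dz : is_derive t 1 z (derive1 z t) by rewrite derive1E; exact: derivableP.
rewrite (derive_linear _ oA CF Az).
have := is_derive_chain oA CF _ (is_derive_fst Dz) (is_derive_snd Dz).
rewrite -surjective_pairing => /(_ Az).
rewrite (_ : (fun s => F ((z s).1, (z s).2)) = (fun s => F (z s))) //.
by apply/funext => s; rewrite -surjective_pairing.
Qed.

Lemma derive1_curve2 (A : set (R * R)) (B : set R) (F : R * R -> R) (z : R -> R * R) (t : R) :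
  open A -> open B -> Cn_on 2 A F -> Cn_on 2 B z ->
  (forall s, B s -> A (z s)) -> B t ->
  derive1 (derive1 (fun s => F (z s))) t =
    'D_(derive1 (derive1 z) t) F (z t) +
    'D_(derive1 z t) ('D_(derive1 z t) F) (z t).
Proof.
move=> oA oB CF Cz BA Bt.
have CF1 : Cn_on 1 A F := Cn_onS CF.
have dz s : B s -> derivable z s 1 by move=> Bs; exact: (Cz.2 1).1.
have Cz' : Cn_on 1 B (derive1 z) := Cn_on_derive1 Cz.
have Dz't := Cn_on_derivable Cz' Bt.
set w := derive1 (derive1 z) t in Dz't *; set v := derive1 z t.
have [D1 CD1] := CF.2 (1, 0); have [D2 CD2] := CF.2 (0, 1).
have Az := BA _ Bt.
have E1 s : B s -> derive1 (fun s => F (z s)) s =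
    (derive1 z s).1 * 'D_(1, 0) F (z s) + (derive1 z s).2 * 'D_(0, 1) F (z s).
  move=> Bs; rewrite derive1E.
  have [_ ->] := is_derive_curve oA CF1 (BA _ Bs) (dz _ Bs).
  exact: (derive_linear _ oA CF1 (BA _ Bs)).
have Dw1 := is_derive_fst Dz't; have Dw2 := is_derive_snd Dz't.
have Dc1 := is_derive_curve oA CD1 Az (dz _ Bt).
have Dc2 := is_derive_curve oA CD2 Az (dz _ Bt).
have Dp : is_derive t 1 (fun s => (derive1 z s).1 * 'D_(1, 0) F (z s) +
    (derive1 z s).2 * 'D_(0, 1) F (z s))
   ((v.1 * 'D_v ('D_(1, 0) F) (z t) + 'D_(1, 0) F (z t) * w.1) +
    (v.2 * 'D_v ('D_(0, 1) F) (z t) + 'D_(0, 1) F (z t) * w.2)).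
  apply: is_deriveD; exact: is_deriveM.
have E2 : \near t, (fun s => (derive1 z s).1 * 'D_(1, 0) F (z s) +
    (derive1 z s).2 * 'D_(0, 1) F (z s)) t = derive1 (fun s => F (z s)) t.
  have : nbhs t B by exact: open_nbhs_nbhs.
  by apply: filterS => s Bs; rewrite E1.
have [_ E3] := near_eq_is_derive E2 Dp.
rewrite derive1E E3.
have E4 : 'D_v ('D_v F) (z t) =
    v.1 * 'D_v ('D_(1, 0) F) (z t) + v.2 * 'D_v ('D_(0, 1) F) (z t).
  have N : \forall q \near z t,
      v.1 * 'D_(1, 0) F q + v.2 * 'D_(0, 1) F q = 'D_v F q.
    have : nbhs (z t) A by exact: open_nbhs_nbhs.
    apply: filterS => q Aq; exact: (esym (derive_linear v oA CF1 Aq)).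
  have [d1 _] := CD1.2 v; have [d2 _] := CD2.2 v.
  have Dd1 := derivableP (d1 _ Az); have Dd2 := derivableP (d2 _ Az).
  have Dl : is_derive (z t) v
     (fun q => v.1 * 'D_(1, 0) F q + v.2 * 'D_(0, 1) F q)
     (v.1 * 'D_v ('D_(1, 0) F) (z t) + v.2 * 'D_v ('D_(0, 1) F) (z t)).
    exact: (is_deriveD (is_deriveZ v.1 Dd1) (is_deriveZ v.2 Dd2)).
  have Dl' := @near_eq_is_derive R _ _ (fun q => v.1 * 'D_(1, 0) F q +
    v.2 * 'D_(0, 1) F q) ('D_v F) (z t) v _ N Dl.
  exact: (@derive_val _ _ _ _ _ _ _ Dl').
apply: etrans (esym (f_equal2 +%R (derive_linear w oA CF1 Az) E4)).
have H (a1 a2 b1 b2 c1 c2 d1 d2 : R) : (a1 * b1 + c1 * d1) + (a2 * b2 + c2 * d2)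
  = (d1 * c1 + d2 * c2) + (a1 * b1 + a2 * b2) by ring.
exact: H.
Qed.

End SecondChain.

(** * Geodesics in normal charts *)

Section MetricAlgebra.
Context {R : realType}.

(* [y^2 dx^2 + 2 dx dy + k dy^2] *)
Definition metric_form (y k : R) (u v : R * R) : R :=
  y ^+ 2 * (u.1 * v.1) + (u.1 * v.2 + u.2 * v.1) + k * (u.2 * v.2).

(* Lowered components of the covariant acceleration of a curve [(X, Y)] with
   velocity [v] and second derivative [a], at [y = Y], [k = f y], [k' = f' y]. *)
Definition accel1 (y : R) (v a : R * R) : R :=
  y ^+ 2 * a.1 + 2 * y * v.2 * v.1 + a.2.

Definition accel2 (y k k' : R) (v a : R * R) : R :=
  a.1 + k * a.2 + 2^-1 * k' * v.2 ^+ 2 - y * v.1 ^+ 2.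

Definition geodesic_eq (f X Y : R -> R) (t : R) : Prop :=
  let v := (derive1 X t, derive1 Y t) in
  let a := (derive1 (derive1 X) t, derive1 (derive1 Y) t) in
  accel1 (Y t) v a = 0 /\ accel2 (Y t) (f (Y t)) (derive1 f (Y t)) v a = 0.

Context {V : normedModType R}.

(** Rate of change of [metric_form] when the base point and both vectors vary; primes are rates,
    except that [k'] is the slope of [f], so that [k] varies at rate [k' * y']. *)
Definition dmetric (y k y' k' xv xw yv yw xv' xw' yv' yw' : R) : R :=
  2 * y * y' * (xv * xw) + y ^+ 2 * (xv' * xw + xv * xw') +
  (xv' * yw + xv * yw' + yv' * xw + yv * xw') +
  (k' * y' * (yv * yw) + k * (yv' * yw + yv * yw')).

Lemma is_derive_metric (Y Xv Xw Yv Yw : V -> R) (f : R -> R) (q u : V)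
    (y' xv' xw' yv' yw' k' : R) :
  is_derive q u Y y' -> is_derive q u Xv xv' -> is_derive q u Xw xw' ->
  is_derive q u Yv yv' -> is_derive q u Yw yw' -> is_derive (Y q) 1 f k' ->
  is_derive q u
    (fun z => metric_form (Y z) (f (Y z)) (Xv z, Yv z) (Xw z, Yw z))
    (dmetric (Y q) (f (Y q)) y' k' (Xv q) (Xw q) (Yv q) (Yw q) xv' xw' yv' yw').
Proof.
move=> DY DXv DXw DYv DYw Df.
have Dk := is_derive_comp_real DY Df.
rewrite (_ : (fun z => metric_form _ _ _ _) =
  Y * Y * (Xv * Xw) + (Xv * Yw + Yv * Xw) + (f \o Y) * (Yv * Yw)); last first.
  by apply/funext => z; rewrite /metric_form /= expr2.
have D1 := is_deriveM (is_deriveM DY DY) (is_deriveM DXv DXw).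
have D2 := is_deriveD (is_deriveM DXv DYw) (is_deriveM DYv DXw).
have D3 := is_deriveM Dk (is_deriveM DYv DYw).
apply: (is_derive_eq (is_deriveD (is_deriveD D1 D2) D3)).
rewrite /dmetric -![_ *: _]/(_ * _) /= !mulrfctE /=; ring.
Qed.

(** The left-hand side is the lowered acceleration in an arbitrary chart, with the Koszul
    combination of derivatives of the pulled-back metric. The mixed derivatives [Xvw], [Yvw] cancel,
    and [Xvv], [Yvv] are absorbed as corrections of the acceleration. *)
Lemma transfer_algebra (y k k' : R)
  (Xvv Xvw Yvv Yvw : R) (Xv Xw Yv Yw Xa Ya : R) :
  metric_form y k (Xa, Ya) (Xw, Yw) +
  2^-1 * (dmetric y k Yv k' Xv Xw Yv Yw Xvv Xvw Yvv Yvw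
        + dmetric y k Yv k' Xv Xw Yv Yw Xvv Xvw Yvv Yvw
        - dmetric y k Yw k' Xv Xv Yv Yv Xvw Xvw Yvw Yvw) =
  accel1 y (Xv, Yv) (Xa + Xvv, Ya + Yvv) * Xw +
  accel2 y k k' (Xv, Yv) (Xa + Xvv, Ya + Yvv) * Yw.
Proof.
by rewrite /metric_form /dmetric /accel1 /accel2 /=; field.
Qed.

End MetricAlgebra.

Section CurveComponents.
Context {R : realType}.
Variables (B : set R) (z : R -> R * R) (t : R).
Hypotheses (oB : open B) (Bt : B t).

Lemma derive1_components : Cn_on 1 B z ->
  derive1 z t = (derive1 (fun s => (z s).1) t, derive1 (fun s => (z s).2) t).
Proof.
move=> Cz; have Dz := Cn_on_derivable Cz Bt.
rewrite [LHS]surjective_pairing; congr pair; apply/esym; rewrite derive1E.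
  exact: (@derive_val _ _ _ _ _ _ _ (is_derive_fst Dz)).
exact: (@derive_val _ _ _ _ _ _ _ (is_derive_snd Dz)).
Qed.

End CurveComponents.

Lemma near_derive1 {R : realType} {W : normedModType R} (B : set R)
    (a b : R -> W) (t : R) :
  open B -> B t -> (forall s, B s -> a s = b s) -> derive1 a t = derive1 b t.
Proof.
move=> oB Bt ab; rewrite !derive1E; apply: near_eq_derive.
have : nbhs t B by exact: open_nbhs_nbhs.
exact: filterS.
Qed.

Lemma derive1_components2 {R : realType} (B : set R) (z : R -> R * R) (t : R) :
  open B -> B t -> Cn_on 2 B z ->
  derive1 (derive1 z) t = (derive1 (derive1 (fun s => (z s).1)) t,
    derive1 (derive1 (fun s => (z s).2)) t).
Proof.
move=> oB Bt Cz; rewrite (derive1_components Bt (Cn_on_derive1 Cz)).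
have Cz1 := Cn_onS Cz.
congr pair; apply: (near_derive1 oB Bt) => s Bs;
  by rewrite (derive1_components Bs Cz1).
Qed.

Section Charts.
Context {R : realType} {S : surface R} (g : lorentzian_metric S).
Implicit Types (c : chart R S) (q u v w : R * R).

Lemma chart_imgK c q : is_chart c -> chart_img c q ->
  chart_dom c (chart_inv c q) /\ chart_map c (chart_inv c q) = q.
Proof. by move=> [_ _ mK _ _] [p cp <-]; rewrite mK. Qed.

Lemma overlapE c c' : is_chart c ->
  overlap c c' = chart_img c `&` chart_inv c @^-1` chart_dom c'.
Proof.
move=> hc; apply/seteqP; split => [q [p [cp c'p] <-]|q [cq c'q]].
  have [_ _ mK _ _] := hc.
  by split; [exists p|rewrite /preimage /= mK].
by exists (chart_inv c q); [split => //|]; have [] := chart_imgK hc cq.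
Qed.

Lemma overlap_open c c' : is_chart c -> is_chart c' -> open (overlap c c').
Proof.
move=> hc hc'; rewrite (overlapE _ hc) openE => q [cq c'q].
have [_ oi _ _ ci] := hc; have [od _ _ _ _] := hc'.
apply: filterI; first exact: open_nbhs_nbhs.
by apply: ci => //; exact: open_nbhs_nbhs.
Qed.

Definition normal_chart c (f : R -> R) : Prop :=
  [/\ atlas c, chart_img c = setT, smooth_on setT f &
    forall q u v, pullback g c q u v = metric_form q.2 (f q.2) u v].

Lemma christoffel_normal c f q (a v w : R * R) : normal_chart c f ->
  pullback g c q a w + christoffel g c q v v w =
  accel1 q.2 v a * w.1 + accel2 q.2 (f q.2) (derive1 f q.2) v a * w.2.
Proof.
move=> [_ _ sf gE].
have D (u v' w' : R * R) : 'D_u (fun z => pullback g c z v' w') q =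
    dmetric q.2 (f q.2) u.2 (derive1 f q.2) v'.1 w'.1 v'.2 w'.2 0 0 0 0.
  rewrite (_ : (fun z => _) = (fun z : R * R => metric_form z.2 (f z.2) (v'.1, v'.2)
    (w'.1, w'.2))); last first.
    by apply/funext => z; rewrite gE -!surjective_pairing.
  have Df : is_derive q.2 1 f (derive1 f q.2) by exact: smooth_on_is_derive.
  have Ds : is_derive q u (fun z : R * R => z.2) u.2.
    exact: (@is_derive_snd _ _ _ _ id).
  have Dc (k : R) : is_derive q u (fun _ : R * R => k) 0 by exact: is_derive_cst.
  exact: (@derive_val _ _ _ _ _ _ _
    (is_derive_metric Ds (Dc _) (Dc _) (Dc _) (Dc _) Df)).
rewrite /christoffel !D gE.
(* The change of chart is the identity here, with vanishing second derivatives. *)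
have := transfer_algebra q.2 (f q.2) (derive1 f q.2) 0 0 0 0 v.1 w.1 v.2 w.2
  a.1 a.2.
by rewrite !addr0 -!surjective_pairing.
Qed.

End Charts.

(** * The geodesic equation under a change of chart *)

Section Transfer.
Context {R : realType} {S : surface R} (g : lorentzian_metric S).
Variables (c c' : chart R S) (f : R -> R).
Hypotheses (hc : atlas c) (hc' : normal_chart g c' f).

Let A := overlap c c'.
Let X (q : R * R) : R := (transition c c' q).1.
Let Y (q : R * R) : R := (transition c c' q).2.

Let ac' : atlas c'. Proof. by case: hc'. Qed.

Let oA : open A.
Proof. by apply: overlap_open; exact: atlas_is_chart. Qed.

Let CX n : Cn_on n A X.
Proof. by apply: Cn_on_fst => //; exact: (atlas_compatible hc ac').1. Qed.

Let CY n : Cn_on n A Y.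
Proof. by apply: Cn_on_snd => //; exact: (atlas_compatible hc ac').1. Qed.

Let derive_transition q v : A q ->
  'D_v (transition c c') q = ('D_v X q, 'D_v Y q).
Proof.
move=> Aq.
have [_ /(_ v) [dT _]] := (atlas_compatible hc ac').1 1%N.
have DT := derivableP (dT q Aq).
rewrite [LHS]surjective_pairing; congr pair; apply/esym.
  exact: (@derive_val _ _ _ _ _ _ _ (is_derive_fst DT)).
exact: (@derive_val _ _ _ _ _ _ _ (is_derive_snd DT)).
Qed.

Let pullbackE q u v : A q -> pullback g c q u v =
  metric_form (Y q) (f (Y q)) ('D_u X q, 'D_u Y q) ('D_v X q, 'D_v Y q).
Proof.
move=> Aq; have [_ _ _ gE] := hc'.
by rewrite (pullback_transition g hc ac' Aq) gE !derive_transition.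
Qed.

Let derive_pullback q u v w : A q ->
  'D_u (fun z => pullback g c z v w) q =
  dmetric (Y q) (f (Y q)) ('D_u Y q) (derive1 f (Y q))
    ('D_v X q) ('D_w X q) ('D_v Y q) ('D_w Y q)
    ('D_u ('D_v X) q) ('D_u ('D_w X) q) ('D_u ('D_v Y) q) ('D_u ('D_w Y) q).
Proof.
move=> Aq; have [_ _ sf _] := hc'.
have N : \near q, metric_form (Y q) (f (Y q)) ('D_v X q, 'D_v Y q)
    ('D_w X q, 'D_w Y q) = pullback g c q v w.
  have : nbhs q A by exact: open_nbhs_nbhs.
  by apply: filterS => z Az; rewrite pullbackE.
have Df : is_derive (Y q) 1 f (derive1 f (Y q)) by exact: smooth_on_is_derive.
have D1 (F : R * R -> R) : Cn_on 1 A F -> is_derive q u F ('D_u F q).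
  by move=> [_ /(_ u) [dF _]]; apply: derivableP; exact: dF.
have D2 (F : R * R -> R) r : Cn_on 2 A F ->
    is_derive q u ('D_r F) ('D_u ('D_r F) q).
  by move=> [_ /(_ r) [_ CF]]; exact: D1.
have DM := is_derive_metric (D1 _ (CY 1)) (D2 _ v (CX 2)) (D2 _ w (CX 2))
  (D2 _ v (CY 2)) (D2 _ w (CY 2)) Df.
have DP := @near_eq_is_derive R _ _ _ (fun z => pullback g c z v w) q u _ N DM.
exact: (@derive_val _ _ _ _ _ _ _ DP).
Qed.

Let christoffel_transition q (a v w : R * R) : A q ->
  pullback g c q a w + christoffel g c q v v w =
  accel1 (Y q) ('D_v X q, 'D_v Y q)
    ('D_a X q + 'D_v ('D_v X) q, 'D_a Y q + 'D_v ('D_v Y) q) * 'D_w X q +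
  accel2 (Y q) (f (Y q)) (derive1 f (Y q)) ('D_v X q, 'D_v Y q)
    ('D_a X q + 'D_v ('D_v X) q, 'D_a Y q + 'D_v ('D_v Y) q) * 'D_w Y q.
Proof.
move=> Aq; rewrite /christoffel !(derive_pullback _ _ _ Aq) (pullbackE _ _ Aq).
(* Symmetry of the second derivatives of the change of chart is what permits a single [Xvw] and a
   single [Yvw] in [transfer_algebra]. *)
rewrite (@derive_swap _ _ _ _ oA (CX 2) q v w Aq)
  (@derive_swap _ _ _ _ oA (CY 2) q v w Aq).
exact: transfer_algebra.
Qed.

Section AlongCurve.
Variables (gamma : R -> S) (B : set R).
Hypotheses (oB : open B)
  (Bc : forall s, B s -> chart_dom c (gamma s) /\ chart_dom c' (gamma s)).

Let z := chart_map c \o gamma.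
Let x1 (s : R) := (chart_map c' (gamma s)).1.
Let x2 (s : R) := (chart_map c' (gamma s)).2.
Hypothesis Cz : Cn_on 2 B z.

Let BA s : B s -> A (z s).
Proof. by move=> /Bc [cs c's]; exists (gamma s). Qed.

Let x1E s : B s -> x1 s = X (z s).
Proof.
move=> /Bc [cs _]; have [_ _ mK _ _] := atlas_is_chart hc.
by rewrite /x1 /X /transition /= /z /= mK.
Qed.

Let x2E s : B s -> x2 s = Y (z s).
Proof.
move=> /Bc [cs _]; have [_ _ mK _ _] := atlas_is_chart hc.
by rewrite /x2 /Y /transition /= /z /= mK.
Qed.

Let dz s : B s -> derivable z s 1.
Proof. by move=> Bs; have [_ /(_ 1) [d _]] := Cz; exact: d. Qed.

Let velocity_transfer t : B t ->
  derive1 x1 t = 'D_(derive1 z t) X (z t) /\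
  derive1 x2 t = 'D_(derive1 z t) Y (z t).
Proof.
move=> Bt; rewrite (near_derive1 oB Bt x1E) (near_derive1 oB Bt x2E).
have DX := is_derive_curve oA (CX 1) (BA Bt) (dz Bt).
have DY := is_derive_curve oA (CY 1) (BA Bt) (dz Bt).
split; rewrite [LHS]derive1E.
  exact: (@derive_val _ _ _ _ _ _ _ DX).
exact: (@derive_val _ _ _ _ _ _ _ DY).
Qed.

Let accel_transfer t : B t ->
  derive1 (derive1 x1) t = 'D_(derive1 (derive1 z) t) X (z t) +
    'D_(derive1 z t) ('D_(derive1 z t) X) (z t) /\
  derive1 (derive1 x2) t = 'D_(derive1 (derive1 z) t) Y (z t) +
    'D_(derive1 z t) ('D_(derive1 z t) Y) (z t).
Proof.
move=> Bt.
have E1 s : B s -> derive1 x1 s = derive1 (fun s => X (z s)) s.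
  by move=> Bs; exact: near_derive1 x1E.
have E2 s : B s -> derive1 x2 s = derive1 (fun s => Y (z s)) s.
  by move=> Bs; exact: near_derive1 x2E.
rewrite (near_derive1 oB Bt E1) (near_derive1 oB Bt E2); split.
  exact: (derive1_curve2 oA oB (CX 2) Cz BA Bt).
exact: (derive1_curve2 oA oB (CY 2) Cz BA Bt).
Qed.

(** [geodesic] quantifies over all charts of the maximal atlas; this reduces the equation to the two
    scalar equations in one normal chart. *)
Lemma geodesic_eq_transfer t : B t -> geodesic_eq f x1 x2 t ->
  forall w, pullback g c (z t) (derive1 (derive1 z) t) w +
    christoffel g c (z t) (derive1 z t) (derive1 z t) w = 0.
Proof.
move=> Bt [+ +] w; have [v1 v2] := velocity_transfer Bt.
have [a1 a2] := accel_transfer Bt.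
rewrite (x2E Bt) v1 v2 a1 a2 => G1 G2.
apply: (etrans (christoffel_transition _ _ _ (BA Bt))).
by rewrite G1 G2 !mul0r addr0.
Qed.

Lemma sq_norm_transfer t : B t ->
  pullback g c (z t) (derive1 z t) (derive1 z t) =
  metric_form (x2 t) (f (x2 t)) (derive1 x1 t, derive1 x2 t)
    (derive1 x1 t, derive1 x2 t).
Proof.
move=> Bt; have [-> ->] := velocity_transfer Bt.
by rewrite (x2E Bt); exact: (pullbackE _ _ (BA Bt)).
Qed.

End AlongCurve.

End Transfer.

(** * Geodesics read in normal charts *)

Section LocalGeodesics.
Context {R : realType} {S : surface R} (g : lorentzian_metric S).
Implicit Types (c : chart R S) (gamma : R -> S) (J B : set R).

Lemma open_preimage_in {T U : topologicalType} (J : set T) (h : T -> U) (D : set U) :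
  open J -> (forall x, J x -> {for x, continuous h}) -> open D ->
  open (J `&` h @^-1` D).
Proof.
move=> oJ ch oD; rewrite openE => x [Jx Dx].
apply: filterI; first exact: open_nbhs_nbhs.
by apply: ch => //; exact: open_nbhs_nbhs.
Qed.

Lemma geodesic_eq_ext (f X Y X' Y' : R -> R) B t : open B -> B t ->
  (forall s, B s -> X s = X' s) -> (forall s, B s -> Y s = Y' s) ->
  geodesic_eq f X Y t -> geodesic_eq f X' Y' t.
Proof.
move=> oB Bt EX EY; rewrite /geodesic_eq.
have EX1 s : B s -> derive1 X s = derive1 X' s.
  by move=> Bs; exact: near_derive1 EX.
have EY1 s : B s -> derive1 Y s = derive1 Y' s.
  by move=> Bs; exact: near_derive1 EY.
rewrite (EX1 _ Bt) (EY1 _ Bt) (near_derive1 oB Bt EX1).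
by rewrite (near_derive1 oB Bt EY1) (EY _ Bt).
Qed.

Lemma normal_chartK c f q : normal_chart g c f ->
  chart_dom c (chart_inv c q) /\ chart_map c (chart_inv c q) = q.
Proof.
move=> [ac ic _ _]; apply: chart_imgK; first exact: atlas_is_chart.
by rewrite ic.
Qed.

Lemma smooth_into_local J gamma :
  (forall t, J t -> exists B c f X Y, [/\ open B, B t, normal_chart g c f,
     smooth_on B X /\ smooth_on B Y &
     forall s, B s -> gamma s = chart_inv c (X s, Y s)]) ->
  smooth_into J gamma.
Proof.
move=> H; split.
  move=> t /H [B [c' [f [X [Y [oB Bt nc [sX sY] gE]]]]]].
  have [ac' ic' _ _] := nc; have [_ _ _ _ ci] := atlas_is_chart ac'.
  have cc : {for t, continuous (chart_inv c' \o (fun s => (X s, Y s)))}.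
    apply: continuous_comp.
      exact: (cvg_pair (smooth_on_continuous sX Bt) (smooth_on_continuous sY Bt)).
    by apply: ci; rewrite ic'.
  suff : gamma @ t --> gamma t by [].
  rewrite (gE _ Bt); apply: cvg_trans cc; apply: near_eq_cvg.
  have : nbhs t B by exact: open_nbhs_nbhs.
  by apply: filterS => s Bs; rewrite gE.
move=> c ac n; apply: Cn_on_local => t [Jt ct].
have [B [c' [f [X [Y [oB Bt nc [sX sY] gE]]]]]] := H _ Jt.
have [ac' ic' _ _] := nc.
have oO : open (overlap c' c) by apply: overlap_open; exact: atlas_is_chart.
exists (B `&` (fun s => (X s, Y s)) @^-1` overlap c' c).
have o1 : open (B `&` (fun s => (X s, Y s)) @^-1` overlap c' c).
  apply: open_preimage_in => // s Bs.
  exact: (cvg_pair (smooth_on_continuous sX Bs) (smooth_on_continuous sY Bs)).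
split => //.
  split => //; exists (gamma t); first by rewrite gE//; split;
    [have [] := normal_chartK (X t, Y t) nc|rewrite -gE].
  by rewrite gE//; have [] := normal_chartK (X t, Y t) nc.
have CT := (atlas_compatible ac' ac).1 n.
have C1 : Cn_on n (B `&` (fun s => (X s, Y s)) @^-1` overlap c' c)
   (fun s => (transition c' c (X s, Y s)).1).
  apply: (Cn_on_curve oO o1 _ (Cn_on_fst oO CT)); first by move=> s [].
    by apply: Cn_on_subset (sX n) => s [].
  by apply: Cn_on_subset (sY n) => s [].
have C2 : Cn_on n (B `&` (fun s => (X s, Y s)) @^-1` overlap c' c)
   (fun s => (transition c' c (X s, Y s)).2).
  apply: (Cn_on_curve oO o1 _ (Cn_on_snd oO CT)); first by move=> s [].
    by apply: Cn_on_subset (sX n) => s [].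
  by apply: Cn_on_subset (sY n) => s [].
apply: (Cn_on_ext o1 _ (Cn_on_pair o1 C1 C2)) => s [Bs _].
by rewrite -surjective_pairing /= gE.
Qed.

(** The criterion by which the explicit curves are recognized as geodesics: near each time one
    normal chart is enough. *)
Lemma geodesic_of_local J gamma : open J -> is_interval J -> J !=set0 ->
  (forall t, J t -> exists B c f X Y, [/\ open B, B t, normal_chart g c f,
     smooth_on B X /\ smooth_on B Y &
     forall s, B s -> gamma s = chart_inv c (X s, Y s) /\ geodesic_eq f X Y s]) ->
  geodesic g J gamma.
Proof.
move=> oJ iJ J0 H.
have sg : smooth_into J gamma.
  apply: smooth_into_local => t /H [B [c [f [X [Y [oB Bt nc sXY HB]]]]]].
  by exists B, c, f, X, Y; split => // s /HB [].
split => // c t ac Jt ct /= w.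
have [cg Sg] := sg; have Cc := Sg c ac 2%N.
have [B [c' [f [X [Y [oB Bt nc [sX sY] HB]]]]]] := H _ Jt.
pose D := J `&` gamma @^-1` chart_dom c.
have oD : open D.
  by apply: open_preimage_in => //; have [] := atlas_is_chart ac.
have oDB : open (D `&` B) by exact: openI.
have DBt : (D `&` B) t by [].
have mE s : B s -> chart_dom c' (gamma s) /\ chart_map c' (gamma s) = (X s, Y s).
  by move=> /HB [-> _]; exact: normal_chartK nc.
have E1 s : (D `&` B) s -> X s = (chart_map c' (gamma s)).1.
  by move=> [_ /mE [_ ->]].
have E2 s : (D `&` B) s -> Y s = (chart_map c' (gamma s)).2.
  by move=> [_ /mE [_ ->]].
apply: (@geodesic_eq_transfer _ _ g c c' f ac nc gamma (D `&` B)) => //.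
- by move=> s [[_ cs] /mE []].
- by apply: Cn_on_subset Cc => s [].
- have [_ Gt] := HB _ Bt; exact: (geodesic_eq_ext oDB DBt E1 E2 Gt).
Qed.

Lemma geodesic_in_chart J gamma c f (D := J `&` gamma @^-1` chart_dom c)
    (X := fun s => (chart_map c (gamma s)).1)
    (Y := fun s => (chart_map c (gamma s)).2) :
  geodesic g J gamma -> normal_chart g c f ->
  [/\ open D, smooth_on D X, smooth_on D Y &
   forall s, D s -> [/\ gamma s = chart_inv c (X s, Y s), geodesic_eq f X Y s &
    sq_velocity g gamma s = metric_form (Y s) (f (Y s))
      (derive1 X s, derive1 Y s) (derive1 X s, derive1 Y s)]].
Proof.
move=> [oJ iJ J0 [cg sg] Hg] nc; have [ac ic sf gE] := nc.
have oD : open D.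
  by apply: open_preimage_in => //; have [] := atlas_is_chart ac.
have CD n : Cn_on n D (chart_map c \o gamma) := sg c ac n.
split => //; [by move=> n; exact: Cn_on_fst|by move=> n; exact: Cn_on_snd|].
move=> s Ds; have [Js cs] := Ds; split.
- rewrite -surjective_pairing; have [_ _ mK _ _] := atlas_is_chart ac.
  by rewrite mK.
- have G := Hg c s ac Js cs.
  have D1 := derive1_components Ds (CD 1%N).
  have D2 := derive1_components2 oD Ds (CD 2%N).
  have G' w := etrans (esym (christoffel_normal (chart_map c (gamma s))
     (derive1 (derive1 (chart_map c \o gamma)) s)
     (derive1 (chart_map c \o gamma) s) w nc)) (G w).
  rewrite D1 D2 in G'.
  (* The two lowered components are obtained by testing with the coordinate vectors. *)
  split.
    by have := G' (1, 0); rewrite /= mulr1 mulr0 addr0.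
  by have := G' (0, 1); rewrite /= mulr1 mulr0 add0r.
(* [sq_velocity] is computed in the arbitrary chart [chart_at], so it has to be transferred to the
   normal chart. *)
- rewrite /sq_velocity /=; set c0 := chart_at (gamma s).
  have [ac0 c0s] : atlas c0 /\ chart_dom c0 (gamma s).
    by rewrite /c0 /chart_at; case: cid.
  have oE : open (D `&` gamma @^-1` chart_dom c0).
    apply: open_preimage_in => //; last by have [] := atlas_is_chart ac0.
    by move=> u [Ju _]; exact: cg.
  apply: (@sq_norm_transfer _ _ g c0 c f ac0 nc gamma _ oE) => //.
    by move=> u [[_ ?] ?].
  by apply: Cn_on_subset (sg c0 ac0 2%N) => u [[]].
Qed.

End LocalGeodesics.

(** * The parabolic atlas *)

Section CyclicIndex.
Variables (k : nat) (hk : (1 <= k)%N).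

Let k2_gt0 : (0 < 2 * k)%N. Proof. by rewrite muln_gt0. Qed.

Lemma cyc_subproof (i : int) : (`|(i %% (2 * k)%:Z)%Z|%N < 2 * k)%N.
Proof.
rewrite -ltz_nat gez0_abs; last by rewrite modz_ge0// gt_eqF.
by rewrite ltz_pmod.
Qed.

Definition cyc (i : int) : 'I_(2 * k) := Ordinal (cyc_subproof i).
(** The number of times the sequence of all [2k] charts has been run through; each time costs one
    translation by [tau]. *)
Definition turn (i : int) : int := (i %/ (2 * k)%:Z)%Z.

Lemma cyc_turn i : i = turn i * (2 * k)%:Z + (cyc i : nat)%:Z.
Proof.
rewrite /= gez0_abs; last by rewrite modz_ge0// gt_eqF.
exact: divz_eq.
Qed.

Lemma cyc_turn_unique (i q : int) (j : 'I_(2 * k)) :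
  i = q * (2 * k)%:Z + (j : nat)%:Z -> turn i = q /\ cyc i = j.
Proof.
move=> E; have k0 : (2 * k)%:Z != 0 by rewrite gt_eqF.
have q1 : turn i = q.
  rewrite /turn E divzMDl// divz_small ?addr0//.
  by rewrite lez_nat leq0n /= ltz_nat ltn_ord.
split => //; apply/val_inj/eqP; rewrite -eqz_nat; apply/eqP.
have := cyc_turn i; rewrite q1 {1}E => /addrI ->//.
Qed.

Lemma cyc_ord (j : 'I_(2 * k)) : cyc (j : nat)%:Z = j.
Proof. by have [] := @cyc_turn_unique (j : nat)%:Z 0 j; rewrite ?mul0r ?add0r. Qed.

Lemma cyc_period i (m : int) : cyc (i + m * (2 * k)%:Z) = cyc i.
Proof.
have [] // := @cyc_turn_unique (i + m * (2 * k)%:Z) (turn i + m) (cyc i).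
by rewrite {1}(cyc_turn i) mulrDl addrAC.
Qed.

Lemma turn_period i (m : int) : turn (i + m * (2 * k)%:Z) = turn i + m.
Proof.
have [] // := @cyc_turn_unique (i + m * (2 * k)%:Z) (turn i + m) (cyc i).
by rewrite {1}(cyc_turn i) mulrDl addrAC.
Qed.

Lemma cycS i : cyc (i + 1) = ordS (cyc i) /\
  turn (i + 1) = turn i + ((cyc i).+1 == (2 * k)%N)%:Z.
Proof.
have ES : (ordS (cyc i) : nat) = ((cyc i).+1 %% (2 * k))%N by [].
have [e|ne] := eqVneq (cyc i).+1 (2 * k)%N.
  have [|-> ->] := @cyc_turn_unique (i + 1) (turn i + 1) (ordS (cyc i)) => //.
  rewrite ES {1}(cyc_turn i) e modnn addr0 mulrDl mul1r -addrA; congr (_ + _).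
  by apply: etrans (congr1 Posz e); rewrite intS addrC.
have lt : ((cyc i).+1 < 2 * k)%N by rewrite ltn_neqAle ne ltn_ord.
have [|-> ->] := @cyc_turn_unique (i + 1) (turn i) (ordS (cyc i)) => //.
  rewrite ES {1}(cyc_turn i) -addrA; congr (_ + _).
  by rewrite modn_small// intS addrC.
by rewrite addr0.
Qed.

Lemma odd_ordS (j : 'I_(2 * k)) : odd (ordS j) = ~~ odd j.
Proof. by rewrite /= odd_mod // mul2n odd_double. Qed.

Lemma ordS_neq (j : 'I_(2 * k)) : j != ordS j.
Proof.
by apply/eqP => /(congr1 (odd \o @nat_of_ord _)); rewrite /= odd_ordS; case: odd.
Qed.

End CyclicIndex.

(** * Functions of the angle glued from overlapping strips *)

Section Gluing.
Context {R : realType}.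
Implicit Types (th : R) (i : int).

(** The index [i] for which [th] lies in the half-open interval of length [pi] centred at [i pi],
    well inside the strip of half-width [pi] where the [i]-th piece lives. *)
Definition nearest th : int := Num.floor (th / pi + 2^-1).

Lemma nearest_itv th : (nearest th)%:~R * pi - pi / 2 <= th <
  (nearest th)%:~R * pi + pi / 2.
Proof.
have /andP[h1 h2] := floor_itv (th / pi + 2^-1); rewrite -/(nearest th) in h1 h2.
rewrite intrD in h2; set n := (nearest th)%:~R in h1 h2 *.
have p0 := @pi_gt0 R.
have E : th = th / pi * pi by rewrite divfK// gt_eqF.
set x := th / pi in h1 h2 E; rewrite E.
by apply/andP; split; nra.
Qed.

Lemma nearest_cases th i : (i - 1)%:~R * pi < th < (i + 1)%:~R * pi ->
  [\/ nearest th = i,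
      nearest th = i - 1 /\ (i - 1)%:~R * pi < th < i%:~R * pi |
      nearest th = i + 1 /\ i%:~R * pi < th < (i + 1)%:~R * pi].
Proof.
move=> /andP[h1 h2]; have /andP[n1 n2] := nearest_itv th.
set j := nearest th in n1 n2 *; have p0 := @pi_gt0 R.
have e1 : (1 : int)%:~R = 1 :> R by [].
have e2 : (2 : int)%:~R = 2 :> R by [].
have ji : j < i + 2.
  rewrite -(ltr_int R) -(ltr_pM2r p0).
  move: h1 h2 n1 n2; rewrite !intrD => h1 h2 n1 n2.
  by move: h1 h2 n1 n2; rewrite ?e2 ?e1; nra.
have ij : i - 2 < j.
  rewrite -(ltr_int R) -(ltr_pM2r p0).
  move: h1 h2 n1 n2; rewrite !intrD => h1 h2 n1 n2.
  by move: h1 h2 n1 n2; rewrite ?mulrNz ?e2 ?e1; nra.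
have : (j == i) || (j == i - 1) || (j == i + 1) by lia.
move=> /orP[/orP[]|] /eqP e; [by constructor 1|constructor 2|constructor 3]; split => //.
  by rewrite h1 /=; move: n2; rewrite e intrD mulrNz e1; nra.
by rewrite h2 andbT; move: n1; rewrite e intrD e1; nra.
Qed.

Lemma nearest_in th : (nearest th - 1)%:~R * pi < th < (nearest th + 1)%:~R * pi.
Proof.
have /andP[n1 n2] := nearest_itv th; have p0 := @pi_gt0 R.
by rewrite !intrD; apply/andP; split; nra.
Qed.

Lemma nearestD th i : nearest (th + i%:~R * pi) = nearest th + i.
Proof.
rewrite /nearest mulrDl mulfK ?gt_eqF ?pi_gt0// addrAC floorDrz ?intr_int//.
by rewrite intrKfloor.
Qed.

Definition glue (T : Type) (F : int -> R -> T) th : T := F (nearest th) th.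

(** A point of the strip of [i] has nearest index [i - 1], [i] or [i + 1], and in the outer cases it
    lies in the overlap of the two strips; agreement of consecutive pieces therefore suffices. *)
Lemma glueE (T : Type) (F : int -> R -> T) i th :
  (forall j x, j%:~R * pi < x < (j + 1)%:~R * pi -> F j x = F (j + 1) x) ->
  (i - 1)%:~R * pi < th < (i + 1)%:~R * pi -> glue F th = F i th.
Proof.
move=> H /nearest_cases [e|[e h]|[e h]]; rewrite /glue e //.
  by rewrite H subrK.
by rewrite -H.
Qed.

End Gluing.

Section ParabolicCharts.
Context {R : realType} {S : surface R} (g : lorentzian_metric S).
Variables (k : nat) (tau : R) (phi : 'I_(2 * k) -> chart R S)
  (f : 'I_(2 * k) -> R -> R).
Hypotheses (hk : (1 <= k)%N) (hA : parabolic_atlas g tau phi f).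

(** The sign [(-1)^i], consistently read off the residue because [2k] is even. It is also the sign
    of [y] on the half-plane where charts [i] and [i + 1] are glued. *)
Definition sgc (i : int) : R := (-1) ^+ cyc hk i.

Lemma sgcS i : sgc (i + 1) = - sgc i.
Proof.
rewrite /sgc; have [-> _] := cycS hk i.
by rewrite -signr_odd odd_ordS -(signr_odd _ (cyc hk i)); case: odd;
  rewrite /= ?expr0 ?expr1 ?opprK.
Qed.

Lemma sgcB1 i : sgc (i - 1) = - sgc i.
Proof. by rewrite -[in RHS](subrK 1 i) sgcS opprK. Qed.

Lemma sgc_sqr i : sgc i * sgc i = 1.
Proof. by rewrite /sgc -signr_odd; case: odd; rewrite /= ?expr0 ?expr1 ?mulrNN mulr1. Qed.

Lemma sgc_neq0 i : sgc i != 0.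
Proof. by rewrite signr_eq0. Qed.

Lemma sgc0 : sgc 0 = 1.
Proof. by rewrite /sgc; have -> : cyc hk 0 = 0%N :> nat by rewrite /= mod0z. Qed.

Lemma sin_shift i (th : R) : sin (th - i%:~R * pi) = sgc i * sin th.
Proof.
elim/int_rec: i => [|n IH|n IH].
- by rewrite sgc0 mul0r subr0 mul1r.
- rewrite intS (addrC 1) sgcS mulNr -IH intrD mulrDl mul1r opprD addrA.
  by rewrite -[in RHS](subrK pi (th - _)) sinDpi opprK.
- rewrite intS (addrC 1) opprD sgcB1 mulNr -IH intrB mulrBl mul1r opprB.
  by rewrite addrA addrAC sinDpi.
Qed.

Lemma cos_shift i (th : R) : cos (th - i%:~R * pi) = sgc i * cos th.
Proof.
elim/int_rec: i => [|n IH|n IH].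
- by rewrite sgc0 mul0r subr0 mul1r.
- rewrite intS (addrC 1) sgcS mulNr -IH intrD mulrDl mul1r opprD addrA.
  by rewrite -[in RHS](subrK pi (th - _)) cosDpi opprK.
- rewrite intS (addrC 1) opprD sgcB1 mulNr -IH intrB mulrBl mul1r opprB.
  by rewrite addrA addrAC cosDpi.
Qed.

Lemma parabolic_normal j : normal_chart g (phi j) (f j).
Proof.
have [[at_ _] im _ _ hf] := hA; have [sf _ gE] := hf j.
by split => // q u v; rewrite gE.
Qed.

Definition shift_at (j : 'I_(2 * k)) : R := if j.+1 == (2 * k)%N then tau else 0.

Let glued_side (j : 'I_(2 * k)) (y : R) : 0 < (-1) ^+ j * y ->
  if odd j then y < 0 else 0 < y.
Proof.
by rewrite -signr_odd; case: odd; rewrite /= ?expr1 ?expr0 ?mulN1r ?mul1r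
  ?oppr_gt0.
Qed.

Lemma transitionE (j : 'I_(2 * k)) (q : R * R) : 0 < (-1) ^+ j * q.2 ->
  transition (phi j) (phi (ordS j)) q = (- q.1 + 2 / q.2 + shift_at j, q.2).
Proof.
move=> /glued_side; have [_ _ _ [up down] _] := hA.
have [oj y0|ej y0] := boolP (odd j); first exact: down.
rewrite up// /shift_at; case: eqP => [e|_]; last by rewrite addr0.
by have := congr1 odd e; rewrite /= (negPf ej) mul2n odd_double.
Qed.

Lemma overlap_ordS (j : 'I_(2 * k)) (q : R * R) : 0 < (-1) ^+ j * q.2 ->
  overlap (phi j) (phi (ordS j)) q.
Proof.
move=> /glued_side y0; have [_ _ ov _ _] := hA.
rewrite ov ?ordS_neq//= /glued_up /glued_down eqxx !andbT.
by case: (odd j) y0 => /= y0; [right|left].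
Qed.

Lemma chart_inv_ordS (j : 'I_(2 * k)) (x y : R) : 0 < (-1) ^+ j * y ->
  chart_inv (phi j) (x, y) =
  chart_inv (phi (ordS j)) (- x + 2 / y + shift_at j, y).
Proof.
move=> y0; have := @transitionE j (x, y) y0; rewrite /= => <-.
have [at1 _ _ _] := parabolic_normal j.
have [at2 _ _ _] := parabolic_normal (ordS j).
have := overlap_ordS (q := (x, y)) y0; rewrite (overlapE _ (atlas_is_chart at1)).
move=> [_ d2]; have [_ _ mK _ _] := atlas_is_chart at2.
by rewrite /transition /= mK.
Qed.

(** The metric is compared on [d/dy]. The gluing map sends it to [(- 2 / y^2, 1)], and
    [y^2 * 4 / y^4 - 4 / y^2 = 0], so the [dy^2] coefficient is unchanged: the term [2 / y] is what
    makes the gluing isometric. *)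
Lemma f_ordS (j : 'I_(2 * k)) (y : R) : 0 < (-1) ^+ j * y ->
  f j y = f (ordS j) y.
Proof.
move=> y0.
have [at1 _ _ g1] := parabolic_normal j.
have [at2 _ _ g2] := parabolic_normal (ordS j).
have yn0 : y != 0 by apply: contraTneq y0 => ->; rewrite mulr0 ltxx.
have O := overlap_ordS (q := (0, y)) y0.
have := pullback_transition g at1 at2 O (0, 1) (0, 1).
rewrite g1 g2 transitionE //.
set T := transition _ _.
have CT := (atlas_compatible at1 at2).1 1%N.
have DT : is_derive ((0, y) : R * R) (0, 1) T ('D_(0, 1) T (0, y)).
  by have [_ /(_ (0, 1)) [d _]] := CT; apply: derivableP; exact: d.
have D1 := is_derive_fst DT; have D2 := is_derive_snd DT.
have P1 := is_derive_partial2 (@ex_derive _ _ _ _ _ _ _ D1).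
have P2 := is_derive_partial2 (@ex_derive _ _ _ _ _ _ _ D2).
rewrite (@derive_val _ _ _ _ _ _ _ D1) in P1.
rewrite (@derive_val _ _ _ _ _ _ _ D2) in P2.
have nT : \forall r \near y, T (0, r) = (- 0 + 2 / r + shift_at j, r).
  have [c0|c0] := ltP 0 y; last first.
    have {}c0 : y < 0 by rewrite lt_neqAle yn0.
    near=> r; rewrite /T transitionE //=.
    have r0 : r < 0 by near: r; exact: lt_nbhsl.
    by rewrite nmulr_lgt0//; move: y0; rewrite nmulr_lgt0.
  near=> r; rewrite /T transitionE //=.
  have r0 : 0 < r by near: r; exact: lt_nbhsr.
  by rewrite pmulr_lgt0//; move: y0; rewrite pmulr_lgt0.
have Q1 : is_derive y 1 (fun r : R => - 0 + 2 / r + shift_at j) (- 2 / y ^+ 2).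
  rewrite (_ : (fun r : R => _) =
     cst (- 0) + 2 \*: (fun r : R => r^-1) + cst (shift_at j)) //.
  apply: (is_derive_eq (is_deriveD (is_deriveD (is_derive_cst _ _ _)
    (is_deriveZ 2 (is_deriveV yn0 (is_derive_id y 1)))) (is_derive_cst _ _ _))).
  by rewrite add0r addr0 -[_ *: _]/(_ * _) -[_ *: _]/(_ * _) mulr1 mulrN mulNr.
have n1 : \forall r \near y, (T (0, r)).1 = - 0 + 2 / r + shift_at j.
  by near=> r; rewrite (near nT r).
have n2 : \forall r \near y, (T (0, r)).2 = r.
  by near=> r; rewrite (near nT r).
have [_ E1] := @near_eq_is_derive R _ _ (fun r => (T (0, r)).1) _ y 1 _ n1 P1.
have [_ E2] := @near_eq_is_derive R _ _ (fun r => (T (0, r)).2) _ y 1 _ n2 P2.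
move: E1 E2; have [_ ->] := Q1; have [_ ->] := is_derive_id y 1.
case: ('D_(0, 1) T (0, y)) => a b /= <- <-.
rewrite /metric_form /= => E; apply: (etrans _ (etrans E _)); first by ring.
by field.
Unshelve. all: by end_near. Qed.

End ParabolicCharts.

(** * Explicit geodesics *)

Section FirstIntegrals.
Context {R : realType}.
Variable f : R -> R.
Hypotheses (sf : smooth_on setT f) (f1 : forall y, 0 < 1 - y ^+ 2 * f y).

(* [hh] is [1 + kappa]; the quotient [gg] extends [(1 - hh) / y^2] smoothly
   across [y = 0]. *)
Definition hh (y : R) : R := Num.sqrt (1 - y ^+ 2 * f y).
Definition gg (y : R) : R := f y / (1 + hh y).

Lemma hh_gt0 y : 0 < hh y.
Proof. by rewrite sqrtr_gt0. Qed.

Lemma hh_sqr y : hh y ^+ 2 = 1 - y ^+ 2 * f y.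
Proof. by rewrite sqr_sqrtr// ltW. Qed.

Lemma hh_smooth : smooth_on setT hh.
Proof.
have oT : open [set: R] by exact: openT.
apply: smooth_on_sqrt => //.
rewrite (_ : (fun y => _) = (fun y => cst 1 y + (- 1) * (y * y * f y))).
  apply: smooth_onD => //; first exact: smooth_on_cst.
  apply: smooth_onZ => //; apply: smooth_onM => //.
  by apply: smooth_onM => //; exact: smooth_on_id.
by apply/funext => y /=; rewrite mulN1r expr2.
Qed.

Lemma gg_smooth : smooth_on setT gg.
Proof.
have oT : open [set: R] by exact: openT.
apply: smooth_onM => //; apply: smooth_onV => //.
  by move=> y _; rewrite gt_eqF// ltr_wpDl ?hh_gt0.
by apply: smooth_onD => //; [exact: smooth_on_cst|exact: hh_smooth].
Qed.

Lemma sqr_gg y : y ^+ 2 * gg y = 1 - hh y.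
Proof.
have h0 : 1 + hh y != 0 by rewrite gt_eqF// ltr_wpDl ?hh_gt0.
apply: (mulIf h0); rewrite /gg mulrA divfK//.
have := hh_sqr y; move: (hh y) (f y) => a b E.
have -> : y ^+ 2 * b = 1 - a ^+ 2 by rewrite E; ring.
by ring.
Qed.

Lemma hh_derive y : 2 * hh y * derive1 hh y =
  - (2 * y * f y + y ^+ 2 * derive1 f y).
Proof.
have Df : is_derive y 1 f (derive1 f y) by exact: smooth_on_is_derive.
have Dh : is_derive y 1 hh (derive1 hh y).
  by apply: (smooth_on_is_derive hh_smooth).
have D1 : is_derive y 1 (fun z => hh z * hh z)
    (hh y * derive1 hh y + hh y * derive1 hh y) by exact: (is_deriveM Dh Dh).
have Di := is_derive_id y (1 : R).
have D2 := is_deriveB (is_derive_cst (1 : R) y (1 : R))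
  (is_deriveM (is_deriveM Di Di) Df).
have E : (fun z => hh z * hh z) = cst 1 - id * id * f.
  by apply/funext => z; rewrite -expr2 hh_sqr expr2.
rewrite E in D1.
have := etrans (esym (@derive_val _ _ _ _ _ _ _ D1)) (@derive_val _ _ _ _ _ _ _ D2).
rewrite -![_ *: _]/(_ * _) /= mulrfctE.
move=> E2; have -> : 2 * hh y * derive1 hh y =
  hh y * derive1 hh y + hh y * derive1 hh y by ring.
by rewrite E2; ring.
Qed.

Variables (X Y : R -> R) (B : set R) (t : R).
Hypotheses (sX : smooth_on B X) (sY : smooth_on B Y) (Bt : B t).

(** The product [g(gamma', d/dx)], conserved because [d/dx] is a Killing field. *)
Definition clairaut (s : R) : R := Y s ^+ 2 * derive1 X s + derive1 Y s.
Definition energy (s : R) : R := metric_form (Y s) (f (Y s))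
  (derive1 X s, derive1 Y s) (derive1 X s, derive1 Y s).

Let v := (derive1 X t, derive1 Y t).
Let a := (derive1 (derive1 X) t, derive1 (derive1 Y) t).

Let DX : is_derive t 1 X v.1.
Proof. exact: (smooth_on_is_derive sX). Qed.
Let DY : is_derive t 1 Y v.2.
Proof. exact: (smooth_on_is_derive sY). Qed.
Let DX1 : is_derive t 1 (derive1 X) a.1.
Proof. exact: (smooth_on_is_derive (smooth_on_derive1 sX)). Qed.
Let DY1 : is_derive t 1 (derive1 Y) a.2.
Proof. exact: (smooth_on_is_derive (smooth_on_derive1 sY)). Qed.

Lemma clairaut_derive : is_derive t 1 clairaut (accel1 (Y t) v a).
Proof.
have D := is_deriveD (is_deriveM (is_deriveM DY DY) DX1) DY1.
have -> : clairaut = Y * Y * derive1 X + derive1 Y.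
  by apply/funext => s; rewrite /clairaut expr2.
apply: (is_derive_eq D); rewrite -![_ *: _]/(_ * _) /= !mulrfctE /accel1 /=.
by move: (derive1 X t) (derive1 Y t) (derive1 _ _) (derive1 _ _) => *; ring.
Qed.

Lemma energy_derive : is_derive t 1 energy
  (2 * derive1 X t * accel1 (Y t) v a +
   2 * derive1 Y t * accel2 (Y t) (f (Y t)) (derive1 f (Y t)) v a).
Proof.
have Df : is_derive (Y t) 1 f (derive1 f (Y t)) by exact: smooth_on_is_derive.
apply: (is_derive_eq (is_derive_metric DY DX1 DX1 DY1 DY1 Df)).
rewrite /dmetric /accel1 /accel2 /=.
move: (derive1 X t) (derive1 Y t) (f (Y t)) => x y z.
move: (derive1 (derive1 X) t) (derive1 (derive1 Y) t) (derive1 f (Y t)) => *.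
by field.
Qed.

(** On a geodesic of energy [E] this reads [(h y')' = - E y / h]. Together with [y' = (h y') / h] it
    says that [(sqrt E y, h y')] rotates with angular velocity [sqrt E / h], for [E > 0]. *)
Lemma turning_derive : is_derive t 1 (fun s => hh (Y s) * derive1 Y s)
  ((accel1 (Y t) v a
    - Y t ^+ 2 * accel2 (Y t) (f (Y t)) (derive1 f (Y t)) v a
    - energy t * Y t) / hh (Y t)).
Proof.
have Dh : is_derive (Y t) 1 hh (derive1 hh (Y t)).
  by apply: (smooth_on_is_derive hh_smooth).
have D := is_deriveM (is_derive1_comp Dh DY) DY1.
apply: (is_derive_eq D).
have h0 : hh (Y t) != 0 by rewrite gt_eqF// hh_gt0.
apply: (mulfI h0); rewrite [RHS]mulrC divfK//.
rewrite -![_ *: _]/(_ * _) /= /accel1 /accel2 /energy /metric_form /=.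
have := hh_sqr (Y t); have := hh_derive (Y t); rewrite /v /a /=.
move: (derive1 X t) (derive1 Y t) (f (Y t)) => x y z.
move: (derive1 (derive1 X) t) (derive1 (derive1 Y) t) (derive1 f (Y t)) => xx yy zz.
move: (Y t) (derive1 hh (Y t)) (hh (Y t)) => u h' h E1 E2.
have E3 : h * h' = - (u * z + 2^-1 * (u ^+ 2 * zz)).
  have -> : h * h' = 2^-1 * (2 * h * h') by field.
  by rewrite E1; field.
have -> : h * (h * yy + y * (h' * y)) = h ^+ 2 * yy + (h * h') * y ^+ 2 by ring.
by rewrite E2 E3; field.
Qed.

(** Completion of the square in the metric; the remaining factor [hh ^+ 2] is minus its
    determinant. *)
Lemma clairaut_energy : clairaut t ^+ 2 =
  (hh (Y t) * derive1 Y t) ^+ 2 + energy t * Y t ^+ 2.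
Proof.
rewrite /clairaut /energy /metric_form /= exprMn hh_sqr.
by move: (derive1 X t) (derive1 Y t) (f (Y t)) => *; ring.
Qed.

(* [accel1] is the derivative of the Clairaut integral; for [accel2], note that
   [Y] and [Y'] do not vanish together on a curve of nonzero energy. *)
Lemma geodesic_eq_of_integrals : energy t != 0 ->
  is_derive t 1 clairaut 0 -> is_derive t 1 energy 0 ->
  is_derive t 1 (fun s => hh (Y s) * derive1 Y s)
    (- (energy t * Y t) / hh (Y t)) ->
  geodesic_eq f X Y t.
Proof.
move=> E0 [_ Dc] [_ De] [_ Dt].
have A1 : accel1 (Y t) v a = 0 by have [_ <-] := clairaut_derive.
have A2 : derive1 Y t * accel2 (Y t) (f (Y t)) (derive1 f (Y t)) v a = 0.
  have : 'D_1 energy t = 0 := De; have [_ ->] := energy_derive.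
  rewrite A1 mulr0 add0r -mulrA => /eqP; rewrite mulf_eq0 pnatr_eq0 /=.
  by move=> /eqP.
have A3 : Y t ^+ 2 * accel2 (Y t) (f (Y t)) (derive1 f (Y t)) v a = 0.
  have : 'D_1 (fun s => hh (Y s) * derive1 Y s) t = _ := Dt.
  have [_ ->] := turning_derive; rewrite A1 sub0r.
  have h0 : (hh (Y t))^-1 != 0 by rewrite invr_eq0 gt_eqF// hh_gt0.
  move=> /(mulIf h0) /eqP; rewrite -subr_eq0 opprK subrK oppr_eq0.
  by move=> /eqP.
split => //; apply/eqP; apply: contraNT E0 => A0.
have Y0 : Y t = 0.
  by move/eqP: A3; rewrite mulf_eq0 (negPf A0) orbF sqrf_eq0 => /eqP.
have Y'0 : derive1 Y t = 0.
  by move/eqP: A2; rewrite mulf_eq0 (negPf A0) orbF => /eqP.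
by rewrite /energy /metric_form /= Y0 Y'0 expr0n /= !mul0r !mulr0 !addr0.
Qed.

End FirstIntegrals.

(** * Primitives used as integrals from zero *)

Section Primitive.
Context {R : realType}.
Implicit Types g : R -> R.

(** Plays the role of the integral of [g] from [0]. The default value [cst 0] is taken only when [g]
    has no primitive, so never for a continuous [g]. *)
Definition prim g : R -> R :=
  xget (cst 0) [set F | F 0 = 0 /\ forall x : R, is_derive x 1 F (g x)].

Lemma primP g : continuous g ->
  prim g 0 = 0 /\ forall x : R, is_derive x 1 (prim g) (g x).
Proof.
move=> /antiderivative [F HF].
suff : [set F | F 0 = 0 /\ forall x : R, is_derive x 1 F (g x)] (prim g) by [].
by apply: xgetPex; exists F.
Qed.

Lemma prim0 g : continuous g -> prim g 0 = 0.
Proof. by case/primP. Qed.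

Lemma is_derive_prim g (x : R) : continuous g -> is_derive x 1 (prim g) (g x).
Proof. by move=> /primP[]. Qed.

Lemma derive_eq_subr (F K d : R -> R) : (forall x : R, is_derive x 1 F (d x)) ->
  (forall x : R, is_derive x 1 K (d x)) -> forall x y, F x - F y = K x - K y.
Proof.
move=> DF DK x y.
have D (z : R) : is_derive z 1 (F - K) 0.
  by rewrite -(subrr (d z)); apply: is_deriveB.
have E : F x - K x = F y - K y := is_derive_0_is_cst x y D.
by move: E; move: (F x) (F y) (K x) (K y) => *; lra.
Qed.

Lemma primE g (F : R -> R) : continuous g ->
  (forall x : R, is_derive x 1 F (g x)) -> forall x, prim g x = F x - F 0.
Proof.
move=> cg DF x.
have := derive_eq_subr (fun x => is_derive_prim x cg) DF x 0.
by rewrite prim0// subr0.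
Qed.

Lemma prim_period g (p : R) : continuous g -> (forall x, g (x + p) = g x) ->
  forall x, prim g (x + p) = prim g x + prim g p.
Proof.
move=> cg gp x.
have D (z : R) : is_derive z 1 (fun z => prim g (z + p)) (g z).
  have Ds : is_derive z 1 (fun z : R => z + p) 1.
    by have := is_deriveD (is_derive_id z (1 : R)) (is_derive_cst p z 1);
      rewrite addr0.
  have := @is_derive1_comp R (prim g) (fun z => z + p) z _ _
    (is_derive_prim (z + p) cg) Ds.
  by rewrite mulr1 gp.
rewrite (primE cg D x) /= add0r; ring.
Qed.

End Primitive.

Section HalfAngle.
Context {R : realType}.
Implicit Types u th : R.

Lemma cos_half th : cos th = 2 * cos (th / 2) ^+ 2 - 1.
Proof.
have {1}-> : th = (th / 2) *+ 2 by rewrite mulr2n -splitr.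
by rewrite cos_mulr2n mulr_natl.
Qed.

Lemma sin_half th : sin th = 2 * (sin (th / 2) * cos (th / 2)).
Proof.
have {1}-> : th = (th / 2) *+ 2 by rewrite mulr2n -splitr.
by rewrite sin_mulr2n mulr_natl (mulrC (cos _)).
Qed.

Lemma cos_half_gt0 th : - pi < th < pi -> 0 < cos (th / 2).
Proof. by move=> /andP[h1 h2]; apply: cos_gt0_pihalf; apply/andP; split; lra. Qed.

Lemma cosD1_gt0 th : - pi < th < pi -> 0 < 1 + cos th.
Proof.
move=> /cos_half_gt0 c0; rewrite cos_half.
by have := exprn_gt0 2 c0; lra.
Qed.

Lemma is_derive_tan_half th : - pi < th < pi ->
  is_derive th 1 (fun z => tan (z / 2)) (1 + cos th)^-1.
Proof.
move=> hth; have c0 := cos_half_gt0 hth.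
have Ds : is_derive th 1 (fun z : R => z / 2) 2^-1.
  rewrite (_ : (fun z => _) = 2^-1 \*: id); last by apply/funext => z /=; rewrite mulrC.
  by have := is_deriveZ 2^-1 (is_derive_id th (1 : R)); rewrite [_ *: 1]mulr1.
have Dt : is_derive (th / 2) 1 tan (cos (th / 2) ^- 2).
  by apply: is_derive_tan; rewrite gt_eqF.
have := @is_derive1_comp R tan (fun z => z / 2) th _ _ Dt Ds.
rewrite (_ : _ * _ = (1 + cos th)^-1) // (cos_half th) addrCA subrr addr0.
by field; rewrite gt_eqF.
Qed.

Lemma atan_tan_half th : - pi < th < pi ->
  th = 2 * atan (sin th / (1 + cos th)).
Proof.
move=> hth; have c0 := cos_half_gt0 hth.
have -> : sin th / (1 + cos th) = tan (th / 2).
  rewrite (sin_half th) (cos_half th) /tan addrCA subrr addr0.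
  by field; rewrite gt_eqF.
rewrite tanK; first by rewrite mulrC divfK.
by rewrite in_itv /=; apply/andP; split; move/andP: hth => [? ?]; lra.
Qed.

(** Angle of a point of the unit circle from [tan (th / 2) = sin th / (1 + cos th)]. Unlike arcsine
    or arccosine this is smooth in [(p, r)] and covers the whole interval []-pi, pi[]. *)
Lemma sin_cos_2atan (p r : R) : p ^+ 2 + r ^+ 2 = 1 -> r != -1 ->
  let th := 2 * atan (p / (1 + r)) in
  [/\ - pi < th < pi, sin th = p & cos th = r].
Proof.
move=> E r1 th; have r0 : 1 + r != 0 by rewrite addrC addr_eq0.
have ht : - pi < th < pi.
  by rewrite /th; have := atan_gtNpi2 (p / (1 + r));
     have := atan_ltpi2 (p / (1 + r)); lra.
have c0 := cos_half_gt0 ht.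
have th2 : th / 2 = atan (p / (1 + r)) by rewrite /th mulrC mulKf.
have tE : tan (th / 2) = p / (1 + r) by rewrite th2 atanK.
have := cos2_tan2 (lt0r_neq0 c0); rewrite tE => cE.
have pE : p ^+ 2 = (1 - r) * (1 + r).
  have -> : (1 - r) * (1 + r) = 1 - r ^+ 2 by ring.
  by rewrite -E addrK.
have cc : cos (th / 2) ^+ 2 = (1 + r) / 2.
  apply: invr_inj; rewrite cE expr_div_n pE; field.
  by rewrite r0.
have cth : cos th = r by rewrite (cos_half th) cc; field.
split => //.
have -> : sin th = 2 * (tan (th / 2) * cos (th / 2) ^+ 2).
  by rewrite (sin_half th) /tan; field; rewrite gt_eqF.
by rewrite tE cc; field.
Qed.

End HalfAngle.

Section ExplicitGeodesics.
Context {R : realType} {S : surface R} (g : lorentzian_metric S).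
Variables (k : nat) (tau : R) (phi : 'I_(2 * k) -> chart R S)
  (f : 'I_(2 * k) -> R -> R).
Hypotheses (hk : (1 <= k)%N) (hA : parabolic_atlas g tau phi f).

Notation ff i := (f (cyc hk i)).
Notation pp i := (phi (cyc hk i)).
Notation s i := (@sgc R k hk i).

Definition strip (i : int) : set R :=
  [set th | (i - 1)%:~R * pi < th < (i + 1)%:~R * pi].

Lemma f_smooth j : smooth_on setT (f j).
Proof. by have [_ _ _ _ /(_ j) []] := hA. Qed.

Lemma f_lt1 j y : 0 < 1 - y ^+ 2 * f j y.
Proof. by have [_ _ _ _ /(_ j) []] := hA. Qed.

Lemma strip_open i : open (strip i).
Proof.
rewrite (_ : strip i = [set` `](i - 1)%:~R * pi, (i + 1)%:~R * pi[%R]).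
  exact: interval_open.
by apply/seteqP; split => th; rewrite /= in_itv.
Qed.

Lemma strip_nearest th : strip (nearest th) th.
Proof. exact: nearest_in. Qed.

Lemma strip_shift i th : strip i th <-> - pi < th - i%:~R * pi < pi.
Proof.
rewrite /strip /= !intrD mulrNz !mulrDl mulNr !mul1r.
by split => /andP[h1 h2]; apply/andP; split; move: h1 h2;
  move: (_ * _) => ?; lra.
Qed.

(** Matches angles with the gluing: on the common half of two consecutive strips, [a sin th] lies on
    the side where the two charts are glued. *)
Lemma strip_sin i th : i%:~R * pi < th < (i + 1)%:~R * pi ->
  0 < s i * sin th /\ strip i th /\ strip (i + 1) th.
Proof.
rewrite intrD mulrDl mul1r => /andP[h1 h2]; have p0 := @pi_gt0 R; split.
  rewrite -(sin_shift hk); apply: sin_gt0_pi.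
  by apply/andP; split; move: h1 h2; move: (_ * _) => ?; lra.
by split; apply/strip_shift; rewrite ?intrD ?mulrDl ?mul1r;
  apply/andP; split; move: h1 h2; move: (_ * _) => ?; lra.
Qed.

Section Amplitude.
Variables (a : R) (a0 : 0 < a).

(** The value of [h] along [y = a sin th]. It is the derivative of time with respect to the angle
    when [e = 1]; the angle itself moves with velocity [e / speed]. *)
Definition speed : R -> R := glue (fun i th => hh (ff i) (a * sin th)).
Definition drift : R -> R := glue (fun i th => gg (ff i) (a * sin th)).

Let f_agree i th : i%:~R * pi < th < (i + 1)%:~R * pi ->
  ff i (a * sin th) = ff (i + 1) (a * sin th).
Proof.
move=> /strip_sin [h _]; have [-> _] := cycS hk i.
by apply: (f_ordS hA); rewrite mulrCA mulr_gt0.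
Qed.

Lemma speedE i th : strip i th -> speed th = hh (ff i) (a * sin th).
Proof.
move=> hth; rewrite /speed (glueE (i := i)) // => j x hx.
by rewrite /hh f_agree.
Qed.

Lemma driftE i th : strip i th -> drift th = gg (ff i) (a * sin th).
Proof.
move=> hth; rewrite /drift (glueE (i := i)) // => j x hx.
by rewrite /gg /hh f_agree.
Qed.

Let oT : open [set: R]. Proof. exact: openT. Qed.

Let smooth_asin : smooth_on setT (fun th : R => a * sin th).
Proof. by apply: smooth_onZ => //; case: (@smooth_sin_cos R). Qed.

Lemma speed_smooth : smooth_on setT speed.
Proof.
move=> n; apply: Cn_on_local => th _; exists (strip (nearest th)).
split; [exact: strip_open|exact: strip_nearest|].
apply: (@Cn_on_ext _ _ _ n _ (hh (ff (nearest th)) \o (fun th => a * sin th))).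
- exact: strip_open.
- by move=> x hx; rewrite (speedE hx).
- apply: Cn_on_subset (smooth_on_comp oT oT _ _ smooth_asin n) => //.
  by apply: hh_smooth; [exact: f_smooth|exact: f_lt1].
Qed.

Lemma drift_smooth : smooth_on setT drift.
Proof.
move=> n; apply: Cn_on_local => th _; exists (strip (nearest th)).
split; [exact: strip_open|exact: strip_nearest|].
apply: (@Cn_on_ext _ _ _ n _ (gg (ff (nearest th)) \o (fun th => a * sin th))).
- exact: strip_open.
- by move=> x hx; rewrite (driftE hx).
- apply: Cn_on_subset (smooth_on_comp oT oT _ _ smooth_asin n) => //.
  by apply: gg_smooth; [exact: f_smooth|exact: f_lt1].
Qed.

Lemma speed_continuous : continuous speed.
Proof. by move=> x; exact: (smooth_on_continuous speed_smooth). Qed.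

Lemma drift_continuous : continuous drift.
Proof. by move=> x; exact: (smooth_on_continuous drift_smooth). Qed.

Lemma speed_gt0 th : 0 < speed th.
Proof. by rewrite /speed /glue hh_gt0//; exact: f_lt1. Qed.

(** Compactness of [[-a, a]] in each of finitely many charts. Through [derive_inverse] this bound
    makes the explicit geodesics defined for all times. *)
Lemma speed_lower_bound : exists2 m, 0 < m & forall th, m <= speed th.
Proof.
have H j : exists m, 0 < m /\ forall th, m <= hh (f j) (a * sin th).
  have ab : - a <= a by rewrite ge0_cp// ltW.
  have [|c _ hc] := @EVT_min R (hh (f j)) (- a) a ab.
    apply: continuous_subspaceT => y.
    exact: (smooth_on_continuous (hh_smooth (f_smooth j) (f_lt1 j))).
  exists (hh (f j) c); split; first exact: hh_gt0 (f_lt1 j) c.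
  move=> th; apply: hc; rewrite in_itv /= -ler_norml normrM gtr0_norm//.
  by rewrite -[leRHS]mulr1 ler_pM2l// sin_max.
have [m hm] := choice H.
have m0 j : 0 < m j by case: (hm j).
have Sm j : (m j)^-1 <= \sum_j (m j)^-1.
  by rewrite (bigD1 j) //= lerDl sumr_ge0// => i _; rewrite invr_ge0 ltW.
pose j0 := cyc hk 0.
have S0 : 0 < \sum_j (m j)^-1.
  by apply: lt_le_trans (Sm j0); rewrite invr_gt0.
(* The inverse of the sum of the inverses lies below every [m j], so no minimum over the index set
   is needed. *)
exists (\sum_j (m j)^-1)^-1; first by rewrite invr_gt0.
move=> th; rewrite /speed /glue; set j := cyc hk _.
apply: le_trans ((hm j).2 th).
by rewrite -[leRHS]invrK lef_pV2 ?Sm// posrE// invr_gt0.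
Qed.

(** The time at which the motion with [e = 1], started at angle [0], reaches a given angle; [phase]
    is its inverse. *)
Definition clock : R -> R := prim speed.
Definition phase : R -> R := xget (@id R) [set G : R -> R | [/\ cancel clock G,
  cancel G clock & forall y : R, is_derive y 1 G (speed (G y))^-1]].

Lemma phaseP : [/\ cancel clock phase, cancel phase clock &
  forall y : R, is_derive y 1 phase (speed (phase y))^-1].
Proof.
suff : [set G : R -> R | [/\ cancel clock G, cancel G clock &
    forall y : R, is_derive y 1 G (speed (G y))^-1]] phase by [].
apply: xgetPex.
have DT (x : R) : is_derive x 1 clock (speed x).
  by apply: is_derive_prim; exact: speed_continuous.
by have [G HG] := derive_inverse DT speed_lower_bound; exists G.
Qed.

(* Obtained by integrating [clairaut = s i * a * e] along [y = a sin th]; the last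
   term counts how often the gluing of the last chart to the first is crossed. *)
Definition xcoord (x0 : R) (i : int) (th : R) : R :=
  s i * (tan ((th - i%:~R * pi) / 2) / a - a * prim drift th + x0
         + tau * (turn k i)%:~R).

Definition path_point (x0 : R) (i : int) (th : R) : S :=
  chart_inv (pp i) (xcoord x0 i th, a * sin th).

Definition path x0 : R -> S := glue (path_point x0).

(** Passing to the next chart turns the half-angle [u] into [u - pi / 2], hence [tan u] into
    [- cot u]; the gluing term [2 / y] compensates by [tan u + cot u = 2 / sin (2 u)]. *)
Lemma xcoordS x0 i th : i%:~R * pi < th < (i + 1)%:~R * pi ->
  xcoord x0 (i + 1) th =
  - xcoord x0 i th + 2 / (a * sin th) + shift_at tau (cyc hk i).
Proof.
move=> hth; have [s0 [hi _]] := strip_sin hth.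
rewrite /xcoord sgcS; have [_ ->] := cycS hk i.
(* [turn] jumps only on leaving the last chart, whose index is odd: the sign there is [-1], which
   accounts for the minus sign on the right. *)
have E : s i * (tau * ((cyc hk i).+1 == (2 * k)%N)%:~R)
    = - shift_at tau (cyc hk i).
  rewrite /shift_at /sgc; case: eqP => [e|_]; last by rewrite !mulr0 oppr0.
  have o : odd (cyc hk i).
    by have := congr1 odd e; rewrite /= mul2n odd_double => /negbFE.
  by rewrite -signr_odd o expr1 mulr1 mulN1r.
pose u := (th - i%:~R * pi) / 2.
have -> : (th - (i + 1)%:~R * pi) / 2 = u - pi / 2.
  by rewrite intrD /u (_ : 1%:~R = 1 :> R) //; field.
rewrite -/u intrD (mulrDr tau).
have cu : 0 < cos u by apply: cos_half_gt0; apply/strip_shift.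
have sE : s i * sin th = 2 * (sin u * cos u) by rewrite -(sin_shift hk) sin_half.
have su : 0 < sin u.
  by move: s0; rewrite sE pmulr_rgt0// pmulr_lgt0.
have tE : tan (u - pi / 2) = - (cos u / sin u).
  by rewrite /tan cosBpihalf sinBpihalf mulNr.
have -> : sin th = s i * (2 * (sin u * cos u)).
  by rewrite -sE mulrA sgc_sqr mul1r.
rewrite tE /tan.
have -> : 2 / (a * (s i * (2 * (sin u * cos u)))) =
   s i * (sin u / cos u + cos u / sin u) / a.
  have := cos2Dsin2 u; have := @sgc_sqr R k hk i; move: (@sgc_neq0 R k hk i).
  move: (s i) => e e0 e2 E1.
  have -> : sin u / cos u + cos u / sin u = (cos u * sin u)^-1.
    by rewrite -[RHS]mul1r -E1; field; rewrite !gt_eqF.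
  have -> : e / (cos u * sin u) / a = e * e / (e * (cos u * sin u) * a).
    by field; rewrite e0 !gt_eqF.
  rewrite e2; field; rewrite e0 !gt_eqF//.
move: E; move: (shift_at _ _) (s i) (prim drift th) (turn k i)%:~R (_ == _)%:~R.
move=> sh e p t b E.
transitivity (- e * ((- (cos u / sin u)) / a - a * p + x0 + tau * t)
   - e * (tau * b)); first by ring.
by rewrite E; field; rewrite !gt_eqF.
Qed.

Lemma path_pointS x0 i th : i%:~R * pi < th < (i + 1)%:~R * pi ->
  path_point x0 i th = path_point x0 (i + 1) th.
Proof.
move=> hth; have [s0 _] := strip_sin hth.
rewrite /path_point xcoordS//; have [-> _] := cycS hk i.
by apply: (chart_inv_ordS hA); rewrite mulrCA mulr_gt0.
Qed.

Lemma pathE x0 i th : strip i th -> path x0 th = path_point x0 i th.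
Proof. by apply: glueE => j x; exact: path_pointS. Qed.

Lemma is_derive_xcoord x0 i (th : R) : strip i th ->
  is_derive th 1 (xcoord x0 i)
    (s i * ((1 + s i * cos th)^-1 / a - a * gg (ff i) (a * sin th))).
Proof.
move=> hth; have hth' := (strip_shift i th).1 hth.
have Ds : is_derive th 1 (fun z : R => z - i%:~R * pi) 1.
  by have := is_deriveB (is_derive_id th (1 : R))
    (is_derive_cst (i%:~R * pi) th (1 : R)); rewrite subr0.
have Dt := @is_derive1_comp R (fun z => tan (z / 2)) (fun z => z - i%:~R * pi)
  th _ _ (is_derive_tan_half hth') Ds.
rewrite mulr1 (cos_shift hk) in Dt.
have Dp : is_derive th 1 (prim drift) (gg (ff i) (a * sin th)).
  by rewrite -(driftE hth); apply: is_derive_prim; exact: drift_continuous.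
have D := is_deriveZ (s i) (is_deriveD (is_deriveD
  (is_deriveB (is_deriveZ a^-1 Dt) (is_deriveZ a Dp))
  (is_derive_cst x0 th 1)) (is_derive_cst (tau * (turn k i)%:~R) th 1)).
have -> : xcoord x0 i = s i \*: (a^-1 \*: ((fun z => tan (z / 2)) \o
    (fun z => z - i%:~R * pi)) - a \*: prim drift + cst x0
    + cst (tau * (turn k i)%:~R)).
  by apply/funext => z; rewrite /xcoord /= (mulrC _ a^-1).
apply: (is_derive_eq D); rewrite !addr0 -![_ *: _]/(_ * _).
by rewrite (mulrC a^-1).
Qed.

Lemma xcoord_smooth x0 i : smooth_on (strip i) (xcoord x0 i).
Proof.
have oi := @strip_open i; have sT (h : R -> R) : smooth_on setT h -> smooth_on (strip i) h.
  exact: smooth_on_subset.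
apply: (smooth_on_line oi (fun th => @is_derive_xcoord x0 i th)).
apply: smooth_onZ => //; apply: (@smooth_on_ext _ _ (fun th =>
  a^-1 * (cst 1 th + s i * cos th)^-1 + (- a) * drift th)) => //.
  by move=> x hx; rewrite (driftE hx) mulrC mulNr.
apply: smooth_onD => //; apply: smooth_onZ => //; last first.
  exact: sT drift_smooth.
apply: smooth_onV => //.
  by move=> x /strip_shift /cosD1_gt0; rewrite (cos_shift hk) => /lt0r_neq0.
apply: sT; apply: smooth_onD => //; first exact: smooth_on_cst.
by apply: smooth_onZ => //; case: (@smooth_sin_cos R).
Qed.

Section Motion.
Variables (x0 e t0 : R).

Definition angle (t : R) : R := phase (e * t + t0).
Definition geod (t : R) : S := path x0 (angle t).

Lemma is_derive_angle (t : R) : is_derive t 1 angle (e / speed (angle t)).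
Proof.
have [_ _ DP] := phaseP.
have Dl : is_derive t 1 (fun z : R => e * z + t0) e.
  have := is_deriveD (is_deriveZ e (is_derive_id t (1 : R)))
    (is_derive_cst t0 t (1 : R)); rewrite addr0 [_ *: 1]mulr1; exact.
have := @is_derive1_comp R phase (fun z => e * z + t0) t _ _ (DP _) Dl.
by rewrite mulrC.
Qed.

Lemma angle_smooth : smooth_on setT angle.
Proof.
have sF : smooth_on setT (fun th => e * (speed th)^-1).
  apply: smooth_onZ => //; apply: smooth_onV => //; last exact: speed_smooth.
  by move=> x _; rewrite gt_eqF// speed_gt0.
exact: (smooth_on_ode oT oT (fun x _ => I) sF (fun t _ => is_derive_angle t)).
Qed.

Variable i : int.

Let D : set R := setT `&` angle @^-1` strip i.

Let oD : open D.
Proof.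
apply: open_preimage_in => //; last exact: strip_open.
by move=> t _; exact: (smooth_on_continuous angle_smooth).
Qed.

Let X (t : R) : R := xcoord x0 i (angle t).
Let Y (t : R) : R := a * sin (angle t).

Let sX : smooth_on D X.
Proof.
apply: (@smooth_on_comp _ D (strip i) (xcoord x0 i) angle) => //.
- exact: strip_open.
- by move=> t [].
- exact: xcoord_smooth.
- exact: smooth_on_subset angle_smooth.
Qed.

Let sY : smooth_on D Y.
Proof.
apply: (@smooth_on_comp _ D setT (fun th => a * sin th) angle) => //.
exact: smooth_on_subset angle_smooth.
Qed.

Let velY t : D t -> derive1 Y t = a * cos (angle t) * (e / hh (ff i) (Y t)).
Proof.
move=> [_ Dt]; rewrite derive1E -(speedE Dt).
have Dsin := is_deriveZ a (is_derive_sin (angle t)).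
have := @is_derive1_comp R (a \*: sin) angle t _ _ Dsin (is_derive_angle t).
by move=> [_ ->].
Qed.

Let velX t : D t -> derive1 X t =
  s i * ((1 + s i * cos (angle t))^-1 / a - a * gg (ff i) (Y t)) *
  (e / hh (ff i) (Y t)).
Proof.
move=> [_ Dt]; rewrite derive1E -(speedE Dt).
have := @is_derive1_comp R (xcoord x0 i) angle t _ _ (is_derive_xcoord x0 Dt)
  (is_derive_angle t).
by move=> [_ ->].
Qed.

Let hY t : hh (ff i) (Y t) != 0.
Proof. by rewrite gt_eqF// hh_gt0//; exact: f_lt1. Qed.

Lemma geod_turning t : strip i (angle t) ->
  hh (ff i) (Y t) * derive1 Y t = a * e * cos (angle t).
Proof.
by move=> hth; rewrite velY//; move: (hY t) => h0; field.
Qed.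

Let velX_alt t : D t -> Y t ^+ 2 * derive1 X t =
  s i * a * e - derive1 Y t.
Proof.
move=> Dt; have [_ hth] := Dt; rewrite velX// velY//.
have h1 : 1 + s i * cos (angle t) != 0.
  by have := cosD1_gt0 ((strip_shift i _).1 hth); rewrite (cos_shift hk) => /lt0r_neq0.
have := hY t; have := sqr_gg (f_lt1 (cyc hk i)) (Y t).
have := @sgc_sqr R k hk i; have := @cos2Dsin2 R (angle t).
move: h1; rewrite /Y; set h := hh _ _; set G := gg _ _.
move: (s i) (cos (angle t)) (sin (angle t)) => q c z h1 E1 E2 E3 h0.
have a1 : a != 0 by rewrite gt_eqF.
(* This factorization of [sin^2] removes the denominator [1 + s cos] of [x']. *)
have E4 : z ^+ 2 = (1 + q * c) * (1 - q * c).
  have -> : (1 + q * c) * (1 - q * c) = 1 - (q * q) * c ^+ 2 by ring.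
  by rewrite E2 mul1r -E1 addrAC subrr add0r.
have -> : (a * z) ^+ 2 * (q * ((1 + q * c)^-1 / a - a * G) * (e / h)) =
  q * (e / h) * (a * (z ^+ 2 / (1 + q * c)) - a * ((a * z) ^+ 2 * G)).
  by field; rewrite h1 h0 a1.
rewrite E3 E4.
have -> : (1 + q * c) * (1 - q * c) / (1 + q * c) = 1 - q * c by field.
have -> : a * c * (e / h) = (q * q) * (a * c * (e / h)) by rewrite E2 mul1r.
by field.
Qed.

Lemma geod_clairaut t : strip i (angle t) -> clairaut X Y t = s i * a * e.
Proof. by move=> hth; rewrite /clairaut velX_alt// subrK. Qed.

Lemma geod_energy t : strip i (angle t) -> energy (ff i) X Y t = e ^+ 2.
Proof.
move=> hth; have Dt : D t by [].
have h1 : 1 + s i * cos (angle t) != 0.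
  by have := cosD1_gt0 ((strip_shift i _).1 hth); rewrite (cos_shift hk) => /lt0r_neq0.
have := hY t; have := sqr_gg (f_lt1 (cyc hk i)) (Y t).
have h2 := hh_sqr (f_lt1 (cyc hk i)) (Y t).
have := @sgc_sqr R k hk i; have := velX_alt Dt.
rewrite /energy /metric_form /=.
(* Extracting the energy from [clairaut_energy] would need [y <> 0]. Grouping [y^2 x'] with one
   factor [x'] gives a computation that is also valid where the curve crosses [y = 0]. *)
have -> : Y t ^+ 2 * (derive1 X t * derive1 X t) +
  (derive1 X t * derive1 Y t + derive1 Y t * derive1 X t) +
  ff i (Y t) * (derive1 Y t * derive1 Y t) =
  derive1 X t * (Y t ^+ 2 * derive1 X t + 2 * derive1 Y t) +
  ff i (Y t) * derive1 Y t ^+ 2 by ring.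
move=> ->; rewrite velX// velY// /gg.
have := @cos2Dsin2 R (angle t).
move: h1 h2; rewrite /Y; set h := hh _ _; set F := ff i _.
have hp : 1 + h != 0 by rewrite gt_eqF// ltr_wpDl// hh_gt0//; exact: f_lt1.
have a1 : a != 0 by rewrite gt_eqF.
move: (s i) (cos (angle t)) (sin (angle t)) => q c z h1 E1 E5 E2 E3 h0.
pose C := q * c; have Cc : c ^+ 2 = C ^+ 2.
  by rewrite /C exprMn [q ^+ 2]expr2 E2 mul1r.
have zE : z ^+ 2 = 1 - C ^+ 2 by rewrite -Cc -E5 [c ^+ 2 + _]addrC addrK.
pose p := a ^+ 2 * F.
have Ep : (h - 1) / (1 + C) = - (p * (1 - C)) / (1 + h).
  apply: (mulIf h1); apply: (mulIf hp); rewrite -/C divfK// [RHS]mulrAC divfK//.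
  have -> : (h - 1) * (1 + h) = h ^+ 2 - 1 by ring.
  rewrite E1 [(a * z) ^+ 2]exprMn zE /p.
  by ring.
(* The energy divided by [(e / h)^2]; here [C] is [cos (theta - i pi)] and [p] is [a^2 f]. *)
have bracket : ((1 + C)^-1 - p / (1 + h)) * (h + C) + p * C ^+ 2 = h ^+ 2.
  have -> : ((1 + C)^-1 - p / (1 + h)) * (h + C) =
    1 + (h - 1) / (1 + C) - p / (1 + h) * (h + C) by field; rewrite hp h1.
  rewrite Ep E1 [(a * z) ^+ 2]exprMn zE /p.
  by field.
transitivity ((e / h) ^+ 2 *
   (((1 + C)^-1 - p / (1 + h)) * (q * q * h + C) + p * c ^+ 2)).
  by rewrite /p /C; field; rewrite h1 h0 a1 hp.
by rewrite E2 mul1r Cc bracket expr_div_n divfK// sqrf_eq0.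
Qed.

Lemma geod_geodesic_eq t : e != 0 -> strip i (angle t) ->
  geodesic_eq (ff i) X Y t.
Proof.
move=> e0 hth; have Dt : D t by [].
have nD (F : R -> R) (c : R) : (forall z, D z -> F z = c) -> is_derive t 1 F 0.
  move=> FE; apply: (@near_eq_is_derive R _ _ (cst c) F t 1 0 _ (is_derive_cst c t 1)).
  have : nbhs t D by exact: open_nbhs_nbhs.
  by apply: filterS => z Dz; rewrite /= (FE _ Dz).
apply: (@geodesic_eq_of_integrals _ (ff i) (f_smooth _) (f_lt1 _) X Y D t) => //.
- by rewrite geod_energy// sqrf_eq0.
- by apply: (nD _ (s i * a * e)) => z [_ Dz]; exact: geod_clairaut.
- by apply: (nD _ (e ^+ 2)) => z [_ Dz]; exact: geod_energy.
have Dc := is_deriveZ (a * e) (is_derive1_comp (is_derive_cos (angle t))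
  (is_derive_angle t)).
apply: (@near_eq_is_derive R _ _ ((a * e) \*: (cos \o angle)) _ t 1).
  have : nbhs t D by exact: open_nbhs_nbhs.
  by apply: filterS => z [_ Dz] /=; rewrite geod_turning.
apply: (is_derive_eq Dc); rewrite geod_energy// (speedE hth) /Y.
by rewrite -![_ *: _]/(_ * _); ring.
Qed.

Lemma geod_local t : e != 0 -> strip i (angle t) ->
  exists B c h X Y, [/\ open B, B t, normal_chart g c h,
     smooth_on B X /\ smooth_on B Y &
     forall z, B z -> geod z = chart_inv c (X z, Y z) /\ geodesic_eq h X Y z].
Proof.
move=> e0 hth; exists D, (pp i), (ff i), X, Y; split => //.
  exact: (parabolic_normal hA).
by move=> z [_ Dz]; split; [exact: pathE|exact: geod_geodesic_eq].
Qed.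

End Motion.

Lemma geod_geodesic x0 e t0 : e != 0 -> geodesic g setT (geod x0 e t0).
Proof.
move=> e0; apply: geodesic_of_local => //; first by exists 0.
move=> t _; apply: (@geod_local x0 e t0 (nearest (angle e t0 t))) => //.
exact: strip_nearest.
Qed.

End Amplitude.

End ExplicitGeodesics.

(** * Integration of a spacelike geodesic inside one chart *)

Section LocalForm.
Context {R : realType} {S : surface R} (g : lorentzian_metric S).
Variables (k : nat) (tau : R) (phi : 'I_(2 * k) -> chart R S)
  (f : 'I_(2 * k) -> R -> R).
Hypotheses (hk : (1 <= k)%N) (hA : parabolic_atlas g tau phi f).

Notation ff i := (f (cyc hk i)).
Notation s i := (@sgc R k hk i).

(** All parameters are read off conserved quantities: [e^2] is the energy, [s * a * e] the Clairaut
    constant, and [t0], [x0] are the constants left by integrating the equations for the angle and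
    for [x]. *)
Lemma spacelike_curve_in_chart i (X Y : R -> R) (B : set R) t1 :
  is_interval B -> B t1 -> smooth_on B X -> smooth_on B Y ->
  (forall t, B t -> geodesic_eq (ff i) X Y t /\ 0 < energy (ff i) X Y t) ->
  exists a e t0 x0, [/\ 0 < a, e != 0 & forall t, B t ->
    [/\ strip i (angle f hk a e t0 t),
        X t = xcoord tau f hk a x0 i (angle f hk a e t0 t) &
        Y t = a * sin (angle f hk a e t0 t)]].
Proof.
move=> iB Bt1 sX sY HB.
have sf := f_smooth hA (cyc hk i); have f1 := f_lt1 hA (cyc hk i).
set F := ff i in HB sf f1.
have Dcl t : B t -> is_derive t 1 (clairaut X Y) 0.
  by move=> Bt; have [[A1 _] _] := HB t Bt; have := clairaut_derive sX sY Bt; rewrite A1.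
have Den t : B t -> is_derive t 1 (energy F X Y) 0.
  move=> Bt; have [[A1 A2] _] := HB t Bt; have := energy_derive sf sX sY Bt.
  by rewrite A1 A2 !mulr0 addr0.
set C := clairaut X Y t1; set E := energy F X Y t1.
have clE t : B t -> clairaut X Y t = C.
  by move=> Bt; exact: (derive0_constant_in iB Dcl).
have enE t : B t -> energy F X Y t = E.
  by move=> Bt; exact: (derive0_constant_in iB Den).
have E0 : 0 < E by have [] := HB t1 Bt1.
have CE t : B t -> C ^+ 2 = (hh F (Y t) * derive1 Y t) ^+ 2 + E * Y t ^+ 2.
  by move=> Bt; rewrite -(clE t Bt) -(enE t Bt); exact: clairaut_energy.
have h0 y : hh F y != 0 by rewrite gt_eqF// hh_gt0.
(* If [C = 0], positivity of the energy in [clairaut_energy] gives [y = y' = 0], where the energy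
   vanishes. *)
have C0 : C != 0.
  apply/eqP => C0; have := CE t1 Bt1; rewrite C0 expr0n /= => /esym/eqP.
  have EY0 : 0 <= E * Y t1 ^+ 2 by apply: mulr_ge0; [exact: ltW|exact: sqr_ge0].
  rewrite paddr_eq0 ?sqr_ge0// => /andP[].
  rewrite sqrf_eq0 mulf_eq0 (negPf (h0 _)) /= => /eqP Y'0.
  rewrite mulf_eq0 (gt_eqF E0) /= sqrf_eq0 => /eqP Y0.
  have [_] := HB t1 Bt1.
  by rewrite /energy /metric_form /= Y0 Y'0 expr0n /= !mul0r !mulr0 !addr0 ltxx.
(* The sign is the one that makes the amplitude [a = s C / e] positive. *)
pose e := s i * Num.sg C * Num.sqrt E.
have e2 : e ^+ 2 = E.
  rewrite /e !exprMn sqr_sqrtr ?ltW// sqr_sg C0 mulr1 expr2.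
  by rewrite sgc_sqr mul1r.
have e0 : e != 0 by rewrite -sqrf_eq0 e2 gt_eqF.
pose a := s i * C / e.
have aeC : a * e = s i * C by rewrite /a divfK.
have Cae : C = s i * a * e by rewrite -mulrA aeC mulrA sgc_sqr mul1r.
have a0 : 0 < a.
  rewrite /a /e (_ : s i * C = s i * Num.sg C * `|C|); last first.
    by rewrite -mulrA -numEsg.
  rewrite invfM mulrA [_ / (_ * _)]mulrAC divff ?mul1r; last first.
    by rewrite mulf_neq0 ?sgc_neq0 ?sgr_eq0.
  by rewrite divr_gt0 ?normr_gt0 ?sqrtr_gt0.
have an0 : a != 0 by rewrite gt_eqF.
have CEa : C ^+ 2 = E * a ^+ 2.
  rewrite Cae -e2 -mulrA exprMn [_ ^+ 2]expr2 sgc_sqr mul1r exprMn.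
  by rewrite mulrC.
pose p t := s i * Y t / a; pose r t := hh F (Y t) * derive1 Y t / C.
have pr t : B t -> p t ^+ 2 + r t ^+ 2 = 1.
  move=> Bt; have CC := CE t Bt.
  have C2 : C ^+ 2 != 0 by rewrite sqrf_eq0.
  apply: (mulIf C2); rewrite mul1r [RHS]CC mulrDl addrC; congr (_ + _).
    by rewrite /r expr_div_n divfK.
  rewrite CEa /p expr_div_n exprMn [s i ^+ 2]expr2 sgc_sqr mul1r.
  by field.
(* A cosine equal to [-1] would force [y = 0]; but there [h = 1] and [C = y'], so the cosine is [1].
   This keeps the curve inside the open strip. *)
have r1 t : B t -> r t != -1.
  move=> Bt; apply/eqP => rt.
  have : p t ^+ 2 = 0.
    by apply: (addIr 1); rewrite add0r -[RHS](pr t Bt) rt sqrrN expr1n.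
  move/eqP; rewrite sqrf_eq0 /p mulf_eq0 invr_eq0 (negPf an0) orbF mulf_eq0.
  rewrite (negPf (sgc_neq0 _ _)) /= => /eqP Y0.
  have h1 : hh F 0 = 1 by rewrite /hh expr0n /= mul0r subr0 sqrtr1.
  have := clE t Bt; rewrite /clairaut Y0 expr0n /= mul0r add0r => Y'C.
  move: rt; rewrite /r Y0 h1 mul1r Y'C divff// => /eqP.
  by rewrite -subr_eq0 opprK -mulr2n pnatr_eq0.
pose th t := 2 * atan (p t / (1 + r t)).
have thP t : B t -> [/\ - pi < th t < pi, sin (th t) = p t & cos (th t) = r t].
  by move=> Bt; exact: (sin_cos_2atan (pr t Bt) (r1 t Bt)).
have Dp t : B t -> is_derive t 1 p (r t * (e / hh F (Y t))).
  move=> Bt; have DY := smooth_on_is_derive sY Bt.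
  have -> : p = (s i / a) \*: Y.
    by apply/funext => z; rewrite /p /= mulrAC.
  apply: (is_derive_eq (is_deriveZ (s i / a) DY)).
  rewrite -[_ *: _]/(_ * _) /r Cae; have := @sgc_sqr R k hk i.
  have := h0 (Y t); have := @sgc_neq0 R k hk i.
  move: (s i) (hh F (Y t)) => q h q0 hn q2.
  have -> : q / a * derive1 Y t = q * q * derive1 Y t / (q * a) by field; rewrite q0 an0.
  by rewrite q2; field; rewrite q0 an0 e0 hn.
have Dr t : B t -> is_derive t 1 r (- (p t * (e / hh F (Y t)))).
  move=> Bt; have [[A1 A2] _] := HB t Bt.
  have D := turning_derive sf f1 X sY Bt.
  rewrite A1 A2 mulr0 subr0 sub0r (enE t Bt) in D.
  have -> : r = C^-1 \*: (fun z => hh F (Y z) * derive1 Y z).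
    by apply/funext => z; rewrite /r /= mulrC.
  apply: (is_derive_eq (is_deriveZ C^-1 D)).
  rewrite -[_ *: _]/(_ * _) /p -e2 Cae; have := @sgc_sqr R k hk i.
  have := h0 (Y t); have := @sgc_neq0 R k hk i.
  move: (s i) (hh F (Y t)) => q h q0 hn q2.
  have -> : q * Y t / a = (q * q) * Y t / (q * a) by field; rewrite q0 an0.
  by rewrite q2; field; rewrite q0 an0 e0 hn.
have Dth t : B t -> is_derive t 1 th (e / hh F (Y t)).
  move=> Bt; have rn : 1 + r t != 0 by rewrite addrC addr_eq0 r1.
  have D1 : is_derive t 1 (cst 1 + r) (0 + - (p t * (e / hh F (Y t)))).
    exact: (is_deriveD (is_derive_cst (1 : R) t (1 : R)) (Dr t Bt)).
  have D2 := is_deriveM (Dp t Bt) (@is_deriveV R (cst 1 + r) t _ 1 rn D1).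
  have D3 := @is_derive1_comp R atan (p * (fun z => ((cst 1 + r) z)^-1)) t _ _
    (is_derive1_atan _) D2.
  apply: (is_derive_eq (is_deriveZ 2 D3)).
  rewrite -![_ *: _]/(_ * _) /= !mulrfctE /= add0r.
  rewrite (_ : (cst 1 + r) t = 1 + r t) //.
  have := pr t Bt; move: rn; move: (p t) (r t) (e / _) => x y w rn E1.
  have E2 : x ^+ 2 = (1 - y) * (1 + y).
    have -> : (1 - y) * (1 + y) = 1 - y ^+ 2 by ring.
    by rewrite -E1 addrK.
  have E3 : 1 + (x / (1 + y)) ^+ 2 = 2 / (1 + y).
    by rewrite expr_div_n E2; field.
  rewrite E3.
  have -> : x * (- (1 + y) ^- 2 * - (x * w)) + (1 + y)^-1 * (y * w) =
    (x ^+ 2 + y * (1 + y)) * w / (1 + y) ^+ 2 by field.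
  by rewrite E2; field.
pose Th t := th t + i%:~R * pi.
have sTh t : B t -> strip i (Th t).
  by move=> Bt; apply/strip_shift; rewrite /Th addrK; have [] := thP t Bt.
have sinTh t : B t -> a * sin (Th t) = Y t.
  move=> Bt; have [_ sE _] := thP t Bt.
  have E1 : s i * sin (Th t) = p t by rewrite -sE -(sin_shift hk) /Th addrK.
  have -> : sin (Th t) = s i * p t by rewrite -E1 mulrA sgc_sqr mul1r.
  have -> : a * (s i * p t) = s i * s i * Y t by rewrite /p; field; rewrite an0.
  by rewrite sgc_sqr mul1r.
have cosTh t : B t -> s i * cos (Th t) = r t.
  move=> Bt; have [_ _ cE] := thP t Bt.
  by rewrite -(cos_shift hk) /Th addrK.
have DTh t : B t -> is_derive t 1 Th (e / hh F (Y t)).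
  move=> Bt; have := is_deriveD (Dth t Bt) (is_derive_cst (i%:~R * pi) t (1 : R)).
  by rewrite addr0; exact.
have [K1 K2 _] := phaseP hk hA a0.
(* The angle has derivative [e / h] and [clock] has derivative [h], so the difference is constant;
   its value is [t0]. *)
have clockE t : B t -> clock f hk a (Th t) - e * t = clock f hk a (Th t1) - e * t1.
  move=> Bt; apply: (derive0_constant_in iB (f := fun z =>
    clock f hk a (Th z) - e * z)) => // z Bz.
  have Dck : is_derive (Th z) 1 (clock f hk a) (speed f hk a (Th z)).
    by apply: is_derive_prim => x; exact: (speed_continuous hA a0).
  have D1 := @is_derive1_comp R (clock f hk a) Th z _ _ Dck (DTh z Bz).
  have D2 := is_deriveB D1 (is_deriveZ e (is_derive_id z (1 : R))).
  apply: (is_derive_eq D2).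
  rewrite (speedE hk hA a0 (sTh z Bz)) (sinTh z Bz) -/F -[_ *: _]/(_ * _).
  by rewrite mulrC divfK// mulr1 subrr.
pose t0 := clock f hk a (Th t1) - e * t1.
have ThE t : B t -> angle f hk a e t0 t = Th t.
  move=> Bt; rewrite /angle /t0 -(clockE t Bt) addrC subrK; exact: K1.
have DX0 t : B t -> is_derive t 1 (fun z => X z - xcoord tau f hk a 0 i (Th z)) 0.
  move=> Bt; have DX := smooth_on_is_derive sX Bt.
  have D1 := @is_derive1_comp R (xcoord tau f hk a 0 i) Th t _ _
    (is_derive_xcoord hk hA a0 0 (sTh t Bt)) (DTh t Bt).
  apply: (is_derive_eq (is_deriveB DX D1)).
  apply/eqP; rewrite subr_eq0; apply/eqP.
  rewrite (sinTh t Bt) (cosTh t Bt) -/F.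
  have cl := clE t Bt; have en := enE t Bt.
  have prt := pr t Bt; have rn : 1 + r t != 0 by rewrite addrC addr_eq0 r1.
  have hn := h0 (Y t); have s2 := @sgc_sqr R k hk i.
  have sn := @sgc_neq0 R k hk i.
  (* The Clairaut integral determines [x'] only where [y <> 0]. At [y = 0] the energy reduces to
     [2 x' y' + f y'^2] with [y' = C <> 0], which determines [x'] instead. *)
  have [Y0|Y0] := eqVneq (Y t) 0.
    have r11 : r t = 1.
      move: prt; rewrite /p Y0 mulr0 mul0r expr0n /= add0r => /eqP.
      by rewrite sqrf_eq1 (negPf (r1 t Bt)) orbF => /eqP.
    have h1 : hh F 0 = 1 by rewrite /hh expr0n /= mul0r subr0 sqrtr1.
    have Y'C : derive1 Y t = C.
      by move: cl; rewrite /clairaut Y0 expr0n /= mul0r add0r.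
    move: en; rewrite /energy /metric_form /= Y'C Y0 expr0n /= mul0r add0r.
    rewrite r11 /gg h1 -e2 Cae; move: (derive1 X t) (F 0) => x y en.
    apply: (mulIf (mulf_neq0 (_ : 2 != 0) C0)); first by rewrite pnatr_eq0.
    have {}en : x * (2 * (s i * a * e)) = e ^+ 2 - y * (s i * s i) * (a * e) ^+ 2.
      by rewrite -en; ring.
    rewrite Cae en s2 mulr1.
    have -> : s i * ((1 + 1)^-1 / a - a * (y / (1 + 1))) * (e / 1) *
      (2 * (s i * a * e)) = s i * s i * (e ^+ 2 - y * (a * e) ^+ 2).
      by field; rewrite an0.
    by rewrite s2 mul1r.
  apply: (mulfI (expf_neq0 2 Y0)).
  have -> : Y t ^+ 2 * derive1 X t = C - derive1 Y t.
    by rewrite -cl /clairaut addrK.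
  have gE := sqr_gg f1 (Y t); rewrite -/F in gE.
  have Y2 : Y t ^+ 2 = a ^+ 2 * ((1 - r t) * (1 + r t)).
    have -> : (1 - r t) * (1 + r t) = 1 - r t ^+ 2 by ring.
    rewrite -prt addrK.
    have -> : a ^+ 2 * p t ^+ 2 = s i * s i * Y t ^+ 2.
      by rewrite /p; field; rewrite an0.
    by rewrite s2 mul1r.
  have Y'E : derive1 Y t = r t * C / hh F (Y t) by rewrite /r; field; rewrite hn C0.
  rewrite Y'E; move: gE Y2; set y2 := Y t ^+ 2; move: (gg F (Y t)) => G gE Y2.
  have -> : y2 * (s i * ((1 + r t)^-1 / a - a * G) * (e / hh F (Y t))) =
    s i * (e / hh F (Y t)) * (y2 / (1 + r t) / a - a * (y2 * G)) by ring.
  rewrite gE Y2 Cae; move: (r t) rn (hh F (Y t)) hn => rr rn h hn.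
  by field; rewrite rn hn an0.
pose x0 := s i * (X t1 - xcoord tau f hk a 0 i (Th t1)).
exists a, e, t0, x0; split => // t Bt; rewrite (ThE t Bt); split.
- exact: sTh.
- have E1 : X t - xcoord tau f hk a 0 i (Th t) = s i * x0.
    rewrite /x0 mulrA sgc_sqr mul1r.
    exact: (derive0_constant_in iB DX0 Bt Bt1).
  have -> : X t = xcoord tau f hk a 0 i (Th t) + s i * x0 by rewrite -E1 addrC subrK.
  by rewrite /xcoord; ring.
- by rewrite sinTh.
Qed.

End LocalForm.

(** * Every spacelike geodesic belongs to the explicit family *)

Section SpacelikeGeodesics.
Context {R : realType} {S : surface R} (g : lorentzian_metric S).
Variables (k : nat) (tau : R) (phi : 'I_(2 * k) -> chart R S)
  (f : 'I_(2 * k) -> R -> R).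
Hypotheses (hk : (1 <= k)%N) (hA : parabolic_atlas g tau phi f).

Notation ff i := (f (cyc hk i)).
Notation pp i := (phi (cyc hk i)).
Notation s i := (@sgc R k hk i).
Notation ang := (angle f hk).
Notation gd := (geod tau phi f hk).

Lemma angle_continuous a e t0 : 0 < a -> continuous (ang a e t0).
Proof. by move=> a0 t; exact: (smooth_on_continuous (angle_smooth hk hA a0 e t0)). Qed.

Lemma near_strip a e t0 i t : 0 < a -> strip i (ang a e t0 t) ->
  \forall z \near t, strip i (ang a e t0 z).
Proof.
move=> a0 st; apply: (@angle_continuous a e t0 a0 t).
by apply: open_nbhs_nbhs; split => //; exact: strip_open.
Qed.

Lemma geod_chart_map a e t0 x0 i t : 0 < a -> strip i (ang a e t0 t) ->
  chart_dom (pp i) (gd a x0 e t0 t) /\ chart_map (pp i) (gd a x0 e t0 t) =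
    (xcoord tau f hk a x0 i (ang a e t0 t), a * sin (ang a e t0 t)).
Proof.
move=> a0 st; rewrite /geod (pathE hk hA a0 x0 st).
exact: (normal_chartK _ (parabolic_normal hA _)).
Qed.

Lemma sin_cos_strip_inj i (u v : R) : strip i u -> strip i v ->
  sin u = sin v -> cos u = cos v -> u = v.
Proof.
move=> /strip_shift hu /strip_shift hv es ec.
apply: (addIr (- (i%:~R * pi))).
rewrite (atan_tan_half hu) (atan_tan_half hv).
by rewrite !(sin_shift hk) !(cos_shift hk) es ec.
Qed.

(** The Clairaut constant and the energy give [a e] and [e^2]; [y] and [h y'] give the sine and
    cosine of the angle, hence the angle within the strip; [t0] and [x0] follow. *)
Lemma geod_parameters_unique i a e t0 x0 a' e' t0' x0' t :
  0 < a -> 0 < a' -> e != 0 ->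
  strip i (ang a e t0 t) -> strip i (ang a' e' t0' t) ->
  (\forall z \near t, xcoord tau f hk a x0 i (ang a e t0 z) =
     xcoord tau f hk a' x0' i (ang a' e' t0' z)) ->
  (\forall z \near t, a * sin (ang a e t0 z) = a' * sin (ang a' e' t0' z)) ->
  [/\ a = a', e = e', t0 = t0' & x0 = x0'].
Proof.
move=> a0 a0' e0 st st' EX EY.
pose X z := xcoord tau f hk a x0 i (ang a e t0 z).
pose X' z := xcoord tau f hk a' x0' i (ang a' e' t0' z).
pose Y z := a * sin (ang a e t0 z).
pose Y' z := a' * sin (ang a' e' t0' z).
have dX : derive1 X t = derive1 X' t by rewrite !derive1E; exact: near_eq_derive.
have dY : derive1 Y t = derive1 Y' t by rewrite !derive1E; exact: near_eq_derive.
have YE : Y t = Y' t := nbhs_singleton EY.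
have XE : X t = X' t := nbhs_singleton EX.
have c1 : s i * a * e = s i * a' * e'.
  rewrite -(geod_clairaut hA a0 x0 st) -(geod_clairaut hA a0' x0' st').
  rewrite -[LHS]/(clairaut X Y t) -[RHS]/(clairaut X' Y' t).
  by rewrite /clairaut dX dY YE.
have c2 : e ^+ 2 = e' ^+ 2.
  rewrite -(geod_energy hA a0 x0 st) -(geod_energy hA a0' x0' st').
  rewrite -[LHS]/(energy (ff i) X Y t) -[RHS]/(energy (ff i) X' Y' t).
  by rewrite /energy dX dY YE.
have c3 : a * e * cos (ang a e t0 t) = a' * e' * cos (ang a' e' t0' t).
  rewrite -(geod_turning hA a0 st) -(geod_turning hA a0' st').
  rewrite -[LHS]/(hh (ff i) (Y t) * derive1 Y t).
  by rewrite -[RHS]/(hh (ff i) (Y' t) * derive1 Y' t) dY YE.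
have ae : a * e = a' * e'.
  by apply: (mulfI (sgc_neq0 hk i)); rewrite !mulrA.
(* Opposite values of [e] are excluded because [a e = a' e'] with positive amplitudes. *)
have ee : e = e'.
  move/eqP: c2; rewrite eqf_sqr => /orP[/eqP //|/eqP en].
  move: ae; rewrite en mulrN => /eqP; rewrite -subr_eq0 -opprD oppr_eq0.
  rewrite -mulrDl mulf_eq0 gt_eqF ?addr_gt0//= => /eqP e'0.
  by move: e0; rewrite en e'0 oppr0 eqxx.
have aa : a = a' by move: ae; rewrite -ee => /(mulIf e0).
subst a' e'.
have th : ang a e t0 t = ang a e t0' t.
  apply: sin_cos_strip_inj st st' _ _.
    by apply: (mulfI (lt0r_neq0 a0)); exact: YE.
  by apply: (mulfI _ c3); rewrite mulf_neq0// gt_eqF.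
have [_ K2 _] := phaseP hk hA a0.
have tt : t0 = t0'.
  by move: th => /(congr1 (clock f hk a)); rewrite /angle !K2 => /addrI.
split => //; move: XE; rewrite /X /X' -th /xcoord => /(mulfI (sgc_neq0 hk i)).
by move=> /addIr /addrI.
Qed.

Section Geodesic.
Variables (J : set R) (gamma : R -> S).
Hypotheses (hg : geodesic g J gamma) (hs : spacelike g J gamma).

Lemma spacelike_geodesic_local i t1 : J t1 -> chart_dom (pp i) (gamma t1) ->
  exists d a e t0 x0, [/\ 0 < d, 0 < a, e != 0 & forall t, ball t1 d t ->
    [/\ J t, strip i (ang a e t0 t) & gamma t = gd a x0 e t0 t]].
Proof.
move=> Jt1 ct1; have nc := parabolic_normal hA (cyc hk i).
have [oD sX sY HD] := geodesic_in_chart hg nc.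
have /nbhs_ballP[d /= d0 Hd] : nbhs t1 (J `&` gamma @^-1` chart_dom (pp i)).
  exact: open_nbhs_nbhs.
have iB : is_interval (ball t1 d).
  by rewrite ball_itv; exact: interval_is_interval.
have Bt1 : ball t1 d t1 by exact: ballxx.
have sX' := smooth_on_subset Hd sX; have sY' := smooth_on_subset Hd sY.
have HB t : ball t1 d t -> geodesic_eq (ff i)
    (fun z => (chart_map (pp i) (gamma z)).1)
    (fun z => (chart_map (pp i) (gamma z)).2) t /\
    0 < energy (ff i) (fun z => (chart_map (pp i) (gamma z)).1)
    (fun z => (chart_map (pp i) (gamma z)).2) t.
  move=> /Hd Dt; have [_ G1 V] := HD t Dt; split => //.
  by rewrite /energy -V; apply: hs; case: Dt.
have [a [e [t0 [x0 [a0 e0 H]]]]] :=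
  spacelike_curve_in_chart hA iB Bt1 sX' sY' HB.
exists d, a, e, t0, x0; split => // t Bt; have Dt := Hd t Bt.
have [st XE YE] := H t Bt; have [gE _ _] := HD t Dt.
split => //; first by case: Dt.
by rewrite gE XE YE /geod (pathE hk hA a0 x0 st).
Qed.

(** Continuation: the explicit geodesic found near one time agrees with [gamma] on a set that is
    open and closed in the interval [J]. *)
Lemma spacelike_geodesic_explicit : exists a e t0 x0,
  [/\ 0 < a, e != 0 & forall t, J t -> gamma t = gd a x0 e t0 t].
Proof.
have [oJ iJ [t1 Jt1] [cg _] _] := hg.
have [[_ cov] _ _ _ _] := hA.
have [j cj] := cov (gamma t1).
have cj' : chart_dom (pp (j : nat)%:Z) (gamma t1) by rewrite cyc_ord.
have [d [a [e [t0 [x0 [d0 a0 e0 H]]]]]] := spacelike_geodesic_local Jt1 cj'.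
exists a, e, t0, x0; split => //.
pose U : set R := [set t | gamma t = gd a x0 e t0 t].
(* The interior makes agreement hold on a whole neighbourhood, as the comparison of derivatives in
   [geod_parameters_unique] requires. *)
pose A := J `&` interior U.
have cG t : {for t, continuous (gd a x0 e t0)}.
  by have [_ _ _ [c _] _] := geod_geodesic hk hA a0 x0 t0 e0; exact: c.
suff AJ : A = J.
  by move=> t; rewrite -AJ => -[_ /nbhs_singleton].
have /connected_intervalP cJ := iJ.
apply: cJ.
- exists t1; split => //; apply/nbhs_ballP; exists d => //= t /H [_ _ gE].
  exact: gE.
- by exists (interior U) => //; exact: open_interior.
exists (closure A); first exact: closed_closure.
apply/seteqP; split => [t At|t2 [Jt2 cA]]; first by split; [case: At|exact: subset_closure].
split => //.
(* Both curves are continuous and the surface is Hausdorff, so they still agree at a limit point of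
   [A]; a chart around that common point contains both. *)
have E2 : gamma t2 = gd a x0 e t0 t2.
  apply: (@surface_hausdorff _ S) => V W nV nW.
  have n1 : nbhs t2 (gamma @^-1` V `&` gd a x0 e t0 @^-1` W).
    by apply: filterI; [exact: cg|exact: cG].
  have [t3 [[_ /nbhs_singleton U3] [V3 W3]]] := cA _ n1.
  by exists (gamma t3); split => //; rewrite U3.
pose i := nearest (ang a e t0 t2).
have st2 : strip i (ang a e t0 t2) by exact: strip_nearest.
have c2 : chart_dom (pp i) (gamma t2).
  by rewrite E2; have [] := geod_chart_map x0 a0 st2.
have [d' [a' [e' [t0' [x0' [d0' a0' e0' H']]]]]] := spacelike_geodesic_local Jt2 c2.
have nB : nbhs t2 (ball t2 d') by exact: nbhsx_ballx.
have oS : open (setT `&` (ang a e t0) @^-1` strip i).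
  apply: open_preimage_in; [exact: openT| |exact: strip_open].
  by move=> x _; exact: angle_continuous.
have nS : nbhs t2 (setT `&` (ang a e t0) @^-1` strip i) by exact: open_nbhs_nbhs.
(* Near [t2] the curve is explicit with possibly other parameters. At a point [t3] of [A] close to
   [t2] both descriptions are valid in the same strip, so their parameters coincide. *)
have [t3 [[J3 U3] [B3 [_ S3]]]] := cA _ (filterI nB nS).
have oB : open (ball t2 d') by exact: ball_open.
have n3 : nbhs t3 (interior U `&` (ball t2 d' `&` (setT `&` (ang a e t0) @^-1` strip i))).
  apply: filterI; first by apply: open_nbhs_nbhs; split => //; exact: open_interior.
  by apply: filterI; exact: open_nbhs_nbhs.
have CE z : (interior U `&` (ball t2 d' `&` (setT `&` (ang a e t0) @^-1` strip i))) z ->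
    (xcoord tau f hk a x0 i (ang a e t0 z), a * sin (ang a e t0 z)) =
    (xcoord tau f hk a' x0' i (ang a' e' t0' z), a' * sin (ang a' e' t0' z)).
  move=> [/nbhs_singleton Uz [/H' [_ s' gz] [_ sz]]].
  have [_ <-] := geod_chart_map x0 a0 sz; have [_ <-] := geod_chart_map x0' a0' s'.
  by rewrite -gz -Uz.
have [|||aa ee tt xx] := @geod_parameters_unique i a e t0 x0 a' e' t0' x0' t3 a0 a0' e0 S3.
- by have [] := H' t3 B3.
- by apply: filterS n3 => z /CE [].
- by apply: filterS n3 => z /CE [].
apply/nbhs_ballP; exists d' => //= z /H' [_ _ gE].
suff : gamma z = gd a x0 e t0 z by [].
by rewrite gE aa ee tt xx.
Qed.

End Geodesic.

End SpacelikeGeodesics.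

(** * Injectivity of the Abel transform *)

Section PrimitiveBounds.
Context {R : realType}.
Implicit Types g h : R -> R.

Lemma prim_eq_on g h (b : R) : continuous g -> continuous h -> 0 <= b ->
  (forall x, 0 <= x <= b -> g x = h x) -> prim g b = prim h b.
Proof.
move=> cg ch b0 gh; apply/eqP; rewrite -subr_eq0; apply/eqP.
have D (x : R) : 0 <= x <= b -> is_derive x 1 (fun x => prim g x - prim h x) 0.
  move=> hx; rewrite -(subrr (g x)) {2}gh//.
  by apply: (is_deriveB (is_derive_prim x cg) (is_derive_prim x ch)).
have iB : is_interval [set x : R | 0 <= x <= b].
  move=> u v /= /andP[u0 _] /andP[_ vb] z /andP[uz zv].
  by rewrite (le_trans u0)//= (le_trans zv).
have := derive0_constant_in iB D (_ : [set x | 0 <= x <= b] b)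
  (_ : [set x | 0 <= x <= b] 0).
by rewrite !prim0// subrr; apply; rewrite /= ?lexx b0.
Qed.

Lemma prim_shift g (c b : R) : continuous g ->
  prim g (b + c) - prim g c = prim (fun x => g (x + c)) b.
Proof.
move=> cg; have D (z : R) : is_derive z 1 (fun z => prim g (z + c)) (g (z + c)).
  have Ds : is_derive z 1 (fun z : R => z + c) 1.
    by have := is_deriveD (is_derive_id z (1 : R)) (is_derive_cst c z 1);
      rewrite addr0.
  have := @is_derive1_comp R (prim g) (fun z => z + c) z _ _
    (is_derive_prim (z + c) cg) Ds.
  by rewrite mulr1.
rewrite (primE _ D) ?add0r// => x.
apply: (@continuous_comp _ _ _ (fun x => x + c) g); last exact: cg.
by apply: cvgD; [exact: cvg_id|exact: cvg_cst].
Qed.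

Lemma prim_linear g h (u v b : R) : continuous g -> continuous h ->
  prim (fun x => u * g x + v * h x) b = u * prim g b + v * prim h b.
Proof.
move=> cg ch.
have D (z : R) : is_derive z 1 (fun z => u * prim g z + v * prim h z)
    (u * g z + v * h z).
  exact: (is_deriveD (is_deriveZ u (is_derive_prim z cg))
    (is_deriveZ v (is_derive_prim z ch))).
rewrite (primE _ D) ?prim0// ?mulr0 ?addr0 ?subr0// => x.
by apply: cvgD; apply: cvgMr; [exact: cg|exact: ch].
Qed.

Lemma prim_cst (c b : R) : prim (fun=> c) b = c * b.
Proof.
have D (z : R) : is_derive z 1 (fun z => c * z) c.
  have := is_deriveZ c (is_derive_id z (1 : R)).
  by rewrite [_ *: 1]mulr1; exact.
by rewrite (primE _ D) ?mulr0 ?subr0// => x; exact: cvg_cst.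
Qed.

Lemma prim_sum (I : Type) (r : seq I) (G : I -> R -> R) (b : R) :
  (forall i, continuous (G i)) ->
  prim (fun x => \sum_(i <- r) G i x) b = \sum_(i <- r) prim (G i) b.
Proof.
move=> cG; elim: r => [|i r IH].
  rewrite big_nil (_ : (fun x => _) = fun=> 0) ?prim_cst ?mul0r//.
  by apply/funext => x; rewrite big_nil.
have cs (s : seq I) : continuous (fun x => \sum_(i <- s) G i x).
  elim: s => [|j s IHs].
    rewrite (_ : (fun x => _) = cst 0); first exact: cst_continuous.
    by apply/funext => x; rewrite big_nil.
  rewrite (_ : (fun x => _) = fun x => G j x + \sum_(i <- s) G i x).
    by move=> x; apply: cvgD; [exact: cG|exact: IHs].
  by apply/funext => x; rewrite big_cons.
have := @prim_linear (G i) (fun x => \sum_(i <- r) G i x) 1 1 b (cG i) (cs r).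
rewrite !mul1r IH big_cons => <-; congr prim.
by apply/funext => x; rewrite big_cons !mul1r.
Qed.

Lemma prim_bound g (B b : R) : continuous g -> 0 <= b ->
  (forall x, 0 <= x <= b -> `|g x| <= B) -> `|prim g b| <= B * b.
Proof.
move=> cg; rewrite le_eqVlt => /orP[/eqP <- _|b0 H].
  by rewrite prim0// mulr0 normr0.
have [x _|c /andP[c0 cb] E] := @mean_value R (prim g) g 0 b b0.
  exact: is_derive_prim.
rewrite prim0// !subr0 in E; rewrite E normrM (gtr0_norm b0).
by apply: ler_wpM2r; [exact: ltW|apply: H; rewrite !ltW].
Qed.

End PrimitiveBounds.

(** * Wallis integrals *)

Section Wallis.
Context {R : realType}.

Definition wallis (n : nat) : R := prim (fun x => sin x ^+ n) pi.

Lemma continuous_sinX (n : nat) : continuous (fun x : R => sin x ^+ n).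
Proof.
move=> x; apply: (@continuous_comp _ _ _ sin (fun y => y ^+ n)).
  exact: continuous_sin.
exact: exprn_continuous.
Qed.

Lemma wallis0 : wallis 0 = pi.
Proof.
by rewrite /wallis (_ : (fun x => _) = fun=> 1) ?prim_cst ?mul1r.
Qed.

Lemma wallis1 : wallis 1 = 2.
Proof.
have D (x : R) : is_derive x 1 (fun x => - cos x) (sin x ^+ 1).
  by have := is_deriveN (is_derive_cos x); rewrite opprK expr1.
rewrite /wallis (primE (@continuous_sinX 1) D) cospi cos0; ring.
Qed.

(** Integration by parts: the right primitive is [- cos x * sin x ^+ n.+1], which vanishes at both
    ends. *)
Lemma wallisS n : n.+2%:R * wallis n.+2 = n.+1%:R * wallis n.
Proof.
have D (x : R) : is_derive x 1 (fun x => - (cos x * sin x ^+ n.+1))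
    (n.+2%:R * sin x ^+ n.+2 + (- n.+1%:R) * sin x ^+ n).
  have Ds := is_derive_sin x.
  have Dsn : is_derive x 1 (fun x => sin x ^+ n.+1) (n.+1%:R * sin x ^+ n * cos x).
    have := is_deriveX n.+1 Ds; rewrite (_ : sin ^+ n.+1 = fun x => sin x ^+ n.+1).
      by move=> H; apply: (is_derive_eq H); rewrite -[_ *: _]/(_ * _) mulr_natl.
    by apply/funext => z; rewrite fctE.
  apply: (is_derive_eq (is_deriveN (is_deriveM (is_derive_cos x) Dsn))).
  rewrite -![_ *: _]/(_ * _) /=.
  have := @cos2Dsin2 R x; rewrite !exprS -!natr1.
  move: (sin x) (cos x) (n%:R) (sin x ^+ n) => s c m p.
  rewrite expr0 !mulr1 => E.
  have -> : c * ((m + 1) * p * c) = (m + 1) * p * (c * c) by ring.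
  have -> : c * c = 1 - s * s by rewrite -E; ring.
  by ring.
have cg : continuous (fun x : R =>
    n.+2%:R * sin x ^+ n.+2 + (- n.+1%:R) * sin x ^+ n).
  by move=> x; apply: cvgD; apply: cvgMr; exact: continuous_sinX.
have := primE cg D pi.
rewrite prim_linear; [|exact: continuous_sinX|exact: continuous_sinX].
rewrite -!/(wallis _) sinpi sin0 !expr0n /= !mulr0 subrr => E.
by apply/eqP; rewrite -subr_eq0 -mulNr E.
Qed.

(** By [wallisS] the left-hand side does not depend on [n], and at [n = 0] it is [pi * 2]. *)
Lemma wallisM n : n.+1%:R * (wallis n * wallis n.+1) = 2 * pi.
Proof.
elim: n => [|n IH]; first by rewrite wallis0 wallis1 mul1r mulrC.
by rewrite mulrCA wallisS mulrCA -IH; ring.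
Qed.

End Wallis.

(** * Bernstein polynomials and uniform approximation *)

Section Bernstein.
Context {R : realType}.
Implicit Types (h : nat -> R) (x : R).

(* [bern n h] is the [n]-th Bernstein polynomial with nodal values [h]; its
   value at [x] is the expectation of [h] under the binomial law [(n, x)]. *)
Fixpoint bern (n : nat) (h : nat -> R) : {poly R} :=
  if n is m.+1 then 'X * bern m (fun i => h i.+1) + (1 - 'X) * bern m h
  else (h 0%N)%:P.

Lemma bernS n h x : (bern n.+1 h).[x] =
  x * (bern n (fun i => h i.+1)).[x] + (1 - x) * (bern n h).[x].
Proof. by rewrite /= !hornerE. Qed.

Lemma bern_linear n h h' (c : R) x :
  (bern n (fun i => h i + c * h' i)).[x] = (bern n h).[x] + c * (bern n h').[x].
Proof.
elim: n h h' => [|n IH] h h'; first by rewrite /= !hornerE.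
by rewrite !bernS !IH; ring.
Qed.

Lemma bern_cst n (c : R) x : (bern n (fun=> c)).[x] = c.
Proof.
by elim: n => [|n IH]; [rewrite /= hornerE|rewrite bernS !IH; ring].
Qed.

Lemma bern_le n h h' x : 0 <= x <= 1 -> (forall i, (i <= n)%N -> h i <= h' i) ->
  (bern n h).[x] <= (bern n h').[x].
Proof.
move=> /andP[x0 x1]; elim: n h h' => [|n IH] h h' H.
  by rewrite /= !hornerE; exact: H.
rewrite !bernS; apply: lerD; apply: ler_wpM2l; rewrite ?subr_ge0//.
  by apply: IH => i hi; exact: H.
by apply: IH => i hi; apply: H; exact: leqW.
Qed.

(** Second moment of the binomial law about an arbitrary point: moving the nodes by one moves [c] by
    one, which is why the induction keeps [c] general. *)
Lemma bern_variance n (c : R) x : (bern n (fun i => (i%:R - c) ^+ 2)).[x] =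
  n%:R * x * (1 - x) + (n%:R * x - c) ^+ 2.
Proof.
elim: n c => [|n IH] c; first by rewrite /= !hornerE; ring.
rewrite bernS IH (_ : (fun i : nat => _) = fun i : nat => (i%:R - (c - 1)) ^+ 2).
  by rewrite IH -natr1; ring.
by apply/funext => i; rewrite -natr1; congr (_ ^+ 2); ring.
Qed.

(** Chebyshev's argument without probabilities: [|w| <= d + w^2 / d] bounds the Lipschitz error by a
    quadratic in the node, whose expectation is given by [bern_variance]. *)
Lemma bern_approx (F : R -> R) (L d x : R) n : 0 <= x <= 1 -> 0 < d -> 0 <= L ->
  (0 < n)%N ->
  (forall u v : R, 0 <= u <= 1 -> 0 <= v <= 1 -> `|F u - F v| <= L * `|u - v|) ->
  `|(bern n (fun i => F (i%:R / n%:R))).[x] - F x| <= L * (d + 1 / (d * n%:R)).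
Proof.
move=> hx d0 L0 n0 HF.
have n0' : (0 : R) < n%:R by rewrite ltr0n.
have nn : (n%:R : R) != 0 by rewrite gt_eqF.
pose E (i : nat) : R := L * d + L / (d * n%:R ^+ 2) * (i%:R - n%:R * x) ^+ 2.
have HE i : (i <= n)%N -> `|F (i%:R / n%:R) - F x| <= E i.
  move=> hi; have iu : 0 <= (i%:R / n%:R : R) <= 1.
    apply/andP; split; first by rewrite divr_ge0.
    by rewrite ler_pdivrMr// mul1r ler_nat.
  apply: le_trans (HF _ _ iu hx) _.
  have -> : E i = L * (d + (i%:R / n%:R - x) ^+ 2 / d).
    by rewrite /E; field; rewrite nn gt_eqF.
  apply: ler_wpM2l => //; set w := _ - x.
  have [wd|dw] := leP `|w| d.
    by apply: le_trans wd _; rewrite lerDl divr_ge0 ?sqr_ge0// ltW.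
  apply: (@le_trans _ _ (w ^+ 2 / d)); last by rewrite lerDr ltW.
  rewrite ler_pdivlMr// -(real_normK (num_real w)) expr2.
  by apply: ler_wpM2l => //; exact: ltW.
have BE : (bern n E).[x] <= L * (d + 1 / (d * n%:R)).
  rewrite (bern_linear n (fun=> L * d)) bern_cst bern_variance subrr expr0n /= addr0.
  rewrite (mulrDr L d) lerD2l.
  have -> : L / (d * n%:R ^+ 2) * (n%:R * x * (1 - x)) =
    L * ((x * (1 - x)) / (d * n%:R)) by field; rewrite nn gt_eqF.
  apply: ler_wpM2l => //; rewrite ler_pM2r ?invr_gt0 ?mulr_gt0//.
  by move/andP: hx => [? ?]; nra.
have up : (bern n (fun i => F (i%:R / n%:R))).[x] <= F x + (bern n E).[x].
  have := @bern_le n (fun i => F (i%:R / n%:R)) (fun i => F x + 1 * E i) x hx.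
  rewrite (bern_linear n (fun=> F x)) bern_cst mul1r; apply => i /HE.
  by rewrite ler_norml mul1r => /andP[_]; lra.
have lo : F x - (bern n E).[x] <= (bern n (fun i => F (i%:R / n%:R))).[x].
  have := @bern_le n (fun i => F x + (-1) * E i) (fun i => F (i%:R / n%:R)) x hx.
  rewrite (bern_linear n (fun=> F x)) bern_cst mulN1r; apply => i /HE.
  by rewrite ler_norml mulN1r => /andP[+ _]; lra.
by rewrite ler_norml; apply/andP; split; move: BE up lo;
  move: (L * _) (bern n E).[x] (bern n _).[x] => *; lra.
Qed.

End Bernstein.

Section Abel.
Context {R : realType}.

Lemma continuous_asin (F : R -> R) (c : R) : continuous F ->
  continuous (fun x => F (c * sin x)).
Proof.
move=> cF x; apply: (@continuous_comp _ _ _ (fun x => c * sin x) F); last exact: cF.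
by apply: cvgMr; exact: continuous_sin.
Qed.

Lemma prim_poly (P : {poly R}) (s : R) :
  prim (horner P) s = \sum_(i < size P) P`_i * (s ^+ i.+1 / i.+1%:R).
Proof.
have E : horner P = fun x => \sum_(i < size P) P`_i * x ^+ i.
  by apply/funext => x; rewrite horner_coef.
have cX (i : nat) : continuous (fun x : R => x ^+ i) by exact: exprn_continuous.
rewrite E prim_sum; last by move=> i x; apply: cvgMr; exact: cX.
apply: eq_bigr => i _.
have D (x : R) : is_derive x 1 (fun x => P`_i * (x ^+ i.+1 / i.+1%:R)) (P`_i * x ^+ i).
  have D1 : is_derive x 1 (fun x : R => x ^+ i.+1) (i.+1%:R * x ^+ i).
    have := is_deriveX i.+1 (is_derive_id x (1 : R)).
    rewrite (_ : id ^+ i.+1 = fun x => x ^+ i.+1); last by apply/funext => z; rewrite fctE.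
    by move=> H; apply: (is_derive_eq H); rewrite [_ *: 1]mulr1 mulr_natl.
  have -> : (fun x => P`_i * (x ^+ i.+1 / i.+1%:R)) =
    (P`_i / i.+1%:R) \*: (fun x : R => x ^+ i.+1).
    by apply/funext => z; rewrite -[RHS]/(_ * _) mulrA mulrAC.
  apply: (is_derive_eq (is_deriveZ _ D1)).
  by rewrite -[_ *: _]/(_ * _) mulrA divfK ?pnatr_eq0.
rewrite (primE _ D) ?expr0n /= ?mul0r ?mulr0 ?subr0//.
by move=> x; apply: cvgMr; exact: cX.
Qed.

(** For [c > 0] this is twice the integral of [F(y) / sqrt (c^2 - y^2)] over [[0, c]], Abel's
    integral, after [y = c sin x]; in this form it has no singularity. *)
Definition abel (F : R -> R) (c : R) : R := prim (fun x => F (c * sin x)) pi.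

Lemma abel_poly (P : {poly R}) (c : R) :
  abel (horner P) c = \sum_(i < size P) P`_i * c ^+ i * wallis i.
Proof.
rewrite /abel.
have -> : (fun x => P.[c * sin x]) =
    fun x => \sum_(i < size P) (P`_i * c ^+ i) * sin x ^+ i.
  apply/funext => x; rewrite horner_coef; apply: eq_bigr => i _.
  by rewrite exprMn mulrA.
rewrite prim_sum; last first.
  by move=> i x; apply: cvgMr; exact: continuous_sinX.
apply: eq_bigr => i _.
have := prim_linear (P`_i * c ^+ i) 0 pi (@continuous_sinX R i) (@continuous_sinX R i).
rewrite mul0r addr0 => <-; congr prim.
by apply/funext => x; rewrite mul0r addr0.
Qed.

(** Abel's inversion formula. On [y^n] both sides are multiples of [s^(n+1)], with factors
    [W_n W_(n+1)] and [2 pi / (n + 1)], equal by [wallisM]. *)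
Lemma abel_abel_poly (P : {poly R}) (s : R) :
  prim (fun x => s * sin x * abel (horner P) (s * sin x)) pi =
  2 * pi * prim (horner P) s.
Proof.
rewrite prim_poly mulr_sumr.
have -> : (fun x => s * sin x * abel (horner P) (s * sin x)) =
   fun x => \sum_(i < size P) (P`_i * s ^+ i.+1 * wallis i) * sin x ^+ i.+1.
  apply/funext => x; rewrite abel_poly mulr_sumr; apply: eq_bigr => i _.
  by rewrite exprMn !exprS; ring.
rewrite prim_sum; last first.
  by move=> i x; apply: cvgMr; exact: continuous_sinX.
apply: eq_bigr => i _.
have := prim_linear (P`_i * s ^+ i.+1 * wallis i) 0 pi
  (@continuous_sinX R i.+1) (@continuous_sinX R i.+1).
rewrite mul0r addr0 => E.
transitivity (P`_i * s ^+ i.+1 * wallis i * wallis i.+1).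
  rewrite /wallis -E; congr prim.
  by apply/funext => x; rewrite mul0r addr0.
rewrite -(@wallisM R i); field.
by rewrite addrC natr1 pnatr_eq0.
Qed.

Lemma smooth_lipschitz (F : R -> R) (s : R) : 0 < s -> smooth_on setT F ->
  exists2 L, 0 <= L & forall u v, 0 <= u <= s -> 0 <= v <= s ->
    `|F u - F v| <= L * `|u - v|.
Proof.
move=> s0 sF.
have cdF : {within `[0, s], continuous (fun x => `|derive1 F x|)}.
  apply: continuous_subspaceT => x; apply: (@continuous_comp _ _ _ (derive1 F) Num.norm).
    exact: (smooth_on_continuous (smooth_on_derive1 sF)).
  exact: norm_continuous.
have [c _ Hc] := EVT_max (ltW s0) cdF.
exists `|derive1 F c| => // u v.
wlog uv : u v / u < v.
  move=> W hu hv; case: (ltgtP u v) => [uv|vu|->]; first exact: W.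
    by rewrite distrC (distrC u); exact: W.
  by rewrite !subrr normr0 mulr0.
move=> /andP[u0 us] /andP[v0 vs].
have [x _|z /andP[uz zv] E] := @mean_value R F (derive1 F) u v uv.
  exact: (smooth_on_is_derive sF).
rewrite distrC E normrM (distrC u); apply: ler_wpM2r => //.
by apply: Hc; rewrite in_itv /= (le_trans u0 (ltW uz)) (le_trans (ltW zv)).
Qed.

(** Bernstein approximation on [[0, 1]], rescaled to [[0, s]]; the Lipschitz constant is multiplied
    by [s]. *)
Lemma poly_approx (F : R -> R) (s eps : R) : 0 < s -> 0 < eps ->
  smooth_on setT F ->
  exists P : {poly R}, forall y, 0 <= y <= s -> `|P.[y] - F y| <= eps.
Proof.
move=> s0 e0 sF; have [L L0 HL] := smooth_lipschitz s0 sF.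
pose L' := L * s; have L'0 : 0 <= L' by rewrite mulr_ge0// ltW.
have L'1 : 0 < L' + 1 by rewrite ltr_wpDl.
have [d d0 Ld] : exists2 d, 0 < d & L' * (d + d) <= eps.
  exists (eps / (2 * (L' + 1))); first by rewrite divr_gt0// mulr_gt0.
  rewrite (_ : L' * _ = eps * (L' / (L' + 1))); last by field; rewrite gt_eqF.
  by rewrite -[leRHS]mulr1 ler_pM2l// ler_pdivrMr ?mul1r ?lerDl.
(* With [n >= d^-2] the two error terms [d] and [1 / (d n)] are both at most [d]. *)
have [n n0 nd] : exists2 n, (0 < n)%N & d ^- 2 <= n%:R.
  by exists (Num.truncn (d ^- 2)).+1 => //; rewrite ltW// truncnS_gt.
have HF u v : 0 <= u <= 1 -> 0 <= v <= 1 ->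
    `|F (s * u) - F (s * v)| <= L' * `|u - v|.
  move=> /andP[u0 u1] /andP[v0 v1].
  have H w : 0 <= w -> w <= 1 -> 0 <= s * w <= s.
    move=> w0 w1; apply/andP; split; first by rewrite mulr_ge0// ltW.
    by rewrite -[leRHS]mulr1 ler_pM2l.
  apply: le_trans (HL _ _ (H u u0 u1) (H v v0 v1)) _.
  by rewrite -mulrBr normrM (gtr0_norm s0) mulrA.
exists (bern n (fun i => F (s * (i%:R / n%:R))) \Po (s^-1 *: 'X)) => y /andP[y0 ys].
have hy : 0 <= y / s <= 1.
  apply/andP; split; first by rewrite divr_ge0// ltW.
  by rewrite ler_pdivrMr// mul1r.
have H := @bern_approx R (fun u => F (s * u)) L' d (y / s) n hy d0 L'0 n0 HF.
have E : s * (y / s) = y by rewrite mulrC divfK ?gt_eqF.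
have Es : (s^-1 *: 'X).[y] = y / s by rewrite !hornerE mulrC.
rewrite /= E in H; rewrite horner_comp Es; apply: le_trans H _.
apply: le_trans Ld; apply: ler_wpM2l => //; rewrite lerD2l.
have nR : (0 : R) < n%:R by rewrite ltr0n.
rewrite ler_pdivrMr ?mulr_gt0// mulrA -expr2 mulrC.
by rewrite -ler_pdivrMr ?exprn_gt0// mul1r.
Qed.

(** As [a] tends to [0] the transform tends to [pi * F 0], at a rate given by the Lipschitz constant
    on [[0, 1]]. *)
Lemma abel_eq0_at0 (F : R -> R) : smooth_on setT F ->
  (forall a, 0 < a -> abel F a = 0) -> F 0 = 0.
Proof.
move=> sF HF; have p0 := @pi_gt0 R.
have cF : continuous F by move=> x; exact: (smooth_on_continuous sF).
have [L L0 HL] := smooth_lipschitz ltr01 sF.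
apply/eqP; rewrite -normr_le0; apply/ler_addgt0Pr => /= e e0; rewrite add0r.
pose a := Num.min 1 (e / (L + 1)).
have L1 : 0 < L + 1 by rewrite ltr_wpDl.
have a0 : 0 < a by rewrite lt_min ltr01 divr_gt0.
have ae : L * a <= e.
  apply: (@le_trans _ _ (L * (e / (L + 1)))).
    by apply: ler_wpM2l => //; rewrite ge_min lexx orbT.
  rewrite mulrCA -[leRHS]mulr1 ler_pM2l// ler_pdivrMr ?mul1r ?lerDl//.
have := @prim_bound R (fun x => F 0 - F (a * sin x)) (L * a) pi _ (ltW p0).
have cg : continuous (fun x => F (a * sin x)) := continuous_asin cF.
have -> : (fun x => F 0 - F (a * sin x)) = (fun x => 1 * F 0 + (-1) * F (a * sin x)).
  by apply/funext => x; rewrite mul1r mulN1r.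
have cc : continuous (fun _ : R => F 0) by move=> x; exact: cvg_cst.
rewrite (prim_linear 1 (-1) pi cc cg) prim_cst (mul1r (F 0 * pi)).
rewrite -/(abel F a) HF// mulr0 addr0 normrM (gtr0_norm p0) ler_pM2r// => H.
apply: le_trans (H _ _) ae.
  by move=> x; apply: cvgD; apply: cvgMr; [exact: cc|exact: cg].
move=> x hx.
have s0 : 0 <= sin x by exact: sin_ge0_pi.
have hs : 0 <= a * sin x <= 1.
  apply/andP; split; first by rewrite mulr_ge0// ltW.
  by rewrite mulr_ile1 ?sin_le1 ?(ltW a0)// ge_min lexx.
have h0 : 0 <= (0 : R) <= 1 by rewrite lexx ler01.
apply: le_trans (HL _ _ h0 hs) _; apply: ler_wpM2l => //.
rewrite sub0r normrN ger0_norm; last by case/andP: hs.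
by rewrite -[leRHS]mulr1 ler_pM2l// sin_le1.
Qed.

(* Weierstrass approximation reduces the claim to polynomials, for which
   averaging the transform once more recovers the primitive
   ([abel_abel_poly]). *)
Lemma abel_injective (F : R -> R) : smooth_on setT F ->
  (forall a, 0 < a -> abel F a = 0) -> forall y, 0 <= y -> F y = 0.
Proof.
move=> sF HF; have p0 := @pi_gt0 R.
have cF : continuous F by move=> x; exact: (smooth_on_continuous sF).
have F0 := abel_eq0_at0 sF HF.
have HF0 a : 0 <= a -> abel F a = 0.
  rewrite le_eqVlt => /orP[/eqP <-|]; last exact: HF.
  by rewrite /abel (_ : (fun x => _) = fun=> 0) ?prim_cst ?mul0r//;
    apply/funext => x; rewrite mul0r.
have pF s : 0 < s -> prim F s = 0.
  move=> s0; apply/eqP; rewrite -normr_le0; apply/ler_addgt0Pr => /= e e0.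
  rewrite add0r.
  (* Error budget: the primitive of the approximating polynomial differs from that of [F] by at most
     [eps * s], and is itself at most [s * eps * pi]; together this is [eps * K = e]. *)
  pose K := s * (1 + pi); have K0 : 0 < K by rewrite mulr_gt0// addr_gt0.
  pose eps := e / K; have eps0 : 0 < eps by rewrite divr_gt0.
  have [P HP] := poly_approx s0 eps0 sF.
  have cP : continuous (horner P) by move=> x; exact: continuous_horner.
  have dP : `|prim (horner P) s - prim F s| <= eps * s.
    have := @prim_bound R (fun x => 1 * P.[x] + (-1) * F x) eps s _ (ltW s0).
    rewrite (prim_linear 1 (-1) s cP cF) mul1r mulN1r; apply.
      by move=> x; apply: cvgD; apply: cvgMr; [exact: cP|exact: cF].
    by move=> x hx; rewrite mul1r mulN1r; exact: HP.
  have bP c : 0 <= c <= s -> `|abel (horner P) c| <= eps * pi.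
    move=> /andP[c0 cs].
    have cPs : continuous (fun x => P.[c * sin x]) := continuous_asin cP.
    have cFs : continuous (fun x => F (c * sin x)) := continuous_asin cF.
    have := @prim_bound R (fun x => 1 * P.[c * sin x] + (-1) * F (c * sin x))
      eps pi _ (ltW p0).
    rewrite (prim_linear 1 (-1) pi cPs cFs) mul1r mulN1r -/(abel F c) HF0// subr0.
    apply.
      by move=> x; apply: cvgD; apply: cvgMr; [exact: cPs|exact: cFs].
    move=> x hx; rewrite mul1r mulN1r; apply: HP.
    have s1 : 0 <= sin x by exact: sin_ge0_pi.
    apply/andP; split; [exact: mulr_ge0|apply: le_trans cs].
    by rewrite -[leRHS]mulr1; apply: ler_wpM2l => //; exact: sin_le1.
  have : `|2 * pi * prim (horner P) s| <= s * (eps * pi) * pi.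
    rewrite -abel_abel_poly; apply: prim_bound; last first.
    - move=> x hx; have s1 : 0 <= sin x by exact: sin_ge0_pi.
      have ss : 0 <= s * sin x <= s.
        apply/andP; split; first by rewrite mulr_ge0// ltW.
        by rewrite -[leRHS]mulr1 ler_pM2l// sin_le1.
      rewrite normrM; apply: ler_pM => //; last exact: bP.
      by case/andP: ss => [h0 h1]; rewrite ger0_norm.
    - exact: ltW.
    (* Continuity of the integrand: the transform of a polynomial is a polynomial, with coefficients
       multiplied by Wallis integrals. *)
    have -> : (fun x => s * sin x * abel (horner P) (s * sin x)) =
      (fun x => ('X * \poly_(i < size P) (P`_i * wallis i)).[s * sin x]).
      apply/funext => x; rewrite !hornerE abel_poly horner_poly; congr (_ * _).
      by apply: eq_bigr => i _; rewrite mulrAC.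
    by apply: continuous_asin => y; exact: continuous_horner.
  rewrite normrM gtr0_norm ?mulr_gt0// => H.
  have H2 : `|prim (horner P) s| <= s * eps * pi.
    have p2 : 0 < 2 * pi :> R by rewrite mulr_gt0.
    rewrite -(ler_pM2l p2); apply: le_trans H _.
    rewrite (_ : s * (eps * pi) * pi = pi * (s * eps * pi)); last by ring.
    apply: ler_wpM2r; first by apply: mulr_ge0; [apply: mulr_ge0|]; exact: ltW.
    by apply: ler_peMl; [exact: ltW|rewrite ler1n].
  have -> : prim F s = prim (horner P) s - (prim (horner P) s - prim F s) by ring.
  apply: le_trans (ler_normB _ _) _.
  apply: le_trans (lerD H2 dP) _.
  suff E (p : R) : 0 < p ->
    s * (e / (s * (1 + p))) * p + e / (s * (1 + p)) * s = e by rewrite E.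
  by move=> hp; field; rewrite (gt_eqF s0) gt_eqF// addr_gt0.
move=> y; rewrite le_eqVlt => /orP[/eqP <- //|y0].
have N : \forall z \near y, cst 0 z = prim F z.
  by near=> z; rewrite pF//; near: z; exact: lt_nbhsr.
have D0 := @near_eq_is_derive R _ _ (cst 0) (prim F) y 1 0 N (is_derive_cst 0 y 1).
have := @derive_val _ _ _ _ _ _ _ (is_derive_prim y cF).
by rewrite (@derive_val _ _ _ _ _ _ _ D0).
Unshelve. all: by end_near. Qed.

End Abel.

(** * Closed geodesics *)

Section Periods.
Context {R : realType} {S : surface R} (g : lorentzian_metric S).
Variables (k : nat) (tau : R) (phi : 'I_(2 * k) -> chart R S)
  (f : 'I_(2 * k) -> R -> R).
Hypotheses (hk : (1 <= k)%N) (hA : parabolic_atlas g tau phi f).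

Notation pp i := (phi (cyc hk i)).
Notation s i := (@sgc R k hk i).
Notation ang := (angle f hk).
Notation gd := (geod tau phi f hk).

Definition full_turn : R := (2 * k)%:R * pi.

Lemma full_turn_gt0 : 0 < full_turn.
Proof. by rewrite mulr_gt0 ?pi_gt0// ltr0n muln_gt0. Qed.

Lemma full_turnE (m : int) :
  m%:~R * full_turn = (m * (2 * k)%:Z)%:~R * pi.
Proof. by rewrite /full_turn intrM mulrA. Qed.

Lemma sgc_period i (m : int) : s (i + m * (2 * k)%:Z) = s i.
Proof. by rewrite /sgc cyc_period. Qed.

Lemma sin_period th (m : int) : sin (th + m%:~R * full_turn) = sin th.
Proof.
have := sin_shift hk (0 + (- m) * (2 * k)%:Z) th.
by rewrite sgc_period sgc0 mul1r add0r -full_turnE mulrNz mulNr opprK.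
Qed.

Lemma nearest_period th (m : int) :
  nearest (th + m%:~R * full_turn) = nearest th + m * (2 * k)%:Z.
Proof. by rewrite full_turnE nearestD. Qed.

Lemma prim_periodz (u : R -> R) (p : R) (m : int) : continuous u ->
  (forall x, u (x + p) = u x) ->
  forall x, prim u (x + m%:~R * p) = prim u x + m%:~R * prim u p.
Proof.
move=> cu hp; elim/int_rec: m => [|n IH|n IH] x.
- by rewrite !mul0r !addr0.
- rewrite intS intrD !mulrDl !mul1r (addrC p) addrA (prim_period cu hp) IH.
  by ring.
- rewrite intS opprD intrD mulrNz !mulrDl !mulNr !mul1r.
  have := prim_period cu hp (x + (- p + (- n%:Z)%:~R * p)).
  rewrite (_ : x + _ + p = x + (- n%:Z)%:~R * p); last by ring.
  rewrite IH => E; move: E; move: (prim _ _) => q E.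
  by move: E; rewrite mulrNz; lra.
Qed.

Section Amplitude.
Variables (a : R) (a0 : 0 < a).

Lemma speed_period th (m : int) :
  speed f hk a (th + m%:~R * full_turn) = speed f hk a th.
Proof. by rewrite /speed /glue nearest_period cyc_period sin_period. Qed.

Lemma drift_period th (m : int) :
  drift f hk a (th + m%:~R * full_turn) = drift f hk a th.
Proof. by rewrite /drift /glue nearest_period cyc_period sin_period. Qed.

Lemma prim_drift_period th (m : int) :
  prim (drift f hk a) (th + m%:~R * full_turn) =
  prim (drift f hk a) th + m%:~R * prim (drift f hk a) full_turn.
Proof.
apply: prim_periodz => [x|x]; first exact: (drift_continuous hA a0).
by rewrite -(drift_period x 1) mul1r.
Qed.

Lemma clock_period th (m : int) :
  clock f hk a (th + m%:~R * full_turn) =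
  clock f hk a th + m%:~R * clock f hk a full_turn.
Proof.
apply: prim_periodz => [x|x]; first exact: (speed_continuous hA a0).
by rewrite -(speed_period x 1) mul1r.
Qed.

(* The translation of the first coordinate after one full turn. *)
Definition holonomy : R := tau - a * prim (drift f hk a) full_turn.

Lemma xcoord_period x0 i th (m : int) :
  xcoord tau f hk a x0 (i + m * (2 * k)%:Z) (th + m%:~R * full_turn) =
  xcoord tau f hk a x0 i th + s i * (m%:~R * holonomy).
Proof.
rewrite /xcoord sgc_period (turn_period hk) prim_drift_period.
rewrite (_ : th + _ - _ = th - i%:~R * pi).
  by rewrite /holonomy intrD; ring.
by rewrite full_turnE intrD; ring.
Qed.

Lemma path_period x0 th (m : int) : holonomy = 0 ->
  path tau phi f hk a x0 (th + m%:~R * full_turn) = path tau phi f hk a x0 th.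
Proof.
move=> h0; rewrite /path /glue nearest_period /path_point xcoord_period h0.
by rewrite !mulr0 addr0 cyc_period sin_period.
Qed.

Lemma clock0 : clock f hk a 0 = 0.
Proof. by apply: prim0 => x; exact: (speed_continuous hA a0). Qed.

Lemma clock_lt u v : u < v -> clock f hk a u < clock f hk a v.
Proof.
move=> uv; apply: (derive_increasing uv (df := speed f hk a)) => x _.
  by apply: is_derive_prim => y; exact: (speed_continuous hA a0).
exact: (speed_gt0 hk hA a x).
Qed.

Lemma clock_full_turn_gt0 : 0 < clock f hk a full_turn.
Proof. by rewrite -clock0; apply: clock_lt; exact: full_turn_gt0. Qed.

Lemma sin_inj_nearest i (u v : R) : nearest u = i -> nearest v = i ->
  sin u = sin v -> u = v.
Proof.
move=> nu nv e; have := nearest_itv u; have := nearest_itv v; rewrite nu nv.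
move=> hv hu; apply: (addIr (- (i%:~R * pi))).
apply: sin_inj; last by rewrite !(sin_shift hk) e.
  by rewrite in_itv /=; move: hu; move: (_ * pi) => w /andP[h1 h2];
    apply/andP; split; lra.
by rewrite in_itv /=; move: hv; move: (_ * pi) => w /andP[h1 h2];
  apply/andP; split; lra.
Qed.

(** The geodesic starts on [y = 0]. When it returns there, the angle has increased by a nonzero
    number of full turns, and [x] has been translated by that number times the holonomy. *)
Lemma holonomy_eq0_of_closed (T : R) : simply_closed T (gd a 0 1 0) ->
  holonomy = 0.
Proof.
move=> [T0 per _].
have [K1 K2 _] := phaseP hk hA a0.
have A0 : ang a 1 0 0 = 0 by rewrite /angle mulr0 addr0 -{1}clock0 K1.
pose u := ang a 1 0 T.
have cu : clock f hk a u = T by rewrite /u /angle mul1r addr0 K2.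
pose i := nearest u; have su : strip i u by exact: strip_nearest.
have s0 : strip 0 (ang a 1 0 0).
  by rewrite A0; apply/strip_shift; rewrite mul0r subr0 oppr_lt0 pi_gt0.
have [d1 m1] := geod_chart_map hA 0 a0 su.
have [d0 m0] := geod_chart_map hA 0 a0 s0.
have E : gd a 0 1 0 T = gd a 0 1 0 0 by rewrite -(per 0) add0r.
rewrite A0 sin0 mulr0 in m0.
(* Distinct charts meet only where [y <> 0], so a point with [y = 0] lies in a single chart and the
   return takes place in the initial one. *)
have ci : cyc hk i = cyc hk 0.
  apply/eqP/negPn/negP => ne; have [_ _ ov _ _] := hA.
  have : overlap (pp 0) (pp i) (xcoord tau f hk a 0 0 0, 0).
    by rewrite -m0; exists (gd a 0 1 0 0) => //; split => //; rewrite -E.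
  rewrite ov 1?eq_sym//= => -[[_ h]|[_ h]]; by rewrite ltxx in h.
have iE : i = 0 + turn k i * (2 * k)%:Z.
  by rewrite {1}(cyc_turn hk i) ci add0r /= mod0z addr0.
have := m1; rewrite E ci m0 => -[xE yE].
have sinu : sin u = 0.
  by move/esym/eqP: yE; rewrite mulf_eq0 gt_eqF//= => /eqP.
have uE : u = 0 + (turn k i)%:~R * full_turn.
  apply: (@sin_inj_nearest i) => //; last by rewrite sin_period sin0.
  rewrite nearest_period iE; congr (_ + _ * _); last by rewrite -iE.
  rewrite /nearest mul0r add0r; apply/eqP; rewrite -[_ == _]/(_ == (0 : int)).
  by apply/eqP; apply/floor_def; rewrite ?add0r ?invr_ge0 ?ler0n ?invf_lt1 ?ltr1n.
have xE' : xcoord tau f hk a 0 i u =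
    xcoord tau f hk a 0 0 0 + s 0 * ((turn k i)%:~R * holonomy).
  by rewrite -xcoord_period -uE -iE.
move: xE; rewrite -/u xE' sgc0 mul1r => /eqP.
rewrite -subr_eq0 opprD addrA subrr sub0r oppr_eq0.
rewrite mulf_eq0 intr_eq0 => /orP[/eqP t0|/eqP//].
by move: cu T0; rewrite uE t0 mul0r addr0 clock0 => ->; rewrite ltxx.
Qed.

End Amplitude.
End Periods.

(** * Absence of self-intersections *)

Section ClosedGeodesics.
Context {R : realType} {S : surface R} (g : lorentzian_metric S).
Variables (k : nat) (tau : R) (phi : 'I_(2 * k) -> chart R S)
  (f : 'I_(2 * k) -> R -> R).
Hypotheses (hk : (1 <= k)%N) (hA : parabolic_atlas g tau phi f).

Notation ff i := (f (cyc hk i)).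
Notation pp i := (phi (cyc hk i)).
Notation s i := (@sgc R k hk i).
Notation gd := (geod tau phi f hk).
Notation P := (full_turn k).

Variables (a : R) (a0 : 0 < a).

Notation pth x0 := (path tau phi f hk a x0).

(* The geodesic could only cross itself at two points of the strip that are
   symmetric about the turning point [z = pi / 2]; there the first coordinate
   differs, because [d/dz] of the difference is [- 2 hh / (a sin^2 z)]. *)
Lemma xcoord_reflect x0 i z : 0 < z < pi / 2 ->
  xcoord tau f hk a x0 i (i%:~R * pi + (pi - z)) !=
  xcoord tau f hk a x0 i (i%:~R * pi + z).
Proof.
move=> /andP[z0 z1]; have p0 := @pi_gt0 R.
pose D y := s i * (xcoord tau f hk a x0 i (i%:~R * pi + y)
                   - xcoord tau f hk a x0 i (i%:~R * pi + (pi - y))).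
have EI (y : R) : i%:~R * pi + y - i%:~R * pi = y by rewrite addrAC subrr add0r.
have st (y : R) : 0 < y < pi -> strip i (i%:~R * pi + y).
  by move=> /andP[y0 y1]; apply/strip_shift; rewrite EI; apply/andP; split; lra.
have sinE y : sin (i%:~R * pi + y) = s i * sin y.
  by have := sin_shift hk i (i%:~R * pi + y); rewrite EI => ->;
    rewrite mulrA sgc_sqr mul1r.
have cosE y : s i * cos (i%:~R * pi + y) = cos y.
  by have := cos_shift hk i (i%:~R * pi + y); rewrite EI.
have DD (y : R) : z <= y <= pi / 2 ->
    is_derive y 1 D (2 / (a * sin y ^+ 2) * hh (ff i) (a * (s i * sin y))).
  move=> /andP[zy yp].
  have y1 : 0 < y < pi by apply/andP; split; lra.
  have y2 : 0 < pi - y < pi by apply/andP; split; lra.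
  have D1 : is_derive y 1 (fun y : R => i%:~R * pi + y) 1.
    by have := is_deriveD (is_derive_cst (i%:~R * pi) y (1 : R))
      (is_derive_id y (1 : R)); rewrite add0r.
  have D2 : is_derive y 1 (fun y : R => i%:~R * pi + (pi - y)) (-1).
    have := is_deriveD (is_derive_cst (i%:~R * pi) y (1 : R))
      (is_deriveB (is_derive_cst (pi : R) y (1 : R)) (is_derive_id y (1 : R))).
    by rewrite add0r sub0r.
  have E1 := @is_derive1_comp R (xcoord tau f hk a x0 i) (fun y => i%:~R * pi + y)
    y _ _ (is_derive_xcoord hk hA a0 x0 (st y y1)) D1.
  have E2 := @is_derive1_comp R (xcoord tau f hk a x0 i)
    (fun y => i%:~R * pi + (pi - y)) y _ _
    (is_derive_xcoord hk hA a0 x0 (st _ y2)) D2.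
  apply: (is_derive_eq (is_deriveZ (s i) (is_deriveB E1 E2))).
  rewrite -[_ *: _]/(_ * _) !cosE !sinE.
  have -> : sin (pi - y) = sin y by rewrite sinB sinpi cospi; ring.
  have -> : cos (pi - y) = - cos y by rewrite cosB sinpi cospi; ring.
  have gE := sqr_gg (f_lt1 hA (cyc hk i)) (a * (s i * sin y)).
  have hE : hh (ff i) (a * (s i * sin y)) =
     1 - (a * (s i * sin y)) ^+ 2 * gg (ff i) (a * (s i * sin y)).
    by rewrite gE; ring.
  rewrite hE; move: (gg _ _) => G.
  have sy : 0 < sin y by exact: sin_gt0_pi.
  have s2 := @sgc_sqr R k hk i.
  have c1 : 1 + cos y != 0.
    by rewrite gt_eqF// cosD1_gt0//; apply/andP; split; lra.
  have cs := @cos2Dsin2 R y.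
  have c2 : 1 - cos y != 0.
    apply/eqP => h; have h1 : cos y = 1 by move: h; lra.
    move: cs; rewrite h1 expr1n => h2; have : sin y ^+ 2 = 0 by move: h2; lra.
    by move/eqP; rewrite sqrf_eq0 gt_eqF.
  have an : a != 0 by rewrite gt_eqF.
  have sn : sin y != 0 by rewrite gt_eqF.
  move: s2 cs c1 c2 sn; move: (s i) (sin y) (cos y) => q u c s2 cs c1 c2 sn.
  have inv1 : (1 + c)^-1 + (1 - c)^-1 = 2 / u ^+ 2.
    have -> : u ^+ 2 = (1 + c) * (1 - c).
      have -> : (1 + c) * (1 - c) = 1 - c ^+ 2 by ring.
      by rewrite -cs [c ^+ 2 + _]addrC addrK.
    by field; rewrite c1 c2.
  transitivity (q * q * (((1 + c)^-1 + (1 - c)^-1) / a - 2 * a * G)); first by ring.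
  rewrite inv1 s2 (_ : (a * (q * u)) ^+ 2 = (q * q) * (a * u) ^+ 2); last by ring.
  by rewrite s2; field; rewrite an sn.
have hlt : D z < D (pi / 2).
  apply: (derive_increasing z1 DD) => y /andP[zy yp].
  apply: mulr_gt0; last exact: (hh_gt0 (f_lt1 hA _)).
  rewrite divr_gt0// mulr_gt0// exprn_gt0// sin_gt0_pi//.
  by apply/andP; split; lra.
have Dh : D (pi / 2) = 0.
  by rewrite /D (_ : pi - pi / 2 = pi / 2) ?subrr ?mulr0//; lra.
by apply/eqP => E; move: hlt; rewrite Dh /D E subrr mulr0 ltxx.
Qed.

Hypothesis hol0 : holonomy tau f hk a = 0.

Let path_chart x0 i u v : strip i u -> strip i v -> pth x0 u = pth x0 v ->
  xcoord tau f hk a x0 i u = xcoord tau f hk a x0 i v /\ sin u = sin v.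
Proof.
move=> su sv; rewrite (pathE hk hA a0 x0 su) (pathE hk hA a0 x0 sv).
move=> /(congr1 (chart_map (pp i))).
have [_ ->] := normal_chartK (xcoord tau f hk a x0 i u, a * sin u)
  (parabolic_normal hA (cyc hk i)).
have [_ ->] := normal_chartK (xcoord tau f hk a x0 i v, a * sin v)
  (parabolic_normal hA (cyc hk i)).
by move=> [-> /(mulfI (lt0r_neq0 a0)) ->].
Qed.

(** After removal of full turns both angles lie in the strip of [nearest u] with equal sines, on
    either side of the turning point; being symmetric about it, they are separated by
    [xcoord_reflect]. *)
Let path_adjacent x0 u v : cyc hk (nearest v) = ordS (cyc hk (nearest u)) ->
  0 < s (nearest u) * sin u -> sin u = sin v -> pth x0 u = pth x0 v -> False.
Proof.
set i := nearest u => cv su sv E.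
have ci : cyc hk (i + 1) = cyc hk (nearest v) by rewrite cv; case: (cycS hk i).
pose m := turn k (nearest v) - turn k (i + 1).
have nv : nearest v = i + 1 + m * (2 * k)%:Z.
  have e1 := cyc_turn hk (nearest v); have e2 := cyc_turn hk (i + 1).
  rewrite ci in e2; rewrite /m mulrBl; move: e1 e2.
  by move: (turn k (nearest v) * _) (turn k (i + 1) * _); lia.
pose w := v + (- m)%:~R * P.
have nw : nearest w = i + 1 by rewrite nearest_period nv mulNr addrK.
have sw : sin w = sin u by rewrite sin_period.
have Ew : pth x0 u = pth x0 w by rewrite (path_period hA a0).
have p0 := @pi_gt0 R.
have /andP[u1 u2] := nearest_itv u; rewrite -/i in u1 u2.
have /andP[w1 w2] := nearest_itv w; rewrite nw intrD mulrDl mul1r in w1 w2.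
have sui : sin (u - i%:~R * pi) = s i * sin u by exact: sin_shift.
have swi : sin (w - i%:~R * pi) = s i * sin u by rewrite -sw; exact: sin_shift.
have stu : strip i u by exact: strip_nearest.
have refl := @xcoord_reflect x0 i (u - i%:~R * pi).
have sti := strip_shift i w.
set I := i%:~R * pi in u1 u2 w1 w2 sui swi refl sti.
have ul : 0 < u - I.
  rewrite ltNge; apply/negP => ule.
  have : 0 <= sin (- (u - I)) by apply: sin_ge0_pi; apply/andP; split; lra.
  by rewrite sinN sui oppr_ge0 leNgt su.
have wl : w - I < pi.
  rewrite ltNge; apply/negP => wle.
  have : 0 <= sin (w - I - pi) by apply: sin_ge0_pi; apply/andP; split; lra.
  have := sinDpi (w - I - pi); rewrite subrK swi => swE.
  by move: su; rewrite swE oppr_gt0 ltNge => /negbTE ->.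
have stw : strip i w by apply/sti/andP; split; lra.
have wE : u - I = pi - (w - I).
  apply: sin_inj.
  - by rewrite in_itv /=; apply/andP; split; lra.
  - by rewrite in_itv /=; apply/andP; split; lra.
  by rewrite sui sinB sinpi cospi swi; ring.
have uh : 0 < u - I < pi / 2 by rewrite ul /=; lra.
have [xE _] := path_chart stu stw Ew.
have := refl uh.
rewrite (_ : I + (pi - (u - I)) = w); last by rewrite wE; ring.
by rewrite (_ : I + (u - I) = u) ?xE ?eqxx// addrC subrK.
Qed.

(** A common point lies in the nearest charts of both angles, and these charts are either equal or
    glued, hence consecutive. *)
Lemma path_injective x0 u v : pth x0 u = pth x0 v ->
  exists m : int, v = u + m%:~R * P.
Proof.
move=> E; set i := nearest u; set j := nearest v.
have su : strip i u by exact: strip_nearest.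
have sv : strip j v by exact: strip_nearest.
have [du mu] := normal_chartK (xcoord tau f hk a x0 i u, a * sin u)
  (parabolic_normal hA (cyc hk i)).
have [dv mv] := normal_chartK (xcoord tau f hk a x0 j v, a * sin v)
  (parabolic_normal hA (cyc hk j)).
rewrite -/(path_point tau phi f hk a x0 i u) -(pathE hk hA a0 x0 su) in du mu.
rewrite -/(path_point tau phi f hk a x0 j v) -(pathE hk hA a0 x0 sv) in dv mv.
(* In the same chart [y] alone separates the angles, the sine being injective on the half-width
   [pi / 2] allowed by [nearest]. Otherwise the gluing rules leave two cyclic orders, both handled
   by [path_adjacent]. *)
have [cij|ne] := eqVneq (cyc hk i) (cyc hk j).
  pose m := turn k j - turn k i; exists m.
  have nj : j = i + m * (2 * k)%:Z.
    have e1 := cyc_turn hk j; have e2 := cyc_turn hk i.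
    rewrite cij in e2; rewrite /m mulrBl; move: e1 e2.
    by move: (turn k j * _) (turn k i * _); lia.
  apply: (sin_inj_nearest hk (i := j)) => //.
    by rewrite nearest_period nj.
  rewrite (sin_period hk); move: mv; rewrite -E -cij mu => -[_].
  by move=> /(mulfI (lt0r_neq0 a0)).
have pE := pathE hk hA a0 x0 su; rewrite /path_point in pE.
have [_ _ ov _ _] := hA.
have : overlap (pp i) (pp j) (xcoord tau f hk a x0 i u, a * sin u).
  by rewrite -mu; exists (pth x0 u) => //; split => //; rewrite E.
have sgn (l l' : 'I_(2 * k)) : ~~ odd l && (l' == ordS l) && (0 < a * sin u) ||
    odd l && (l' == ordS l) && (a * sin u < 0) ->
    l' = ordS l /\ 0 < (-1) ^+ l * (a * sin u).
  case/orP => /andP[/andP[par /eqP ->] y0]; split => //.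
    by rewrite -signr_odd (negPf par) expr0 mul1r.
  by rewrite -signr_odd par expr1 mulN1r oppr_gt0.
rewrite (ov _ _ ne) => Hov.
have [[cj s1]|[ci s1]] : (cyc hk j = ordS (cyc hk i) /\
    0 < (-1) ^+ cyc hk i * (a * sin u)) \/
    (cyc hk i = ordS (cyc hk j) /\ 0 < (-1) ^+ cyc hk j * (a * sin u)).
  case: Hov => -[gl y0]; move: gl => /orP[] /andP[par e'].
  - by left; apply: sgn; rewrite par e' y0.
  - by right; apply: sgn; rewrite par e' y0.
  - by left; apply: sgn; rewrite par e' y0 orbT.
  - by right; apply: sgn; rewrite par e' y0 orbT.
- have pE' := pE; rewrite (chart_inv_ordS hA _ s1) -cj E in pE'.
  have := congr1 (chart_map (pp j)) pE'; rewrite mv.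
  have [_ ->] := normal_chartK (- xcoord tau f hk a x0 i u + 2 / (a * sin u)
    + shift_at tau (cyc hk i), a * sin u) (parabolic_normal hA (cyc hk j)).
  move=> [_ /(mulfI (lt0r_neq0 a0)) /esym sE].
  have s2 : 0 < s i * sin u by move: s1; rewrite mulrCA pmulr_rgt0.
  by case: (path_adjacent cj s2 sE E).
- have := chart_inv_ordS hA (- xcoord tau f hk a x0 i u + 2 / (a * sin u)
    + shift_at tau (cyc hk j)) s1.
  rewrite -ci (_ : - (_ + _ + _) + _ + _ = xcoord tau f hk a x0 i u); last by ring.
  rewrite -pE E => /(congr1 (chart_map (pp j))); rewrite mv.
  have [_ ->] := normal_chartK (- xcoord tau f hk a x0 i u + 2 / (a * sin u)
    + shift_at tau (cyc hk j), a * sin u) (parabolic_normal hA (cyc hk j)).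
  move=> [_ /(mulfI (lt0r_neq0 a0)) sE].
  have s2 : 0 < s j * sin v by move: s1; rewrite mulrCA pmulr_rgt0// sE.
  by case: (path_adjacent ci s2 (esym sE) (esym E)).
Qed.

Section Motion.
Variables (x0 e t0 : R) (e0 : e != 0).

Let T : R := clock f hk a P / `|e|.

Let T0 : 0 < T.
Proof. by rewrite divr_gt0 ?normr_gt0// (clock_full_turn_gt0 hk hA a0). Qed.

(** The integer is the sign of [e]: an integral number of turns treats both orientations at once. *)
Let eT : exists m : int, (m = 1 \/ m = -1) /\ e * T = m%:~R * clock f hk a P.
Proof.
have n0 : `|e| != 0 by rewrite normr_eq0.
rewrite /T; have [ep|en|ez] := ltgtP 0 e; last by move: e0; rewrite -ez eqxx.
  exists 1; split; first by left.
  by rewrite (gtr0_norm ep) mul1r mulrC divfK.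
exists (-1); split; first by right.
by rewrite (ltr0_norm en) mulN1r invrN mulrN mulrN mulrC divfK.
Qed.

Lemma geod_simply_closed : simply_closed T (gd a x0 e t0).
Proof.
have [K1 K2 _] := phaseP hk hA a0.
have phase_period c (m : int) : phase f hk a (c + m%:~R * clock f hk a P) =
    phase f hk a c + m%:~R * P.
  by rewrite -[in LHS](K2 c) -(clock_period hk hA a0) K1.
split => //.
  move=> t; rewrite /geod /angle; have [m [_ me]] := eT.
  by rewrite mulrDr addrAC me phase_period (path_period hA a0).
move=> u v /andP[u0 uT] /andP[v0 vT] /path_injective [m].
move=> /(congr1 (clock f hk a)); rewrite (clock_period hk hA a0) /angle !K2 => E.
have cP := clock_full_turn_gt0 hk hA a0.
have E1 : e * (v - u) = m%:~R * clock f hk a P.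
  by move: E; move: (_ * clock _ _ _ _) => *; lra.
have : `|v - u| < T by rewrite ltr_norml; apply/andP; split; lra.
rewrite -(ltr_pM2l (_ : 0 < `|e|)) ?normr_gt0// -normrM E1 normrM /T.
rewrite [`|e| * _]mulrC divfK ?normr_eq0// (gtr0_norm cP).
rewrite gtr_pMl// -intr_norm -[1]/(1%:~R) ltr_int => m1.
have m0 : m = 0 by lia.
move/eqP: E1; rewrite m0 mul0r mulf_eq0 (negPf e0) /= subr_eq0.
by move=> /eqP ->.
Qed.

End Motion.

End ClosedGeodesics.

Section Length.
Context {R : realType} {S : surface R} (g : lorentzian_metric S).
Variables (k : nat) (tau : R) (phi : 'I_(2 * k) -> chart R S)
  (f : 'I_(2 * k) -> R -> R).
Hypotheses (hk : (1 <= k)%N) (hA : parabolic_atlas g tau phi f).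

Lemma geod_sq_velocity a x0 e t0 t : 0 < a -> e != 0 ->
  sq_velocity g (geod tau phi f hk a x0 e t0) t = e ^+ 2.
Proof.
move=> a0 e0; set i := nearest (angle f hk a e t0 t).
have st : strip i (angle f hk a e t0 t) by exact: strip_nearest.
have hg := geod_geodesic hk hA a0 x0 t0 e0.
have nc := parabolic_normal hA (cyc hk i).
have [_ _ _ HD] := geodesic_in_chart hg nc.
have [d1 m1] := geod_chart_map hA x0 a0 st.
have [_ _ ->] := HD t (conj I d1).
rewrite -(geod_energy hA a0 x0 st) /energy.
have N := near_strip hA a0 st.
have N1 : \forall z \near t, (chart_map (phi (cyc hk i))
    (geod tau phi f hk a x0 e t0 z)).1 =
    xcoord tau f hk a x0 i (angle f hk a e t0 z).
  by apply: filterS N => z sz; have [_ ->] := geod_chart_map hA x0 a0 sz.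
have N2 : \forall z \near t, (chart_map (phi (cyc hk i))
    (geod tau phi f hk a x0 e t0 z)).2 = a * sin (angle f hk a e t0 z).
  by apply: filterS N => z sz; have [_ ->] := geod_chart_map hA x0 a0 sz.
have E1 : derive1 (fun z => (chart_map (phi (cyc hk i))
    (geod tau phi f hk a x0 e t0 z)).1) t = derive1 (fun z =>
    xcoord tau f hk a x0 i (angle f hk a e t0 z)) t.
  by rewrite !derive1E; exact: near_eq_derive.
have E2 : derive1 (fun z => (chart_map (phi (cyc hk i))
    (geod tau phi f hk a x0 e t0 z)).2) t = derive1 (fun z =>
    a * sin (angle f hk a e t0 z)) t.
  by rewrite !derive1E; exact: near_eq_derive.
by rewrite E1 E2 (nbhs_singleton N2).
Qed.

Lemma curve_length_geod a x0 e t0 T : 0 < a -> e != 0 -> 0 < T ->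
  curve_length g T (geod tau phi f hk a x0 e t0) = `|e| * T.
Proof.
move=> a0 e0 T0; rewrite /curve_length.
under eq_Rintegral do rewrite geod_sq_velocity// sqrtr_sqr.
rewrite Rintegral_cst//; congr (_ * _).
have := @lebesgue_measure_itv R `[0, T]%R.
by rewrite /= lte_fin T0 sube0 => /(congr1 fine).
Qed.

End Length.

(** * The Zoll condition *)

Section HalfLine.
Context {R : realType}.

Lemma smooth_derive1n (u : R -> R) n :
  smooth_on setT u -> smooth_on setT (derive1n n u).
Proof.
move=> su; elim: n => [//|n IH]; rewrite derive1nS; exact: smooth_on_derive1.
Qed.

(** All derivatives agree on the open half-line and pass to its end point [0] by continuity; the
    sign of [c] selects the side. *)
Lemma half_line_jet (u v : R -> R) (c : R) : c != 0 ->
  smooth_on setT u -> smooth_on setT v ->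
  (forall y, 0 < c * y -> u y = v y) ->
  forall n, derive1n n u 0 = derive1n n v 0.
Proof.
move=> c0 su sv uv n.
have oA : open [set y : R | 0 < c * y].
  rewrite (_ : [set y | _] = ( *%R c) @^-1` [set x | 0 < x]) //.
  apply: open_comp; last exact: open_gt.
  by move=> x _; apply: cvgMr; exact: cvg_id.
have E m y : 0 < c * y -> derive1n m u y = derive1n m v y.
  elim: m y => [|m IH] y hy; first by rewrite !derive1n0; exact: uv.
  by rewrite !derive1nS; apply: (near_derive1 oA hy) => z hz; exact: IH.
pose w y := derive1n n u y - derive1n n v y.
have cw : {for 0, continuous w}.
  apply: cvgB; apply: (smooth_on_continuous (smooth_derive1n n _)) => //.
apply/eqP; rewrite -subr_eq0 -[_ - _]/(w 0) -normr_le0.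
apply/ler_addgt0Pr => /= e e0; rewrite add0r.
have /nbhs_ballP[d /= d0 Hd] := continuous_near_dist cw e0.
pose z := Num.sg c * (d / 2).
have nz : ball 0 d z.
  rewrite -ball_normE /ball_ /= sub0r normrN /z normrM normr_sg c0 mul1r.
  by rewrite gtr0_norm ?divr_gt0// ltr_pdivrMr// ltr_pMr// ltr1n.
have hz : 0 < c * z.
  have cE : c * Num.sg c = `|c| by rewrite mulrC -normrEsg.
  rewrite (_ : c * z = c * Num.sg c * (d / 2)); last by rewrite /z !mulrA.
  by rewrite cE mulr_gt0 ?normr_gt0 ?divr_gt0.
have := Hd _ nz; rewrite /= {2}/w E// subrr subr0.
exact: ltW.
Qed.

End HalfLine.

(** * Integrals over one full turn *)

Section TurnSum.
Context {R : realType} {S : surface R} (g : lorentzian_metric S).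
Variables (k : nat) (tau : R) (phi : 'I_(2 * k) -> chart R S)
  (f : 'I_(2 * k) -> R -> R).
Hypotheses (hk : (1 <= k)%N) (hA : parabolic_atlas g tau phi f).

Lemma cyc_jet i n : derive1n n (f (cyc hk i)) 0 = derive1n n (f (cyc hk (i + 1))) 0.
Proof.
apply: (@half_line_jet _ _ _ (@sgc R k hk i)); [exact: sgc_neq0| | |].
- exact: (f_smooth hA).
- exact: (f_smooth hA).
by move=> y hy; have [-> _] := cycS hk i; exact: (f_ordS hA).
Qed.

Section Generic.
Variables (Psi : 'I_(2 * k) -> R -> R) (W : R -> R) (a : R).
Hypotheses (cPsi : forall j, continuous (Psi j)) (cW : continuous W).
Hypothesis Psi0 : forall i, Psi (cyc hk i) 0 = Psi (cyc hk (i + 1)) 0.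
Hypothesis WE : forall i th, strip i th -> W th = Psi (cyc hk i) (a * sin th).

Let cterm j (c : R) : continuous (fun x => Psi j (c * (a * sin x))).
Proof.
move=> x; apply: (@continuous_comp _ _ _ (fun x => c * (a * sin x)) (Psi j)).
  by apply: cvgMr; apply: cvgMr; exact: continuous_sin.
exact: cPsi.
Qed.

(** One turn is cut into [2k] intervals of length [pi]; on the [j]-th, [th = x + j pi] gives
    [a sin th = (-1)^j a sin x]. Stated for a general integrand because it serves both [drift] and
    [speed]. *)
Lemma prim_full_turn : prim W (full_turn k) =
  prim (fun x => \sum_j Psi j ((-1) ^+ j * (a * sin x))) pi.
Proof.
have p0 := @pi_gt0 R.
have step (m : nat) : prim W (m%:R * pi) =
    \sum_(j < m) prim (fun x => Psi (cyc hk (j : nat)%:Z)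
      (sgc hk (j : nat)%:Z * (a * sin x))) pi.
  elim: m => [|m IH]; first by rewrite mul0r big_ord0 prim0.
  rewrite big_ord_recr /= -IH [RHS]addrC.
  have -> : m.+1%:R * pi = pi + m%:R * pi :> R by rewrite -natr1; ring.
  apply/eqP; rewrite -subr_eq; apply/eqP; rewrite (prim_shift _ _ cW).
  apply: prim_eq_on; [| exact: cterm |exact: ltW|].
    move=> x; apply: (@continuous_comp _ _ _ (fun x => x + m%:R * pi) W).
      by apply: cvgD; [exact: cvg_id|exact: cvg_cst].
    exact: cW.
  move=> x /andP[x0 xp].
  have mE : (m%:R : R) = (m%:Z)%:~R by [].
  have sE : sgc hk m%:Z * sin x = sin (x + m%:R * pi).
    have := sin_shift hk m%:Z (x + m%:R * pi); rewrite mE addrK => ->.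
    by rewrite mulrA sgc_sqr mul1r.
  rewrite mulrCA sE.
  have [xlt|xge] := ltP x pi.
    apply: WE; apply/strip_shift; rewrite -mE addrK; apply/andP; split; lra.
  (* The right end point is outside the strip of [m]; there the next chart is used, at [y = 0],
     where [Psi0] identifies the two values. *)
  have xE : x = pi by apply/le_anti; rewrite xp xge.
  have s0 : sin (x + m%:R * pi) = 0.
    by rewrite -sE xE sinpi mulr0.
  rewrite (WE (i := m%:Z + 1)); last first.
    apply/strip_shift; rewrite intrD -mE xE.
    rewrite (_ : _ - _ = 0 :> R); last by ring.
    by rewrite oppr_lt0 p0.
  by rewrite s0 mulr0 -Psi0.
rewrite /full_turn step prim_sum; last by move=> j; exact: cterm.
by apply: eq_bigr => j _; rewrite /sgc cyc_ord.
Qed.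

End Generic.

(** The function [F] whose Abel transform is the drift over one turn, each chart contributing on the
    side where it is glued to the next one. In terms of [gg] it is visibly smooth at [0]. *)
Definition drift_sum (y : R) : R := \sum_j gg (f j) ((-1) ^+ j * y).

Lemma drift_sum_smooth : smooth_on setT drift_sum.
Proof.
have oT : open [set: R] by exact: openT.
have H (r : seq 'I_(2 * k)) :
    smooth_on setT (fun y : R => \sum_(j <- r) gg (f j) ((-1) ^+ j * y)).
  elim: r => [|j r IH].
    rewrite (_ : (fun y : R => _) = cst 0); first exact: smooth_on_cst.
    by apply/funext => y; rewrite big_nil.
  rewrite (_ : (fun y : R => _) = fun y : R => gg (f j) ((-1) ^+ j * y) +
    \sum_(j <- r) gg (f j) ((-1) ^+ j * y)).
    apply: smooth_onD => //.
    apply: (smooth_on_comp oT oT (fun _ _ => I)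
      (gg_smooth (f_smooth hA j) (f_lt1 hA j))).
    by apply: smooth_onZ => //; exact: smooth_on_id.
  by apply/funext => y; rewrite big_cons.
exact: H.
Qed.

Lemma sqr_drift_sum y : y ^+ 2 * drift_sum y =
  (2 * k)%:R - \sum_j hh (f j) ((-1) ^+ j * y).
Proof.
transitivity (\sum_(j < 2 * k) (1 - hh (f j) ((-1) ^+ j * y))).
  rewrite /drift_sum mulr_sumr; apply: eq_bigr => j _.
  by rewrite -(sqr_gg (f_lt1 hA j)) exprMn sqrr_sign mul1r.
by rewrite sumrB sumr_const card_ord.
Qed.

Lemma gg0 (u : R -> R) : gg u 0 = u 0 / 2.
Proof. by rewrite /gg /hh expr0n /= mul0r subr0 sqrtr1. Qed.

Lemma hh0 (u : R -> R) : hh u 0 = 1.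
Proof. by rewrite /hh expr0n /= mul0r subr0 sqrtr1. Qed.

Lemma prim_drift_full_turn a : 0 < a ->
  prim (drift f hk a) (full_turn k) = abel drift_sum a.
Proof.
move=> a0; apply: (@prim_full_turn (fun j => gg (f j))).
- move=> j x; apply: (smooth_on_continuous (gg_smooth (f_smooth hA j) (f_lt1 hA j))).
  by [].
- by move=> x; exact: (drift_continuous hA a0).
- by move=> i; rewrite !gg0; have := cyc_jet i 0; rewrite !derive1n0 => ->.
- by move=> i th st; exact: (driftE hk hA a0 st).
Qed.

(** By [sqr_drift_sum], vanishing of [drift_sum] means that the [hh] of all charts add up to [2k].
    The time of one turn, and with it the length, then no longer depends on the amplitude. *)
Lemma clock_full_turn a : 0 < a -> (forall y, 0 <= y -> drift_sum y = 0) ->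
  clock f hk a (full_turn k) = full_turn k.
Proof.
move=> a0 S0; rewrite /clock (@prim_full_turn (fun j => hh (f j)) _ a).
- have sE x : \sum_j hh (f j) ((-1) ^+ j * (a * sin x)) =
      (2 * k)%:R - (a * sin x) ^+ 2 * drift_sum (a * sin x).
    by rewrite sqr_drift_sum opprB addrC subrK.
  have cs : continuous (fun x => \sum_j hh (f j) ((-1) ^+ j * (a * sin x))).
    under eq_fun do rewrite sE.
    move=> x; apply: cvgB; first exact: cvg_cst.
    apply: (@continuous_comp _ _ _ (fun x => a * sin x)
      (fun y => y ^+ 2 * drift_sum y)).
      by apply: cvgMr; exact: continuous_sin.
    apply: cvgM; first exact: exprn_continuous.
    exact: (smooth_on_continuous drift_sum_smooth).
  rewrite (@prim_eq_on _ _ (fun=> (2 * k)%:R)) ?prim_cst//.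
  + by move=> x; exact: cvg_cst.
  + exact: pi_ge0.
  + move=> x hx; rewrite sE S0 ?mulr0 ?subr0//.
    by apply: mulr_ge0; [exact: ltW|exact: sin_ge0_pi].
- move=> j x; apply: (smooth_on_continuous (hh_smooth (f_smooth hA j) (f_lt1 hA j))).
  by [].
- by move=> x; exact: (speed_continuous hA a0).
- by move=> i; rewrite !hh0.
- by move=> i th st; exact: (speedE hk hA a0 st).
Qed.

End TurnSum.

Section Zoll.
Context {R : realType} {S : surface R} (g : lorentzian_metric S).
Variables (k : nat) (tau : R) (phi : 'I_(2 * k) -> chart R S)
  (f : 'I_(2 * k) -> R -> R).
Hypotheses (hk : (1 <= k)%N) (hA : parabolic_atlas g tau phi f).

Lemma spacelike_zoll_drift :
  spacelike_zoll g -> tau = 0 /\ forall y, 0 <= y -> drift_sum f y = 0.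
Proof.
case=> L HL.
have sS := drift_sum_smooth hA.
(* One test geodesic for each amplitude: its closedness yields one value of the Abel transform. *)
have hol a : 0 < a -> tau = a * abel (drift_sum f) a.
  move=> a0.
  have mg : maximal_geodesic g setT (geod tau phi f hk a 0 1 0).
    split; first exact: (geod_geodesic hk hA a0 0 0 (oner_neq0 R)).
    by move=> J gam _ TJ _; apply/seteqP; split.
  have sg : spacelike g setT (geod tau phi f hk a 0 1 0).
    by move=> t _; rewrite (geod_sq_velocity hk hA 0 0 t a0 (oner_neq0 R)) expr1n.
  have [_ [T [cT _]]] := HL _ _ mg sg.
  have := holonomy_eq0_of_closed hA a0 cT.
  by rewrite /holonomy (prim_drift_full_turn hk hA a0) => /eqP; rewrite subr_eq0 => /eqP.
have tau0 : tau = 0.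
  have [B B0 HB] := smooth_lipschitz (@ltr01 R) sS.
  (* A bound for [drift_sum] on [[0, 1]], so that the transform stays bounded and [a] times it tends
     to [0] with [a]. *)
  pose M := `|drift_sum f 0| + B.
  have M0 : 0 <= M by rewrite addr_ge0.
  have bound a : 0 < a <= 1 -> `|tau| <= a * (M * pi).
    move=> /andP[a0 a1]; rewrite (hol _ a0) normrM gtr0_norm// ler_pM2l//.
    apply: prim_bound; [|exact: pi_ge0|].
      move=> x; apply: (@continuous_comp _ _ _ (fun x => a * sin x) (drift_sum f)).
        by apply: cvgMr; exact: continuous_sin.
      exact: (smooth_on_continuous sS).
    move=> x hx; have s0 := sin_ge0_pi hx; have s1 := sin_le1 x.
    have u0 : 0 <= a * sin x by rewrite mulr_ge0// ltW.
    have u1 : a * sin x <= 1.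
      by rewrite -[1]mulr1; apply: ler_pM => //; exact: ltW.
    rewrite -[drift_sum f (a * sin x)](subrK (drift_sum f 0)) addrC.
    apply: (le_trans (ler_normD _ _)); rewrite lerD2l.
    have h1 : 0 <= a * sin x <= 1 by rewrite u0 u1.
    have h2 : 0 <= (0 : R) <= 1 by rewrite lexx ler01.
    apply: (le_trans (HB _ _ h1 h2)).
    by rewrite subr0 ger0_norm// -[leRHS]mulr1 ler_wpM2l.
  have P0 : 0 <= M * pi by rewrite mulr_ge0// pi_ge0.
  apply/eqP; rewrite -normr_le0; apply/ler_addgt0Pr => e e0; rewrite add0r.
  pose a := Num.min 1 (e / (M * pi + 1)).
  have d0 : 0 < M * pi + 1 by rewrite ltr_wpDl.
  have a0 : 0 < a by rewrite lt_min ltr01 divr_gt0.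
  have a1 : a <= 1 by rewrite ge_min lexx.
  have ae : a <= e / (M * pi + 1) by rewrite ge_min lexx orbT.
  apply: (le_trans (bound a _)); first by rewrite a0 a1.
  apply: (@le_trans _ _ (a * (M * pi + 1))).
    by rewrite ler_pM2l// lerDl.
  by rewrite -ler_pdivlMr.
split=> // y y0; apply: (abel_injective sS _ y0) => a a0.
have := hol _ a0; rewrite tau0 => /esym/eqP.
by rewrite mulf_eq0 (gt_eqF a0) => /eqP.
Qed.

Lemma spacelike_zoll_of_drift :
  tau = 0 -> (forall y, 0 <= y -> drift_sum f y = 0) -> spacelike_zoll g.
Proof.
move=> tau0 S0.
have hol a : 0 < a -> holonomy tau f hk a = 0.
  move=> a0; rewrite /holonomy (prim_drift_full_turn hk hA a0) tau0 /abel.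
  rewrite (@prim_eq_on _ _ (fun=> 0) pi); first by rewrite prim_cst mul0r mulr0 subr0.
  - move=> x; apply: (@continuous_comp _ _ _ (fun x => a * sin x) (drift_sum f)).
      by apply: cvgMr; exact: continuous_sin.
    exact: (smooth_on_continuous (drift_sum_smooth hA)).
  - by move=> x; exact: cvg_cst.
  - exact: pi_ge0.
  - move=> x hx; apply: S0; apply: mulr_ge0; first exact: ltW.
    exact: sin_ge0_pi.
exists (full_turn k) => J gam [hg hmax] hs.
have [a [e [t0 [x0 [a0 e0 E]]]]] := spacelike_geodesic_explicit hk hA hg hs.
(* The explicit geodesic extends [gam] to all times, so maximality forces the domain to be the whole
   line. *)
have JT : [set: R] = J.
  apply: (hmax _ _ (geod_geodesic hk hA a0 x0 t0 e0)) => // t Jt.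
  by rewrite E.
have -> : gam = geod tau phi f hk a x0 e t0.
  by apply/funext => t; apply: E; rewrite -JT.
split; first by rewrite JT.
exists (clock f hk a (full_turn k) / `|e|); split.
  exact: (geod_simply_closed hA a0 (hol _ a0)).
rewrite (curve_length_geod hk hA x0 t0 a0 e0); last first.
  by rewrite divr_gt0 ?normr_gt0//; exact: (clock_full_turn_gt0 hk hA a0).
by rewrite mulrC divfK ?normr_eq0// (clock_full_turn hk hA a0 S0).
Qed.

End Zoll.

(** * Charts of even and odd index *)

Section Parity.
Variable k : nat.

Lemma dbl_subproof (j : 'I_k) : (j.*2 < 2 * k)%N.
Proof. by rewrite mul2n ltn_double. Qed.
Definition dbl (j : 'I_k) : 'I_(2 * k) := Ordinal (dbl_subproof j).

Lemma odd_dbl j : odd (dbl j) = false.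
Proof. exact: odd_double. Qed.

Lemma val_ordS_dbl j : ordS (dbl j) = j.*2.+1 :> nat.
Proof.
rewrite /= modn_small// mul2n -[X in (X < _)%N]addn1.
have := ltn_ord j; lia.
Qed.

Lemma ordS_ordS_dbl j : ordS (ordS (dbl j)) = dbl (ordS j).
Proof.
apply: val_inj; rewrite [LHS]/= -[X in (X.+1 %% _)%N]/(ordS (dbl j) : nat).
by rewrite val_ordS_dbl /= -doubleS -!mul2n muln_modr.
Qed.

Lemma half_dbl (i : 'I_(2 * k)) (j : 'I_k) :
  j = i./2 %[mod k] -> i = if odd i then ordS (dbl j) else dbl j.
Proof.
have lt : (i./2 < k)%N by rewrite ltn_half_double -mul2n.
rewrite !modn_small// => E; apply: val_inj.
have := odd_double_half i; case: (odd i) => h.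
  by rewrite [RHS]val_ordS_dbl E -[LHS]h.
by rewrite /= E -[LHS]h.
Qed.

(** For odd [i] the upper half is [(i + 1) / 2], which wraps to [0] at [i = 2k - 1]; hence the
    cyclic successor of [i] on the left-hand side. *)
Lemma uphalf_dbl (i : 'I_(2 * k)) (j : 'I_k) :
  j = uphalf i %[mod k] -> if odd i then ordS i = dbl j else i = dbl j.
Proof.
have lt : (i./2 < k)%N by rewrite ltn_half_double -mul2n.
rewrite uphalf_half => E.
have h := odd_double_half i; case: (boolP (odd i)) => io; rewrite ?io in E h.
  pose l := Ordinal lt.
  have iE : i = ordS (dbl l) by apply: val_inj; rewrite [RHS]val_ordS_dbl -[LHS]h.
  rewrite iE ordS_ordS_dbl; congr dbl; apply: val_inj.
  by rewrite /= -E modn_small.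
rewrite (negbTE io) in E h.
by apply: val_inj; rewrite /= -[LHS]h -[in LHS](modn_small lt) -E modn_small.
Qed.

Lemma sum_parity {V : nmodType} (F : 'I_(2 * k) -> V) :
  \sum_i F i = \sum_(j < k) (F (dbl j) + F (ordS (dbl j))).
Proof.
pose h (p : 'I_k * bool) := if p.2 then ordS (dbl p.1) else dbl p.1.
have lt (i : 'I_(2 * k)) : (i./2 < k)%N by rewrite ltn_half_double -mul2n.
pose h' (i : 'I_(2 * k)) := (Ordinal (lt i), odd i).
have hK : cancel h h'.
  move=> [j b]; have [hj hb] : (h (j, b))./2 = j /\ odd (h (j, b)) = b.
    case: b; rewrite /h /fst /snd; last by rewrite odd_dbl /= doubleK.
    by rewrite val_ordS_dbl -[j.*2.+1]/(true + j.*2)%N half_bit_double oddD odd_double.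
  by rewrite /h' -[in RHS]hb; congr pair; exact: val_inj.
have h'K : cancel h' h.
  by move=> i; exact: (esym (@half_dbl i (Ordinal (lt i)) erefl)).
rewrite (reindex h) /=; last by exists h' => i _; [exact: hK|exact: h'K].
rewrite -(pair_bigA _ (fun j b => F (h (j, b)))) /=.
by apply: eq_bigr => j _; rewrite big_bool addrC.
Qed.

End Parity.

(** * From the metric coefficients to the functions kappa *)

Section Profiles.
Context {R : realType} {S : surface R} (g : lorentzian_metric S).
Variables (k : nat) (tau : R) (phi : 'I_(2 * k) -> chart R S)
  (f : 'I_(2 * k) -> R -> R).
Hypotheses (hk : (1 <= k)%N) (hA : parabolic_atlas g tau phi f).

(** The prescribed form of [f i], solved for the positive root [hh (f i)]; it is linear in [kappa]
    and free of the division by [y^2]. *)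
Definition profiles (kappa : 'I_k -> R -> R) : Prop :=
  forall (i : 'I_(2 * k)) (j : 'I_k) (y : R),
    (j = i./2 %[mod k] -> 0 < y -> hh (f i) y = 1 + kappa j y) /\
    (j = uphalf i %[mod k] -> y < 0 -> hh (f i) y = 1 + kappa j y).

Lemma sqr_drift_sum_profiles kappa y : profiles kappa -> 0 < y ->
  y ^+ 2 * drift_sum f y = - \sum_j (kappa j y + kappa j (- y)).
Proof.
move=> P y0; rewrite (sqr_drift_sum hA) sum_parity.
have sgn_dbl (j : 'I_k) : (-1) ^+ dbl j = 1 :> R by rewrite -signr_odd odd_dbl expr0.
have sgn_ordS (j : 'I_k) : (-1) ^+ ordS (dbl j) = -1 :> R.
  by rewrite -signr_odd odd_ordS odd_dbl expr1.
transitivity ((2 * k)%:R - (\sum_(j < k) (1 + kappa j y) +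
    \sum_(j < k) (1 + kappa (ordS j) (- y)))).
  congr (_ - _); rewrite -big_split /=; apply: eq_bigr => j _.
  rewrite sgn_dbl sgn_ordS mul1r mulN1r; congr (_ + _).
    by apply: (P _ j y).1 => //; rewrite /= doubleK.
  apply: (P _ (ordS j) (- y)).2; last by rewrite oppr_lt0.
  by rewrite val_ordS_dbl /= modn_mod doubleK.
(* On [y < 0] the chart [2j + 1] involves [kappa] of index [j + 1]; a cyclic shift of the sum
   restores the index [j]. *)
rewrite -(reindex_inj (@ordS_inj k) (P := xpredT) (F := fun j => 1 + kappa j (- y))).
rewrite !big_split /= !sumr_const card_ord natrM.
by rewrite /= -!/(k%:R); ring.
Qed.

Lemma profiles_zoll_drift kappa : profiles kappa ->
  (forall y, 0 <= y -> drift_sum f y = 0) <->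
  (forall y, 0 < y -> \sum_j (kappa j y + kappa j (- y)) = 0).
Proof.
move=> P; split => H y y0.
  have := sqr_drift_sum_profiles P y0.
  by rewrite H ?ltW// mulr0 => /esym/eqP; rewrite oppr_eq0 => /eqP.
have H' z : 0 < 1 * z -> drift_sum f z = cst 0 z.
  rewrite mul1r => z0; have := sqr_drift_sum_profiles P z0.
  rewrite H// oppr0 => /eqP; rewrite mulf_eq0 sqrf_eq0 (gt_eqF z0) /= => /eqP.
  exact.
(* The relation with [kappa] carries a factor [y^2] and says nothing at [0]; there the value follows
   from those on [y > 0] by continuity. *)
have [->|yn0] := eqVneq y 0.
  have s0 : smooth_on setT (cst 0 : R -> R) by exact: smooth_on_cst.
  have := half_line_jet (oner_neq0 R) (drift_sum_smooth hA) s0 H' 0.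
  by rewrite !derive1n0.
by rewrite H' ?mul1r// lt_def yn0.
Qed.

(** The bound [-1 <= kappa] is what selects [1 + kappa] as the nonnegative square root. *)
Lemma profiles_of_metric kappa :
  (forall j y, -1 <= kappa j y) ->
  (forall (i : 'I_(2 * k)) (j : 'I_k) (y : R),
    (j = i./2 %[mod k] -> 0 < y ->
       f i y = (1 - (1 + kappa j y) ^+ 2) / y ^+ 2) /\
    (j = uphalf i %[mod k] -> y < 0 ->
       f i y = (1 - (1 + kappa j y) ^+ 2) / y ^+ 2)) ->
  profiles kappa.
Proof.
move=> k1 H.
have E u (j : 'I_k) y : y != 0 -> u y = (1 - (1 + kappa j y) ^+ 2) / y ^+ 2 ->
    hh u y = 1 + kappa j y.
  move=> y0 e; rewrite /hh e mulrC divfK ?sqrf_eq0// opprB addrC subrK sqrtr_sqr.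
  by rewrite ger0_norm// -lerBlDl sub0r.
move=> i j y; split=> hj hy; apply: E.
- by rewrite gt_eqF.
- exact: (H i j y).1.
- by rewrite lt_eqF.
- exact: (H i j y).2.
Qed.

Lemma metric_of_profiles kappa : profiles kappa ->
  forall (i : 'I_(2 * k)) (j : 'I_k) (y : R),
    (j = i./2 %[mod k] -> 0 < y ->
       f i y = (1 - (1 + kappa j y) ^+ 2) / y ^+ 2) /\
    (j = uphalf i %[mod k] -> y < 0 ->
       f i y = (1 - (1 + kappa j y) ^+ 2) / y ^+ 2).
Proof.
move=> P i j y.
have E : y != 0 -> hh (f i) y = 1 + kappa j y ->
    f i y = (1 - (1 + kappa j y) ^+ 2) / y ^+ 2.
  move=> y0 <-; rewrite (hh_sqr (f_lt1 hA i)) opprB addrC subrK.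
  by rewrite [y ^+ 2 * _]mulrC mulfK ?sqrf_eq0.
split=> hj hy; apply: E.
- by rewrite gt_eqF.
- exact: (P i j y).1.
- by rewrite lt_eqF.
- exact: (P i j y).2.
Qed.

Definition profile (i : 'I_(2 * k)) (y : R) : R := hh (f i) y - 1.

Lemma profile_smooth i : smooth_on setT (profile i).
Proof.
apply: smooth_onD; [exact: openT| |exact: smooth_on_cst].
exact: (hh_smooth (f_smooth hA i) (f_lt1 hA i)).
Qed.

Lemma profile_ordS (j : 'I_(2 * k)) (y : R) : 0 < (-1) ^+ j * y -> profile j y = profile (ordS j) y.
Proof. by move=> hy; rewrite /profile /hh (f_ordS hA hy). Qed.

Lemma profile_jet n i i' : derive1n n (profile i) 0 = derive1n n (profile i') 0.
Proof.
have H (m : nat) : derive1n n (profile (cyc hk m)) 0 =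
    derive1n n (profile (cyc hk 0)) 0.
  elim: m => [//|m <-]; rewrite intS addrC; have [-> _] := cycS hk m.
  apply/esym/(@half_line_jet _ _ _ ((-1) ^+ cyc hk m)).
  - by rewrite signr_eq0.
  - exact: profile_smooth.
  - exact: profile_smooth.
  - by move=> y; exact: profile_ordS.
by rewrite -[in LHS](cyc_ord hk i) -[in RHS](cyc_ord hk i') !H.
Qed.

Lemma profile_vertex i : profile i 0 = 0 /\ derive1 (profile i) 0 = 0.
Proof.
split; first by rewrite /profile hh0 subrr.
have sh := hh_smooth (f_smooth hA i) (f_lt1 hA i).
have Dh : is_derive (0 : R) 1 (hh (f i)) (derive1 (hh (f i)) 0).
  exact: smooth_on_is_derive.
have D : is_derive (0 : R) 1 (profile i) (derive1 (hh (f i)) 0).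
  rewrite -[X in is_derive _ _ _ X]subr0.
  have Dc : is_derive (0 : R) 1 (cst 1 : R -> R) 0 by exact: is_derive_cst.
  exact: (is_deriveB Dh Dc).
rewrite derive1E (@derive_val _ _ _ _ _ _ _ D).
have := hh_derive (f_smooth hA i) (f_lt1 hA i) 0.
rewrite hh0 mulr1 mulr0 mul0r expr0n /= mul0r addr0 oppr0 => /eqP.
by rewrite mulf_eq0 pnatr_eq0 /= => /eqP.
Qed.

(** The chart [2j] shares [y > 0] with the chart [2j + 1] and [y < 0] with the chart [2j - 1], so
    its profile serves all three. *)
Lemma profiles_profile : profiles (fun j => profile (dbl j)).
Proof.
move=> i j y; split=> [/half_dbl iE y0|/uphalf_dbl iE y0].
- rewrite /profile addrC subrK iE; case: odd => //.
  by rewrite /hh -(f_ordS hA (j := dbl j))// -signr_odd odd_dbl expr0 mul1r.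
- rewrite /profile addrC subrK; case: (boolP (odd i)) iE => [io <-|_ -> //].
  by rewrite /hh -(f_ordS hA (j := i))// -signr_odd io expr1 mulN1r oppr_gt0.
Qed.

End Profiles.

Theorem theorem5p6 (R : realType) (C : surface R) (g : lorentzian_metric C)
    (k : nat) (tau : R) (phi : 'I_(2 * k) -> chart R C)
    (f : 'I_(2 * k) -> R -> R)
    (hk : (1 <= k)%N) (hC : cylinder C) (hA : parabolic_atlas g tau phi f) :
  spacelike_zoll g <->
  tau = 0 /\
  exists kappa : 'I_k -> R -> R,
    [/\ forall j, smooth_on setT (kappa j),
        forall (j : 'I_k) (t : R), -1 <= kappa j t,
        (forall n j j', (kappa j)^`(n) 0 = (kappa j')^`(n) 0) /\
        (forall j, kappa j 0 = 0 /\ (kappa j)^`() 0 = 0),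
        forall t : R, \sum_(j < k) kappa j (- t) = - \sum_(j < k) kappa j t &
        forall (i : 'I_(2 * k)) (j : 'I_k) (y : R),
          (j = i./2 %[mod k] -> 0 < y ->
             f i y = (1 - (1 + kappa j y) ^+ 2) / y ^+ 2) /\
          (j = uphalf i %[mod k] -> y < 0 ->
             f i y = (1 - (1 + kappa j y) ^+ 2) / y ^+ 2)].
Proof.
split=> [zoll|[tau0 [kappa [_ k1 _ kodd kf]]]].
  have [tau0 S0] := spacelike_zoll_drift hk hA zoll.
  have P := profiles_profile hA.
  have sum0 := (profiles_zoll_drift hA P).1 S0.
  split=> //; exists (fun j => profile f (dbl j)); split.
  - by move=> j; exact: (profile_smooth hA).
  - move=> j t; rewrite /profile lerBrDl subrr ltW//.
    exact: (hh_gt0 (f_lt1 hA _)).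
  - split=> [n j j'|j]; first exact: (profile_jet hk hA).
    exact: (profile_vertex hA).
  - have odd_pos t : 0 < t -> \sum_(j < k) profile f (dbl j) (- t) =
        - \sum_(j < k) profile f (dbl j) t.
      by move=> /sum0; rewrite big_split /= addrC => /eqP; rewrite addr_eq0 => /eqP.
    (* The vanishing sums concern [t > 0] only: at [0] each profile vanishes, and [t < 0] reduces to
       [- t]. *)
    move=> t; have [->|] := eqVneq t 0.
      rewrite (_ : - 0 = 0 :> R); last exact: oppr0.
      by rewrite big1 ?oppr0// => j _; have [] := profile_vertex hA (dbl j).
    rewrite neq_lt => /orP[t0|]; last exact: odd_pos.
    by have := odd_pos (- t); rewrite opprK oppr_gt0 => -> //; rewrite opprK.
  - exact: (metric_of_profiles hA P).
apply: (spacelike_zoll_of_drift hk hA tau0).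
apply/(profiles_zoll_drift hA (profiles_of_metric k1 kf)) => y _.
by rewrite big_split /= kodd subrr.
Qed.
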